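(* Let $d\in\mathbb{N}$. The theory of super $d$-scaled lattices (in the language $\mathcal{L}_{\mathrm{SC}_d}$) is the model-completion of the theory of $d$-subscaled lattices.
   Context: Conventions: $\mathbb{N}=\{0,1,2,\dots\}$. Lattices have a least element $\mathbf 0$ and a greatest element $\mathbf 1$ ($\mathbf 0=\mathbf 1$ is allowed), in the language $\mathcal{L}_{\mathrm{lat}}=\{\mathbf 0,\mathbf 1,\vee,\wedge\}$; an empty join is $\mathbf 0$. In a lattice, $b\ll a$ means: $b\le a\ne\mathbf 0$ and for every $c<a$ one has $b\vee c<a$. A TC-lattice is a lattice with an additional binary operation $-$ such that $a-b$ is the least element $c$ with $a\le b\vee c$ (it is then distributive); $\mathcal{L}_{\mathrm{TC}}=\mathcal{L}_{\mathrm{lat}}\cup\{-\}$. For $d\in\mathbb{N}$, $\mathcal{L}_{\mathrm{SC}_d}=\mathcal{L}_{\mathrm{TC}}\cup\{\mathrm{C}^0,\dots,\mathrm{C}^d\}$ with unary function symbols $\mathrm{C}^i$. Put $\operatorname{sc-dim} a=\min\{l\in\{-1,0,\dots,d\}: a=\bigvee_{0\le i\le l}\mathrm{C}^i(a)\}$ ($\infty$ if there is no such $l$). A $d$-subscaled lattice is an $\mathcal{L}_{\mathrm{SC}_d}$-structure which is a TC-lattice and satisfies, for all elements $a,b$: (1) $\bigvee_{0\le i\le d}\mathrm{C}^i(a)=a$; (2) for all $I\subseteq\{0,\dots,d\}$ and all $k$: $\mathrm{C}^k(\bigvee_{i\in I}\mathrm{C}^i(a))$ equals $\mathrm{C}^k(a)$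 if $k\in I$ and $\mathbf 0$ if $k\notin I$; (3) for $k\ge\max(\operatorname{sc-dim}a,\operatorname{sc-dim}b)$: $\mathrm{C}^k(a\vee b)=\mathrm{C}^k(a)\vee\mathrm{C}^k(b)$; (4) for $i\ne j$: $\operatorname{sc-dim}(\mathrm{C}^i(a)\wedge\mathrm{C}^j(a))<\min(i,j)$; (5) for $k\ge\operatorname{sc-dim}b$: $\mathrm{C}^k(a)-b=\mathrm{C}^k(a)-\mathrm{C}^k(b)$; (6) if $b\ll a$ then $\operatorname{sc-dim}b<\operatorname{sc-dim}a$. The lattice dimension $\dim_L a$ is the supremum of the $n\in\mathbb{N}$ such that there is a chain $\mathbf p_0\subsetneq\dots\subsetneq\mathbf p_n$ of (proper) prime filters of $L$ all containing $a$ ($-1$ if there is none, $\infty$ if unbounded). A $d$-scaled lattice is a $d$-subscaled lattice $L$ in which $\operatorname{sc-dim}a=\dim_L a$ for all $a$ (this is an elementary condition). An element $a$ is $k$-pure if for every $b$, $a-b\ne\mathbf 0$ implies $\dim_L(a-b)=k$; it has pure dimension $k$ if moreover $a\neq\mathbf 0$. A super $d$-scaled lattice is a $d$-subscaled lattice $L$ satisfying: - Scaling: $L$ is a $d$-scaled lattice. - Catenarity: for all $r\le q\le p$ in $\mathbb{N}$ and all $c\le a$ in $L$, if $a$ has pure dimension $p$ and $c$ has pure dimension $r$ then there is a $q$-pure element $b$ with $c\le b\le a$. - Splitting: for all $b_1,b_2,a$, if $b_1\vee b_2\ll a$ then there are non-zero elements $a_1\ge b_1$ and $a_2\ge b_2$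 such that $a_1=a-a_2$, $a_2=a-a_1$ and $a_1\wedge a_2=b_1\wedge b_2$. *)

(* Defs.v *)
From mathcomp Require Import all_boot all_order all_algebra.
From mathcomp Require Import boolp classical_sets constructive_ereal.

Set Implicit Arguments.
Unset Strict Implicit.
Unset Printing Implicit Defensive.

Import Order.TTheory GRing.Theory Num.Theory.

Local Open Scope classical_set_scope.

(** * First-order logic over purely functional languages *)

(* There are no relation symbols, so the atomic formulas are the equations
   between terms. *)
Record language := Language {
  func : Type;
  arity : func -> nat }.

Record structure (L : language) := Structure {
  carrier :> Type;
  carrier_inh : inhabited carrier;
  interp : forall f : func L, ('I_(arity f) -> carrier) -> carrier }.

Arguments interp {L} M f args : rename.

(* [term L n] and [formula L n] are the terms and formulas whose free variables
   are among n given ones; [All] binds the variable of index 0 and shifts the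
   others by one. *)
Inductive term (L : language) (n : nat) : Type :=
| Var of 'I_n
| App (f : func L) of ('I_(arity f) -> term L n).

Inductive formula (L : language) : nat -> Type :=
| Eq n : term L n -> term L n -> formula L n
| Fls n : formula L n
| Imp n : formula L n -> formula L n -> formula L n
| All n : formula L n.+1 -> formula L n.

Arguments Var {L n}.
Arguments App {L n}.
Arguments Eq {L n}.
Arguments Fls {L n}.
Arguments Imp {L n}.
Arguments All {L n}.

Definition Neg (L : language) (n : nat) (phi : formula L n) : formula L n :=
  Imp phi Fls.

Definition sentence (L : language) := formula L 0.

Definition scons (T : Type) (n : nat) (a : T) (v : 'I_n -> T) (i : 'I_n.+1) : T :=
  if unlift ord0 i is Some j then v j else a.

Fixpoint eval (L : language) (M : structure L) (n : nat) (v : 'I_n -> M)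
    (t : term L n) : M :=
  match t with
  | Var i => v i
  | App f ts => interp M f (fun i => eval v (ts i))
  end.

Fixpoint sat (L : language) (M : structure L) (n : nat) (phi : formula L n) :
    ('I_n -> M) -> Prop :=
  match phi in formula _ n return ('I_n -> M) -> Prop with
  | @Eq _ n t u => fun v => eval v t = eval v u
  | @Fls _ n => fun _ => False
  | @Imp _ n p q => fun v => sat p v -> sat q v
  | @All _ n p => fun v => forall a : M, sat p (scons a v)
  end.

Definition no_var (T : Type) (i : 'I_0) : T :=
  match notF (ltn_ord i) with end.

Definition holds (L : language) (M : structure L) (phi : sentence L) : Prop :=
  sat phi (@no_var M).

Definition theory (L : language) := set (sentence L).

Definition models (L : language) (M : structure L) (T : theory L) : Prop :=
  forall phi, T phi -> holds M phi.

Definition entails (L : language) (T : theory L) (phi : sentence L) : Prop :=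
  forall M : structure L, models M T -> holds M phi.

Definition theory_of (L : language) (K : set (structure L)) : theory L :=
  [set phi | forall M : structure L, K M -> holds M phi].

Definition embedding (L : language) (M N : structure L) (h : M -> N) : Prop :=
  injective h /\
  forall (f : func L) (xs : 'I_(arity f) -> M),
    h (interp M f xs) = interp N f (h \o xs).

(** ** Diagrams and model-completions *)

(* L(M): a new constant [inr m] for each element m of M. *)
Definition add_consts (L : language) (C : Type) : language :=
  @Language (func L + C)%type
    (fun f => match f with inl g => arity g | inr _ => 0 end).

Definition name_all (L : language) (M : structure L) :
    structure (add_consts L M) :=
  @Structure (add_consts L M) M (carrier_inh M)
    (fun f => match f
        return ('I_(@arity (add_consts L M) f) -> M) -> M with
      | inl g => interp M g
      | inr m => fun _ => m
      end).

Fixpoint lift_term (L : language) (C : Type) (n : nat) (t : term L n) :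
    term (add_consts L C) n :=
  match t with
  | Var i => Var i
  | App f ts => @App (add_consts L C) n (inl f) (fun i => lift_term C (ts i))
  end.

Fixpoint lift_formula (L : language) (C : Type) (n : nat) (phi : formula L n) :
    formula (add_consts L C) n :=
  match phi with
  | @Eq _ n t u => Eq (lift_term C t) (lift_term C u)
  | @Fls _ n => Fls
  | @Imp _ n p q => Imp (lift_formula C p) (lift_formula C q)
  | @All _ n p => All (lift_formula C p)
  end.

Arguments lift_formula {L} C {n} phi.

Definition diagram (L : language) (M : structure L) :
    theory (add_consts L M) :=
  [set phi | holds (name_all M) phi /\
     exists t u : term (add_consts L M) 0, phi = Eq t u \/ phi = Neg (Eq t u)].

Arguments diagram {L} M _.

Definition complete (L : language) (T : theory L) : Prop :=
  (exists M : structure L, models M T) /\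
  forall phi : sentence L, entails T phi \/ entails T (Neg phi).

(* Robinson's definition: [T'] extends [T], every model of [T] embeds in a model
   of [T'], and [T'] together with the diagram of any model of [T] is
   complete. *)
Definition is_model_completion (L : language) (T' T : theory L) : Prop :=
  [/\ forall phi : sentence L, T phi -> entails T' phi,
      forall M : structure L, models M T ->
        exists (N : structure L) (h : M -> N), models N T' /\ embedding h
    & forall M : structure L, models M T ->
        complete ([set lift_formula M phi | phi in T'] `|` diagram M)].

(** * The language of d-subscaled lattices *)

Inductive SC_func (d : nat) : Type :=
| SCbot | SCtop | SCjoin | SCmeet | SCminus | SCcomp of 'I_d.+1.

Arguments SCbot {d}.
Arguments SCtop {d}.
Arguments SCjoin {d}.
Arguments SCmeet {d}.
Arguments SCminus {d}.

Definition SC_arity (d : nat) (f : SC_func d) : nat :=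
  match f with
  | SCbot | SCtop => 0
  | SCjoin | SCmeet | SCminus => 2
  | SCcomp _ => 1
  end.

Definition L_SC (d : nat) : language := Language (@SC_arity d).

Section SubscaledLattices.

Variables (d : nat) (L : structure (L_SC d)).

Definition bot : L := @interp (L_SC d) L SCbot (@no_var L).
Definition top : L := @interp (L_SC d) L SCtop (@no_var L).
Definition join (a b : L) : L := @interp (L_SC d) L SCjoin (tnth [tuple a; b]).
Definition meet (a b : L) : L := @interp (L_SC d) L SCmeet (tnth [tuple a; b]).
Definition minus (a b : L) : L := @interp (L_SC d) L SCminus (tnth [tuple a; b]).
Definition Cpart (i : 'I_d.+1) (a : L) : L :=
  @interp (L_SC d) L (SCcomp i) (tnth [tuple a]).

Definition latle (a b : L) : Prop := join a b = b.
Definition latlt (a b : L) : Prop := latle a b /\ a <> b.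

Definition is_lattice : Prop :=
  [/\ commutative join /\ commutative meet,
      associative join /\ associative meet,
      (forall a b, join a (meet a b) = a) /\ (forall a b, meet a (join a b) = a)
    & forall a, latle bot a /\ latle a top].

Definition is_TC_lattice : Prop :=
  is_lattice /\
  forall a b, latle a (join b (minus a b)) /\
    forall c, latle a (join b c) -> latle (minus a b) c.

Definition strongly_below (b a : L) : Prop :=
  [/\ latle b a, a <> bot & forall c, latlt c a -> latlt (join b c) a].

(* The join is a finite iteration starting from [bot]; in particular the value
   l = -1 stands for the empty join.  The infimum of a non-empty set of integers
   bounded below is its minimum, and +oo is the value for the empty set. *)
Definition scdim (a : L) : \bar int :=
  infimum +oo%E [set l%:E%E | l in [set l : int |
    ((-1 <= l)%R /\ (l <= d%:Z)%R) /\
    a = \big[join/bot]_(i < d.+1 | ((i : nat)%:Z <= l)%R) Cpart i a]].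

Definition is_subscaled : Prop :=
  [/\ is_TC_lattice,
      forall a, \big[join/bot]_(i < d.+1) Cpart i a = a
   & [/\
      forall (a : L) (I : {set 'I_d.+1}) (k : 'I_d.+1),
        Cpart k (\big[join/bot]_(i in I) Cpart i a) =
          if k \in I then Cpart k a else bot,
      forall (a b : L) (k : 'I_d.+1),
        (Order.max (scdim a) (scdim b) <= (k : nat)%:Z%:E)%E ->
        Cpart k (join a b) = join (Cpart k a) (Cpart k b),
      forall (a : L) (i j : 'I_d.+1), i != j ->
        (scdim (meet (Cpart i a) (Cpart j a)) < (minn i j)%:Z%:E)%E,
      forall (a b : L) (k : 'I_d.+1), (scdim b <= (k : nat)%:Z%:E)%E ->
        minus (Cpart k a) b = minus (Cpart k a) (Cpart k b)
    & forall a b : L, strongly_below b a -> (scdim b < scdim a)%E]].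

(** ** Lattice dimension *)

Definition prime_filter (p : set L) : Prop :=
  [/\ p top /\ ~ p bot,
      forall a b, p a -> latle a b -> p b,
      forall a b, p a -> p b -> p (meet a b)
    & forall a b, p (join a b) -> p a \/ p b].

Definition prime_chain (a : L) (n : nat) : Prop :=
  exists p : 'I_n.+1 -> set L,
    (forall i, prime_filter (p i) /\ p i a) /\
    (forall i j : 'I_n.+1, (j : nat) = i.+1 -> p i `<` p j).

(* In the totally ordered set of extended integers, the supremum of an unbounded
   set of natural numbers is +oo. *)
Definition latdim (a : L) : \bar int :=
  supremum (-1)%:E%E [set n%:Z%:E%E | n in prime_chain a].

Definition is_scaled : Prop :=
  is_subscaled /\ forall a, scdim a = latdim a.

Definition pure (k : nat) (a : L) : Prop :=
  forall b, minus a b <> bot -> latdim (minus a b) = k%:Z%:E%E.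

Definition pure_dim (k : nat) (a : L) : Prop := a <> bot /\ pure k a.

Definition catenarity : Prop :=
  forall (r q p : nat) (c a : L), r <= q -> q <= p -> latle c a ->
    pure_dim p a -> pure_dim r c ->
    exists b, [/\ pure q b, latle c b & latle b a].

Definition splitting : Prop :=
  forall b1 b2 a : L, strongly_below (join b1 b2) a ->
    exists a1 a2 : L,
      [/\ a1 <> bot /\ a2 <> bot,
          latle b1 a1 /\ latle b2 a2,
          a1 = minus a a2 /\ a2 = minus a a1
        & meet a1 a2 = meet b1 b2].

Definition is_super_scaled : Prop :=
  [/\ is_scaled, catenarity & splitting].

End SubscaledLattices.

(* Main.v *)
(** A d-subscaled lattice M is dual to its prime spectrum: a poset X with a strictly
    increasing dimension X -> {0,...,d}.  M becomes a lattice of down-sets of X, in which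
    a - b is the down-set generated by a \ b, and C^i(a) the one generated by the
    maximal points of a of dimension i; embeddings are dual to projections which lift
    inequalities upwards.

    Every subscaled lattice embeds in a super scaled one: alternate two refinements of X,
    one adding points to fill the gaps in the dimensions of chains, the other splitting
    every down-set along all possible pairs (B1, B2), and take the inverse limit.

    Super scaled lattices are related by a back-and-forth of finite partial isomorphisms,
    that is, of projections of both spectra onto a common finite poset P.  An element a
    is captured by refining P, by induction on dim a, through steps replacing a point y
    of P by two points; such a step can be copied into any super scaled lattice, by
    splitting and catenarity.  The two models to be compared contain a common subscaled
    lattice, finitely many elements of which lie in a finite quotient of its spectrum:
    this starts the back-and-forth. *)

From mathcomp Require Import all_boot all_order all_algebra.
From mathcomp Require Import boolp classical_sets constructive_ereal.
From mathcomp Require Import zify.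
Require Import Defs.

Set Implicit Arguments.
Unset Strict Implicit.
Unset Printing Implicit Defensive.

Import Order.TTheory GRing.Theory Num.Theory.

Local Open Scope classical_set_scope.

(** Both theories consist of all sentences true in a class, so one must know which properties pass
    to their models, and dimension by chains of prime filters is not visibly first-order. Chains
    strictly lose dimension, hence the lattice dimension never exceeds [scdim], and Scaling reduces
    to this: below each nonzero element equal to its component of degree [k+1] lies a nonzero one
    equal to its component of degree [k]. All the axioms then become schemes of sentences. The
    obstacle in capturing an element is that splitting [y] requires the traces of both halves on the
    points below [y] to be unions of fibres, whereas refining these lower points changes the poset,
    and possibly the fibre of [y] itself. The traces have smaller dimension than the element, and a
    refinement along a set of dimension [< k] does not separate points of dimension [>= k] that
    shared a fibre; so the preparatory work does not increase the count on which the induction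
    rests. *)

Lemma sval_inj (A : Type) (P : A -> Prop) : injective (@proj1_sig A P).
Proof. by move=> [x Px] [y Py] /= xy; apply: eq_exist. Qed.

(** * Posets with a dimension *)

Record dpos (T : Type) := DPos {
  ple : T -> T -> Prop;
  dm : T -> nat;
  ple_refl : forall x, ple x x;
  ple_trans : forall y x z, ple x y -> ple y z -> ple x z;
  dm_lt : forall x y, ple x y -> x <> y -> dm x < dm y }.

Section Dpos.
Variables (T : Type) (o : dpos T).
Implicit Types (x y z : T) (A B : set T).

Lemma dm_le x y : ple o x y -> dm o x <= dm o y.
Proof.
move=> xy; have [->//|ne] := pselect (x = y).
exact: ltnW (dm_lt xy ne).
Qed.

Lemma ple_dm_eq x y : ple o x y -> dm o y <= dm o x -> x = y.
Proof.
move=> xy yx; apply: contrapT => ne.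
by move: (dm_lt xy ne); rewrite ltnNge yx.
Qed.

Lemma ple_anti x y : ple o x y -> ple o y x -> x = y.
Proof. by move=> xy yx; apply: ple_dm_eq => //; apply: dm_le. Qed.

Definition down A := forall x y, ple o x y -> A y -> A x.

Definition dsub A B : set T :=
  [set x | exists y, [/\ ple o x y, A y & ~ B y]].

Definition maxin A y := A y /\ forall z, ple o y z -> A z -> z = y.

Definition cpt (i : nat) A : set T :=
  [set x | exists y, [/\ ple o x y, maxin A y & dm o y = i]].

Lemma down_dsub A B : down (dsub A B).
Proof.
move=> x y xy [z [yz Az Bz]]; exists z; split=> //.
exact: ple_trans xy yz.
Qed.

Lemma down_cpt i A : down (cpt i A).
Proof.
move=> x y xy [z [yz Az Bz]]; exists z; split=> //.
exact: ple_trans xy yz.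
Qed.

Lemma dsub_sub A B : down A -> dsub A B `<=` A.
Proof. by move=> dA x [y [xy Ay _]]; apply: dA Ay. Qed.

Lemma cpt_sub i A : down A -> cpt i A `<=` A.
Proof. by move=> dA x [y [xy [Ay _] _]]; apply: dA Ay. Qed.

Lemma cpt_dm i A x : cpt i A x -> dm o x <= i.
Proof. by move=> [y [xy _ <-]]; apply: dm_le. Qed.

Lemma pure_top k A x : cpt k A = A -> A x ->
  exists y, [/\ ple o x y, A y & dm o y = k].
Proof. by move=> {1}<- [y [xy [Ay _] ky]]; exists y. Qed.

Lemma pure_dm k A x : cpt k A = A -> A x -> dm o x <= k.
Proof. by move=> {1}<- /cpt_dm. Qed.

Lemma pureP k A : down A -> (forall x, A x -> dm o x <= k) ->
  (forall x, A x -> exists y, [/\ ple o x y, A y & dm o y = k]) ->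
  cpt k A = A.
Proof.
move=> dA Ak tA; apply/seteqP; split; first exact: cpt_sub.
move=> x /tA [y [xy Ay ky]]; exists y; split=> //; split=> // z yz Az.
by apply/esym/(ple_dm_eq yz); rewrite ky; apply: Ak.
Qed.

Definition dbound D := forall x, dm o x < D.

Lemma max_above D A x : dbound D -> A x -> exists y, ple o x y /\ maxin A y.
Proof.
move=> bD; have [n] := ubnP (D - dm o x); elim: n x => // n IHn x.
rewrite ltnS => xn Ax.
have [?|nmax] := pselect (maxin A x); first by exists x; split=> //; exact: ple_refl.
have [z [xz Az zx]] : exists z, [/\ ple o x z, A z & z <> x].
  apply: contrapT => nz; apply: nmax; split=> // z xz Az.
  by apply: contrapT => zx; apply: nz; exists z.
have [|y [zy my]] := IHn z _ Az.
  have := dm_lt xz (nesym zx); have := bD x; have := bD z; move: xn; clear.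
  by lia.
by exists y; split=> //; apply: ple_trans xz zy.
Qed.

End Dpos.

(* Preimage under such a map commutes with [dsub] and [cpt]: these maps are the duals
   of the embeddings of subscaled lattices. *)
Record pmor (T : Type) (o : dpos T) (T' : Type) (o' : dpos T') (f : T -> T') := PMor {
  pm_mono : forall x y, ple o x y -> ple o' (f x) (f y);
  pm_dm : forall x, dm o x <= dm o' (f x);
  pm_lift : forall x q, ple o' (f x) q ->
    exists y, [/\ ple o x y, f y = q & dm o y = dm o' q];
  pm_surj : forall q, exists x, f x = q }.

Section Pmor.
Variables (T : Type) (o : dpos T) (T' : Type) (o' : dpos T') (f : T -> T').
Hypothesis pf : pmor o o' f.

Lemma pm_top q : exists x, f x = q /\ dm o x = dm o' q.
Proof.
have [x xq] := pm_surj pf q.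
have [|y [_ yq dq]] := pm_lift pf (x := x) (q := q).
  by rewrite xq; apply: ple_refl.
by exists y.
Qed.

Lemma pm_down A : down o' A -> down o (f @^-1` A).
Proof. by move=> dA x y xy; apply: dA; apply: pm_mono xy. Qed.

Lemma pm_down_inv A : down o (f @^-1` A) -> down o' A.
Proof.
move=> dA p q pq Aq; have [x xp] := pm_surj pf p.
have [|y [xy yq _]] := pm_lift pf (x := x) (q := q); first by rewrite xp.
by rewrite -xp; apply: dA xy _ => /=; rewrite yq.
Qed.

Lemma pm_inj : injective (preimage f).
Proof.
move=> A B eAB; apply/seteqP; split=> q; have [x <-] := pm_surj pf q.
  by move=> Ax; suff : (f @^-1` B) x by []; rewrite -eAB.
by move=> Ax; suff : (f @^-1` A) x by []; rewrite eAB.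
Qed.

Lemma pm_dsub A B : f @^-1` dsub o' A B = dsub o (f @^-1` A) (f @^-1` B).
Proof.
apply/seteqP; split=> x.
  move=> [q [/(pm_lift pf)[y [xy <- _]] Aq Bq]]; by exists y.
move=> [y [xy Ay By]]; exists (f y); split=> //; exact: pm_mono xy.
Qed.

Lemma pm_cpt i A : f @^-1` cpt o' i A = cpt o i (f @^-1` A).
Proof.
apply/seteqP; split=> x.
  move=> [q [/(pm_lift pf)[y [xy yq dy]] [Aq mq] dq]].
  exists y; split=> //; last by rewrite dy.
  split=> [|z yz Az] /=; first by rewrite yq.
  apply/esym/(ple_dm_eq yz); rewrite dy -(mq (f z)) ?pm_dm //.
  by rewrite -yq; apply: pm_mono yz.
move=> [y [xy [Ay my] dy]]; exists (f y); split; first exact: pm_mono xy.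
  split=> // q yq Aq; have [z [yz zq _]] := pm_lift pf yq.
  by rewrite -(my z) //= zq.
have [z [yz zq <-]] := pm_lift pf (ple_refl o' (f y)).
by rewrite (my z) //= zq.
Qed.

End Pmor.

Lemma pmor_comp T (o : dpos T) T' (o' : dpos T') T'' (o'' : dpos T'') f g :
  pmor o o' f -> pmor o' o'' g -> pmor o o'' (g \o f).
Proof.
move=> pf pg; split=> [x y /(pm_mono pf)/(pm_mono pg)//|x|x q /(pm_lift pg)|q].
- by apply: leq_trans (pm_dm pf x) (pm_dm pg _).
- move=> [y [/(pm_lift pf)[z [xz zy dz]] yq dy]]; exists z.
  by split=> //=; [rewrite zy|rewrite dz].
- have [y <-] := pm_surj pg q; have [x <-] := pm_surj pf y; by exists x.
Qed.

(** The family [F] stands for the lattice. An abstract family is used since saturation is applied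
    both to the range of a representation and to such a range enlarged by one element on a poset
    with an extra top point. *)
Record dsys (T : Type) (o : dpos T) (F : set (set T)) := DSys {
  ds_down : forall A, F A -> down o A;
  ds0 : F set0;
  dsU : forall A B, F A -> F B -> F (A `|` B);
  dsI : forall A B, F A -> F B -> F (A `&` B);
  dsD : forall A B, F A -> F B -> F (dsub o A B);
  dsC : forall i A, F A -> F (cpt o i A) }.

(** * Splitting a point of a finite quotient *)

(* [option P] refines [P] by splitting [y] into [None], of dimension [k], and [Some y];
   [A1] and [A2] are the sets of points that lie strictly below each half.  If
   [k < dm y], then [None] is moreover below [Some y]. *)
Section Ext.
Variables (P : Type) (o : dpos P) (y : P) (k : nat) (A1 A2 : set P).

(** By [ec_full] and [ec_split], each point below [y] stays below a half of full dimension [dm o y];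
    this is what the lifting property of [pmor] demands when the two halves are folded back onto
    [y]. *)
Record ext_cond := ExtCond {
  ec_down1 : down o A1;
  ec_down2 : down o A2;
  ec_lt1 : forall p, A1 p -> ple o p y /\ p <> y;
  ec_lt2 : forall p, A2 p -> ple o p y /\ p <> y;
  ec_dm1 : forall p, A1 p -> dm o p < k;
  ec_le : k <= dm o y;
  ec_full : k < dm o y -> forall p, ple o p y -> p <> y -> A2 p;
  ec_split : k = dm o y -> forall p, ple o p y -> p <> y -> A1 p \/ A2 p }.

Hypothesis ec : ext_cond.

Definition ext_le (u v : option P) : Prop :=
  match u, v with
  | Some p, Some q => ple o p q /\ (q = y -> p = y \/ A2 p)
  | Some p, None => A1 p
  | None, Some q => ple o y q /\ (q = y -> k < dm o y)
  | None, None => True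
  end.

Definition ext_dm (u : option P) : nat := if u is Some p then dm o p else k.

Lemma ext_refl u : ext_le u u.
Proof. by case: u => //= p; split; [apply: ple_refl|left]. Qed.

Lemma ext_trans v u w : ext_le u v -> ext_le v w -> ext_le u w.
Proof.
case: u => [p|]; case: v => [q|]; case: w => [r|] //=.
- move=> [pq hq] [qr hr]; split; first exact: ple_trans pq qr.
  move=> /hr[/hq//|A2q]; right; exact: ec_down2 A2q.
- by move=> [pq _] A1q; apply: ec_down1 A1q.
- move=> A1p [yr hr]; have [py pny] := ec_lt1 ec A1p.
  split; first exact: ple_trans py yr.
  by move=> /hr hk; right; apply: ec_full.
- move=> [yq hq] [qr hr]; split; first exact: ple_trans yq qr.
  move=> ry; apply: hq; subst r; exact: ple_anti qr yq.
Qed.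

Lemma ext_lt u v : ext_le u v -> u <> v -> ext_dm u < ext_dm v.
Proof.
case: u => [p|]; case: v => [q|] //=.
- by move=> [pq _] ne; apply: dm_lt pq _ => epq; apply: ne; rewrite epq.
- by move=> /(ec_dm1 ec).
- move=> [yq hq] _; have [e|ne] := pselect (q = y).
    by rewrite e; apply: hq.
  by apply: leq_ltn_trans (ec_le ec) (dm_lt yq (nesym ne)).
Qed.

Definition ext_dpos := DPos ext_refl ext_trans ext_lt.

End Ext.

(** Dually, the projection comes from elements of the lattice. When [P] is finite, the principal
    down-sets suffice: the preimages of all other down-sets are finite unions of theirs. *)
Definition adm (X P : Type) (o : dpos P) (F : set (set X)) (f : X -> P) :=
  forall p, F [set z | ple o (f z) p].

Definition splitmap (X P : Type) (f : X -> P) (x : set X) (y : P) (z : X) : option P :=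
  if pselect (x z /\ f z = y) then None else Some (f z).

Lemma splitmapK X P (f : X -> P) x y z : odflt y (splitmap f x y z) = f z.
Proof. by rewrite /splitmap; case: pselect => //= -[]. Qed.

Section Step.
Variables (X : Type) (oX : dpos X) (F : set (set X)) (P : Type) (oP : dpos P).
Variables (f : X -> P) (y : P) (k : nat) (A1 A2 : set P).
Hypotheses (ec : ext_cond oP y k A1 A2) (dF : dsys oX F).
Hypotheses (pf : pmor oX oP f) (af : adm oP F f).

(** The sets [x] and [a] are to become the preimages of the principal down-sets at [None] and at
    [Some y], as [g_None] and [g_y] confirm. The clauses [sc_top] and [sc_topa] provide the liftings
    to the two halves. *)
Record step_cond (x a : set X) := StepCond {
  sc_F : F x;
  sc_Fa : F a;
  sc_le : forall z, x z -> ple oP (f z) y;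
  sc_lea : forall z, a z -> ple oP (f z) y;
  sc_dm : forall z, x z -> dm oX z <= k;
  sc_top : forall z, x z -> exists w, [/\ ple oX z w, x w, f w = y & dm oX w = k];
  sc_topa : forall z, a z ->
    exists w, [/\ ple oX z w, ~ x w, f w = y & dm oX w = dm oP y];
  sc_n0 : exists z, x z;
  sc_n0a : exists z, a z;
  sc_cover : forall z, ple oP (f z) y -> x z \/ a z;
  sc_A1 : forall z, ple oP (f z) y -> f z <> y -> (x z <-> A1 (f z));
  sc_A2 : forall z, ple oP (f z) y -> f z <> y -> (a z <-> A2 (f z));
  sc_eq : k = dm oP y -> forall z, x z -> a z -> f z <> y;
  sc_lt : k < dm oP y -> forall z, ple oP (f z) y -> a z }.

Variables (x a : set X).
Hypothesis sc : step_cond x a.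
Let g := splitmap f x y.
Let oE := ext_dpos ec.

Let gN z : x z -> f z = y -> g z = None.
Proof. by move=> xz fz; rewrite /g /splitmap; case: pselect => // -[]. Qed.

Let gS z : ~ (x z /\ f z = y) -> g z = Some (f z).
Proof. by move=> h; rewrite /g /splitmap; case: pselect. Qed.

Let g_y z : ple oE (g z) (Some y) <-> a z.
Proof.
have [[xz fz]|nz] := pselect (x z /\ f z = y).
  rewrite (gN xz fz) /=; split.
    move=> [_ /(_ erefl) ky]; apply: (sc_lt sc ky); rewrite fz; exact: ple_refl.
  move=> az; split; first exact: ple_refl.
  move=> _; have := ec_le ec; rewrite leq_eqVlt => /orP[/eqP ky|//].
  by have := sc_eq sc ky xz az.
rewrite (gS nz) /=; split.
  move=> [fy /(_ erefl)]; have [fe|fne] := pselect (f z = y).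
    move=> _; have [xz|//] := sc_cover sc fy; by case: nz.
  by move=> [//|]; rewrite -(sc_A2 sc).
move=> az; have fy := sc_lea sc az; split=> // _.
have [fe|fne] := pselect (f z = y); [by left|right].
by rewrite -(sc_A2 sc).
Qed.

Let g_None z : ple oE (g z) None <-> x z.
Proof.
have [[xz fz]|nz] := pselect (x z /\ f z = y); first by rewrite (gN xz fz).
rewrite (gS nz) /=; split=> [A1z|xz].
  by have [fy fne] := ec_lt1 ec A1z; rewrite (sc_A1 sc).
apply/(sc_A1 sc) => //; first exact: (sc_le sc xz).
by move=> fz; apply: nz.
Qed.

Let g_Some z q : q <> y -> ple oE (g z) (Some q) <-> ple oP (f z) q.
Proof.
move=> qy; have [[xz fz]|nz] := pselect (x z /\ f z = y).
  by rewrite (gN xz fz) fz /=; split=> [[]|].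
by rewrite (gS nz) /=; split=> [[]|].
Qed.

Lemma step_adm : adm oE F g.
Proof.
case=> [q|]; last first.
  by have -> : [set z | ple oE (g z) None] = x;
    [apply/seteqP; split=> z /g_None|exact: sc_F sc].
have [->|qy] := pselect (q = y).
  by have -> : [set z | ple oE (g z) (Some y)] = a;
    [apply/seteqP; split=> z /g_y|exact: sc_Fa sc].
by have -> : [set z | ple oE (g z) (Some q)] = [set z | ple oP (f z) q];
    [apply/seteqP; split=> z /(g_Some _ qy)|exact: af].
Qed.

Lemma step_pm : pmor oX oE g.
Proof.
have dx := ds_down dF (sc_F sc); have da := ds_down dF (sc_Fa sc).
split=> [z w zw|z|z [q|]|].
- have [[xw fw]|nw] := pselect (x w /\ f w = y).
    by rewrite (gN xw fw) g_None; apply: dx zw xw.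
  rewrite (gS nw); have [fw|fw] := pselect (f w = y).
    rewrite fw g_y; apply: (da _ _ zw).
    have [|xw|//] := sc_cover sc (z := w); last by case: nw.
    by rewrite fw; apply: ple_refl.
  by rewrite g_Some //; apply: pm_mono zw.
- have [[xz fz]|nz] := pselect (x z /\ f z = y).
    by rewrite (gN xz fz); exact: (sc_dm sc xz).
  by rewrite (gS nz); exact: (pm_dm pf).
- have [->|qy] := pselect (q = y).
    rewrite g_y => /(sc_topa sc)[w [zw xw fw dw]]; exists w; split=> //.
    by rewrite gS ?fw // => -[].
  rewrite g_Some // => /(pm_lift pf)[w [zw fw dw]]; exists w; split=> //.
  by rewrite gS ?fw // => -[].
- rewrite g_None => /(sc_top sc)[w [zw xw fw dw]]; exists w; split=> //.
  exact: gN.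
case=> [q|].
- have [->|qy] := pselect (q = y).
    have [z /(sc_topa sc)[w [zw xw fw dw]]] := sc_n0a sc; exists w.
    by rewrite gS ?fw // => -[].
  by have [z fz] := pm_surj pf q; exists z; rewrite gS ?fz // => -[_ /qy].
- have [z /(sc_top sc)[w [zw xw fw dw]]] := sc_n0 sc; exists w; exact: gN.
Qed.

End Step.

(** * Saturating a finite quotient with respect to an element *)

Lemma leq_card_inj_in (T T' : finType) (A : pred T) (B : pred T') (h : T -> T') :
  (forall u, A u -> B (h u)) ->
  (forall u v, A u -> A v -> h u = h v -> u = v) -> #|A| <= #|B|.
Proof.
move=> hAB hinj; rewrite -(@card_in_image _ _ h A); last first.
  by move=> u v uA vA; apply: hinj.
apply: subset_leq_card; apply/fintype.subsetP => v vA.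
have /fintype.imageP[u uA ->] := vA; exact: hAB.
Qed.

Section Key.
Variables (X : Type) (oX : dpos X) (F : set (set X)).
Hypothesis (dF : dsys oX F).
Variables (Y : Type) (G : forall P : finType, dpos P -> (Y -> P) -> Prop).
Hypothesis Gstep : forall (P : finType) (oP : dpos P) (g : Y -> P), G oP g ->
  forall y k A1 A2 (ec : ext_cond oP y k A1 A2),
  exists g' : Y -> option P, @G (option P) (ext_dpos ec) g' /\
    forall w, odflt y (g' w) = g w.

(** A finite quotient of [X] with a companion map from [Y], of which one only remembers that [G]
    survives every splitting step. For the back-and-forth, [G] says that the companion is a quotient
    of the second model; with a trivial [G] one obtains finite quotients of [X] alone. *)
Record config := Config {
  cP : finType;
  co : dpos cP;
  cf : X -> cP;
  cg : Y -> cP;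
  cpm : pmor oX co cf;
  cadm : adm co F cf;
  cG : G co cg }.

(* Only the points of [a] may be told apart from the others in their fibre. *)
Definition refines (a : set X) (c c' : config) := exists th : cP c' -> cP c,
  [/\ forall z, th (cf c' z) = cf c z, forall w, th (cg c' w) = cg c w &
      forall z w, ~ a z -> ~ a w -> cf c z = cf c w -> cf c' z = cf c' w].

Definition saturated (c : config) (a : set X) :=
  forall z w, cf c z = cf c w -> a z -> a w.

Lemma refines_refl a c : refines a c c.
Proof. by exists id. Qed.

Lemma refines_trans b1 b2 a c c' c'' : b1 `<=` a -> b2 `<=` a ->
  refines b1 c c' -> refines b2 c' c'' -> refines a c c''.
Proof.
move=> s1 s2 [t1 [e1 f1 h1]] [t2 [e2 f2 h2]]; exists (t1 \o t2); split.
- by move=> z /=; rewrite e2.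
- by move=> z /=; rewrite f2.
- move=> z w az aw e; apply: h2 => [/s2//|/s2//|].
  by apply: h1 => // [/s1|/s1].
Qed.

Lemma saturated_refines a b c c' : refines a c c' -> saturated c b -> saturated c' b.
Proof.
move=> [t [e _ _]] sb z w ezw; apply: sb.
by rewrite -!e ezw.
Qed.

Lemma adm_down (P : finType) (oP : dpos P) (f : X -> P) (A : set P) :
  adm oP F f -> down oP A -> F (f @^-1` A).
Proof.
move=> af dA.
have H (s : seq P) : F [set z | exists p, [/\ p \in s, A p & ple oP (f z) p]].
  elim: s => [|p s IHs].
    rewrite (_ : [set z | _] = set0); first exact: ds0 dF.
    by apply/seteqP; split=> z // [p []].
  have [Ap|nAp] := pselect (A p).
    rewrite (_ : [set z | _] = [set z | ple oP (f z) p] `|`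
        [set z | exists p, [/\ p \in s, A p & ple oP (f z) p]]).
      exact: (dsU dF (af p) IHs).
    apply/seteqP; split=> z /=.
      move=> [q []]; rewrite inE => /orP[/eqP ->|qs] Aq fq; first by left.
      by right; exists q.
    move=> [fp|[q [qs Aq fq]]]; [exists p|exists q]; rewrite ?mem_head //.
    by rewrite inE qs orbT.
  rewrite (_ : [set z | _] =
        [set z | exists p, [/\ p \in s, A p & ple oP (f z) p]]) //.
  apply/seteqP; split=> z /= [q [qs Aq fq]]; exists q; split=> //.
    by move: qs Aq; rewrite inE => /orP[/eqP ->|].
  by rewrite inE qs orbT.
rewrite (_ : f @^-1` A = [set z | exists p, [/\ p \in enum P, A p & ple oP (f z) p]])//.
apply/seteqP; split=> z /=.
  move=> Az; exists (f z); split=> //; [by rewrite mem_enum|exact: ple_refl].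
by move=> [p [_ Ap fp]]; apply: dA fp Ap.
Qed.

(** For [a] of dimension at most [k], mixed points are the only obstruction to [cpt oX k a] being a
    union of fibres. The second clause says [k <= dm oX w] because the points compared with those of
    [a] are obtained by lifting, with the full dimension of their image, which may exceed [k]. *)
Definition mixed (c : config) (a : set X) (k : nat) (y : cP c) :=
  (exists z, [/\ cf c z = y, dm oX z = k & a z]) /\
  (exists w, [/\ cf c w = y, k <= dm oX w & ~ a w]).

Definition nmixed c a k := #|[pred y : cP c | `[< mixed a k y >]]|.

Definition below (c : config) (y : cP c) : set X :=
  [set z | ple (co c) (cf c z) y /\ cf c z <> y].
Definition under (c : config) (y : cP c) : set X := [set z | ple (co c) (cf c z) y].

Lemma F_below c (y : cP c) : F (below y).
Proof.
apply: (adm_down (A := [set p | ple (co c) p y /\ p <> y])); first exact: cadm.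
move=> p q pq [qy nqy]; split; first exact: ple_trans pq qy.
by move=> py; apply: nqy; apply: ple_anti qy _; rewrite -py.
Qed.

Definition part (c : config) (a : set X) (k : nat) (y : cP c) : set X :=
  [set z | exists w, [/\ ple oX z w, a w, cf c w = y & dm oX w = k]].

(** The points of [a] of dimension [k] over [y] are isolated by lattice operations: take the
    component of degree [k] of [a] cut down to [under y], then subtract [below y]. Points of
    dimension [k] are maximal in [a] by the dimension bound. *)
Lemma F_part c a k (y : cP c) : F a -> (forall z, a z -> dm oX z <= k) ->
  F (part a k y).
Proof.
move=> Fa ak.
rewrite (_ : part a k y = dsub oX (cpt oX k (a `&` under y)) (below y)).
  apply: (dsD dF); last exact: F_below.
  apply: (dsC dF); apply: (dsI dF) => //; exact: cadm.
have pc := cpm c.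
apply/seteqP; split=> z.
  move=> [w [zw aw fw dw]]; exists w; split=> //; last by case.
  exists w; split=> //; first exact: ple_refl.
  split; first by split; rewrite // /under /= fw; apply: ple_refl.
  move=> v wv [av _]; apply/esym/(ple_dm_eq wv); rewrite dw; exact: ak.
move=> [v [zv [w [vw [[aw uw] _] dw]] nv]]; exists w; split=> //.
  exact: ple_trans zv vw.
apply: contrapT => fw; apply: nv; split; first exact: ple_trans (pm_mono pc vw) uw.
move=> fv; apply: fw; apply: ple_anti uw _; rewrite -fv; exact: (pm_mono pc vw).
Qed.

Section Transfer.
Variables (b : set X) (k : nat) (c c' : config).
Hypotheses (r : refines b c c') (bk : forall z, b z -> dm oX z < k).

Let nb z : k <= dm oX z -> ~ b z.
Proof. by move=> kz /bk; rewrite ltnNge kz. Qed.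

(** Points of dimension at least [k] lie outside [b], so a refinement along [b] cannot separate two
    of them. The lemmas that follow draw from this that the data attached to the fibre of [z0]
    survive. *)
Lemma transfer_fibre z0 z : k <= dm oX z0 -> k <= dm oX z ->
  cf c z = cf c z0 <-> cf c' z = cf c' z0.
Proof.
move=> /nb k0 /nb kz; have [t [e _ h]] := r; split; first by apply: h.
by rewrite -!e => ->.
Qed.

Lemma transfer_under z0 : k <= dm oX z0 -> under (cf c' z0) = under (cf c z0).
Proof.
move=> k0; have [t [e _ h]] := r; apply/seteqP; split=> z; rewrite /under /=.
  move=> /(pm_lift (cpm c'))[w [zw fw _]].
  have -> : cf c z0 = cf c w by rewrite -!e fw.
  exact: pm_mono (cpm c) _ _ zw.
move=> /(pm_lift (cpm c))[w [zw fw dw]].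
rewrite -((transfer_fibre (z0 := z0) (z := w) k0 _).1 fw).
  exact: pm_mono (cpm c') _ _ zw.
by rewrite dw; apply: leq_trans k0 (pm_dm (cpm c) _).
Qed.

Lemma transfer_dm z0 : k <= dm oX z0 -> dm (co c') (cf c' z0) = dm (co c) (cf c z0).
Proof.
move=> k0; have [t [e _ h]] := r; apply/eqP; rewrite eqn_leq; apply/andP; split.
  have [w [fw <-]] := pm_top (cpm c') (cf c' z0).
  have -> : cf c z0 = cf c w by rewrite -!e fw.
  exact: pm_dm (cpm c) _.
have [w [fw dw]] := pm_top (cpm c) (cf c z0).
rewrite -dw -((transfer_fibre (z0 := z0) (z := w) k0 _).1 fw).
  exact: pm_dm (cpm c') _.
by rewrite dw; apply: leq_trans k0 (pm_dm (cpm c) _).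
Qed.

(** Only points of [b] can leave a fibre. As [b] lies strictly below that of [z0], this fibre is not
    divided at all. *)
Lemma transfer_below z0 : k <= dm oX z0 -> b `<=` below (cf c z0) ->
  below (cf c' z0) = below (cf c z0).
Proof.
move=> k0 bs; have eu := transfer_under k0; have [t [e _ h]] := r.
have fibre z : cf c z = cf c z0 -> cf c' z = cf c' z0.
  by move=> ez; apply: h => //; [move=> /bs[_]|apply: nb].
apply/seteqP; split=> z [uz nz].
  split; first by have : under (cf c z0) z by rewrite -eu.
  by move=> /fibre.
split; first by have : under (cf c' z0) z by rewrite eu.
by move=> ez; apply: nz; rewrite -!e ez.
Qed.

Lemma transfer_part a z0 : k <= dm oX z0 -> part a k (cf c' z0) = part a k (cf c z0).
Proof.
move=> k0; apply/seteqP; split=> z [w [zw aw fw dw]]; exists w; split=> //.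
  by apply/transfer_fibre; rewrite ?dw.
by apply/transfer_fibre; rewrite ?dw.
Qed.

Lemma transfer_mixed a z0 : k <= dm oX z0 ->
  mixed a k (cf c' z0) <-> mixed a k (cf c z0).
Proof.
move=> k0; split=> -[[z [fz dz az]] [w [fw dw aw]]]; split;
  (try by exists z; split=> //; apply/transfer_fibre; rewrite ?dz);
  by exists w; split=> //; apply/transfer_fibre; rewrite ?dw.
Qed.

(** The map between the quotients is injective on mixed points: each carries a point of dimension
    [k], and such points are not separated by the refinement. *)
Lemma transfer_nmixed a : nmixed c' a k <= nmixed c a k.
Proof.
have [t [e _ h]] := r; apply: (leq_card_inj_in (h := t)).
  move=> y /asboolP my; have [[z [fz dz _]] _] := my; apply/asboolP.
  by rewrite -fz e -transfer_mixed ?dz // fz.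
move=> y y' /asboolP [[z [<- dz _]] _] /asboolP [[w [<- dw _]] _].
by rewrite !e => /transfer_fibre; apply; rewrite ?dz ?dw.
Qed.

End Transfer.

(* [y] can be split along [part a k y] as soon as the traces of the two halves on the
   lower points are unions of fibres. *)
Lemma split_point (c : config) a k (y : cP c) :
  F a -> (forall z, a z -> dm oX z <= k) -> mixed a k y ->
  saturated c (part a k y `&` below y) ->
  (k = dm (co c) y -> saturated c (part a k y `&` dsub oX (under y) (part a k y))) ->
  exists c', refines a c c' /\ nmixed c' a k < nmixed c a k.
Proof.
set x := part a k y; set a2 := dsub oX (under y) x => Fa ak my sx sx2.
have da := ds_down dF Fa; have Fx : F x := F_part y Fa ak.
have dx := ds_down dF Fx; have pc := cpm c.
have Fu : F (under y) := cadm y.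
have Fa2 : F a2 := dsD dF Fu Fx.
have xa : x `<=` a by move=> z [w [zw aw _ _]]; apply: da zw aw.
have xu z : x z -> under y z.
  by move=> [w [zw _ <- _]]; apply: (pm_mono pc zw).
have xk z : x z -> dm oX z <= k by move=> [w [zw _ _ <-]]; apply: dm_le.
have xbk z : x z -> below y z -> dm oX z < k.
  move=> xz [_ fz]; rewrite ltn_neqAle xk // andbT; apply/eqP => dz.
  have [w [zw aw fw dw]] := xz; apply: fz.
  by rewrite (ple_dm_eq zw) ?dw ?dz.
have [[z1 [fz1 dz1 az1]] [w1 [fw1 dw1 aw1]]] := my.
have xz1 : x z1 by exists z1; split=> //; apply: ple_refl.
have ky : k <= dm (co c) y by rewrite -dz1 -fz1; apply: (pm_dm pc).
have xw1 : ~ x w1 by move/xa.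
have cov z : under y z -> ~ x z -> a2 z.
  by move=> uz nx; exists z; split=> //; apply: ple_refl.
have a2w1 : a2 w1 by apply: cov => //; rewrite /under /= fw1; apply: ple_refl.
have top z : under y z -> exists w, [/\ ple oX z w, cf c w = y & dm oX w = dm (co c) y].
  exact: (pm_lift pc).
have full : k < dm (co c) y -> forall z, under y z -> a2 z.
  move=> kl z uz; have [w [zw fw dw]] := top _ uz.
  exists w; split=> //; first by rewrite /under /= fw; apply: ple_refl.
  by move/xk; rewrite dw leqNgt kl.
(* The trace of the second half comes for free: if [k < dm (co c) y] this half is all of [under y],
   and otherwise it is governed by [x] and by the intersection of the halves. *)
have sa2 : saturated c (a2 `&` below y).
  move=> z w ezw [a2z bz].
  have bw : below y w by move: bz; rewrite /below /= ezw.
  split=> //; have [xw|nxw] := pselect (x w); last by apply: cov => //; case: bw.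
  move: ky; rewrite leq_eqVlt => /orP[/eqP ky|/full]; last by apply; case: bw.
  have [xz _] := sx w z (esym ezw) (conj xw bw).
  by have [_] := sx2 ky z w ezw (conj xz a2z).
have bdown z w : ple oX z w -> below y w -> below y z.
  move=> zw; apply: (ds_down dF (F_below y) zw).
(* The image of a trace in the quotient, to serve as [A1] or [A2]; by saturation it loses no
   information. *)
pose tr (s : set X) : set (cP c) := [set p | exists z, cf c z = p /\ (s `&` below y) z].
have trE s z : saturated c (s `&` below y) -> below y z -> s z <-> tr s (cf c z).
  move=> ss bz; split; first by exists z.
  by move=> [w [fw sw]]; case: (ss w z fw sw).
have tr_lt s p : tr s p -> ple (co c) p y /\ p <> y by move=> [z [<- []]].
have tr_down s : down oX s -> saturated c (s `&` below y) -> down (co c) (tr s).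
  move=> ds ss p q pq sq; have [z zp] := pm_surj pc p.
  have [|w [zw fw _]] := pm_lift pc (x := z) (q := q); first by rewrite zp.
  have bw : below y w by rewrite /below /= fw; apply: tr_lt sq.
  exists z; split=> //; split; last exact: bdown zw bw.
  by apply: (ds z w zw); rewrite (trE s w ss bw) fw.
have ec : ext_cond (co c) y k (tr x) (tr a2).
  have inb p : ple (co c) p y -> p <> y -> exists z, cf c z = p /\ below y z.
    by move=> py npy; have [z zp] := pm_surj pc p; exists z; rewrite /below /= zp.
  split=> //.
  - exact: tr_down.
  - by apply: tr_down => //; apply: (ds_down dF).
  - exact: tr_lt.
  - exact: tr_lt.
  - move=> p xp; have [z [zp <-]] := pm_top pc p.
    have bz : below y z by rewrite /below /= zp; apply: tr_lt xp.
    by apply: xbk => //; rewrite (trE x z sx bz) zp.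
  - move=> kl p py /(inb _ py)[z [<- bz]].
    by rewrite -(trE a2 z sa2 bz); apply: full => //; case: bz.
  - move=> _ p py /(inb _ py)[z [<- bz]].
    rewrite -(trE a2 z sa2 bz) -(trE x z sx bz).
    have [xz|nxz] := pselect (x z); first by left.
    by right; apply: cov => //; case: bz.
have sc : step_cond oX F (co c) (cf c) y k (tr x) (tr a2) x a2.
  split=> //.
  - by move=> z [w [zw uw _]]; apply: ple_trans (pm_mono pc zw) uw.
  - move=> z [w [zw aw fw dw]]; exists w; split=> //.
    by exists w; split=> //; apply: ple_refl.
  - move=> z [w [zw uw xw]]; have [v [wv fv dv]] := top _ uw.
    exists v; split=> //; first exact: ple_trans zw wv.
    by move=> xv; apply: xw; apply: (dx _ _ wv).
  - by exists z1.
  - by exists w1.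
  - move=> z uz; have [xz|nxz] := pselect (x z); [by left|right; exact: cov].
  - by move=> z uz fz; apply: trE.
  - by move=> z uz fz; apply: trE.
  - move=> kl z xz a2z fz; have [] := sx2 kl z w1 _ (conj xz a2z) => //.
    by rewrite fz fw1.
have [g' [Gg' thg']] := Gstep (cG c) ec.
pose c' := Config (step_pm ec dF pc sc) (step_adm ec (@cadm c) sc) Gg'.
have cf'N z : cf c' z = None -> x z /\ cf c z = y.
  by rewrite /= /splitmap; case: pselect.
have cf'S z p : cf c' z = Some p -> ~ (x z /\ cf c z = y) /\ cf c z = p.
  by rewrite /= /splitmap; case: pselect => // nz [].
exists c'; split.
  exists (odflt y); split=> // [z|z w az aw e]; first exact: splitmapK.
  rewrite /= /splitmap; case: pselect => [h|?] /=; first by case: (az (xa _ h.1)).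
  by case: pselect => [h|?] /=; [case: (aw (xa _ h.1))|rewrite e].
(* The split point leaves the count: the fibre of [None] lies inside [a], hence is not mixed, and
   that of [Some y] has lost all its points of [a] of dimension [k]. *)
pose B := [pred q : cP c | `[< mixed a k q >] && (q != y)].
have BS : #|B| < nmixed c a k.
  rewrite /nmixed [X in _ < X](cardD1 y) inE (asboolT my) add1n ltnS.
  by apply: subset_leq_card; apply/fintype.subsetP => q; rewrite !inE andbC.
apply: leq_ltn_trans BS; apply: (leq_card_inj_in (h := odflt y)).
  move=> [p|] /asboolP [[z [fz dz az]] [w [fw dw aw]]]; last first.
    by have [/xa] := cf'N w fw.
  have [nz ez] := cf'S _ _ fz; have [nw ew] := cf'S _ _ fw.
  apply/andP; split; last first.
    apply/eqP => /= py; apply: nz; rewrite ez py; split=> //.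
    by exists z; split; rewrite ?ez //; apply: ple_refl.
  by apply/asboolP; split; [exists z|exists w].
move=> [p|] [q|] //= /asboolP [_ [w [fw dw aw]]] /asboolP [_ [v [fv dv av]]].
- by move=> ->.
- by have [/xa] := cf'N v fv.
- by have [/xa] := cf'N w fw.
Qed.

(** Outer induction on the bound for the dimension of [a], inner induction on the number of mixed
    points. Without mixed points, the component of degree [k] is already a union of fibres and the
    rest of [a] has smaller dimension. Otherwise a mixed point is split, after the outer hypothesis
    has prepared the traces. *)
Theorem saturate k a c : F a -> (forall z, a z -> dm oX z < k) ->
  exists c', refines a c c' /\ saturated c' a.
Proof.
elim: k a c => [|k IHk] a c Fa ak.
  exists c; split; first exact: refines_refl.
  by move=> z w _ /ak.
have ak' z : a z -> dm oX z <= k by move/ak; rewrite ltnS.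
have da := ds_down dF Fa.
have [n] := ubnP (nmixed c a k); elim: n c => // n IHn c; rewrite ltnS => cn.
have [[y my]|nomix] := pselect (exists y : cP c, mixed a k y); last first.
  have pc := cpm c.
  have sC : saturated c (cpt oX k a).
    move=> z z' ezz' [w [zw [aw _] dw]].
    have [|w' [z'w' fw' dw']] := pm_lift pc (x := z') (q := cf c w).
      by rewrite -ezz'; apply: (pm_mono pc zw).
    have kw' : k <= dm oX w' by rewrite dw' -dw; apply: (pm_dm pc).
    have aw' : a w'.
      apply: contrapT => naw'; apply: nomix; exists (cf c w).
      by split; [exists w|exists w'].
    exists w'; split=> //; last by apply/eqP; rewrite eqn_leq kw' ak'.
    split=> // v wv av; apply/esym/(ple_dm_eq wv).
    exact: leq_trans (ak' _ av) kw'.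
  have [||c' [rc' sc']] := IHk (dsub oX a (cpt oX k a)) c.
  - by apply: (dsD dF) => //; apply: (dsC dF).
  - move=> z [w [zw aw nw]]; apply: leq_ltn_trans (dm_le zw) _.
    rewrite ltn_neqAle ak' // andbT; apply/eqP => dw; apply: nw.
    exists w; split=> //; first exact: ple_refl.
    by split=> // v wv av; apply/esym/(ple_dm_eq wv); rewrite dw; apply: ak'.
  exists c'; split.
    apply: (refines_trans (b2 := set0)) rc' (refines_refl _ _) => //.
    exact: dsub_sub.
  have aE : a = cpt oX k a `|` dsub oX a (cpt oX k a).
    apply/seteqP; split=> z; last first.
      by move=> [/(cpt_sub da)|/(dsub_sub da)].
    move=> az; have [cz|ncz] := pselect (cpt oX k a z); first by left.
    by right; exists z; split=> //; apply: ple_refl.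
  rewrite aE => z w e [cz|sz]; [left|right].
    exact: (saturated_refines rc' sC e cz).
  exact: sc' e sz.
(* Before splitting [y], saturate the two traces, which have dimension [< k]: first the
   intersection of the halves, as this may add points below [y]; the trace on lower
   points then no longer does. *)
have [[z0 [fz0 dz0 az0]] _] := my.
have k0 : k <= dm oX z0 by rewrite dz0.
set x := part a k y.
have Fx : F x by apply: F_part.
have xa : x `<=` a by move=> z [w [zw aw _ _]]; apply: da zw aw.
have xk z : x z -> dm oX z <= k by move=> [w [zw _ _ <-]]; apply: dm_le.
have xtop z : x z -> dm oX z = k -> cf c z = y.
  move=> [w [zw aw fw dw]] dz; by rewrite (ple_dm_eq zw) ?dw ?dz.
have Fu : F (under y) := cadm y.
(* If [k < dm (co c) y], the other half is all of [under y] and the intersection would be [x], whose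
   dimension [k] is out of reach of the outer hypothesis; [split_point] then asks nothing of it. *)
pose b0 : set X := if k == dm (co c) y then x `&` dsub oX (under y) x else set0.
have Fb0 : F b0.
  rewrite /b0; case: ifP => _; last exact: ds0 dF.
  by apply: (dsI dF) => //; apply: (dsD dF).
have b0x : b0 `<=` x by rewrite /b0; case: ifP => _ // z [].
have b0k z : b0 z -> dm oX z < k.
  rewrite /b0; case: ifP => // /eqP ky [xz [w [zw uw nw]]].
  rewrite ltn_neqAle xk // andbT; apply/eqP => dz; apply: nw.
  rewrite -(ple_dm_eq zw) // dz ky.
  by apply: leq_trans (pm_dm (cpm c) w) (dm_le uw).
have [c1 [r1 s1]] := IHk b0 c Fb0 b0k.
(* The quotient has changed, so [y] is followed through [z0], a point of dimension [k] in its
   fibre. *)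
pose y1 := cf c1 z0.
have x1 : part a k y1 = x by rewrite (transfer_part r1 b0k) // fz0.
pose b1 := x `&` below y1.
have b1k z : b1 z -> dm oX z < k.
  move=> [xz [_ nz]]; rewrite ltn_neqAle xk // andbT; apply/eqP => dz.
  apply: nz; apply/(transfer_fibre r1 b0k) => //; first by rewrite dz.
  by rewrite fz0; apply: xtop.
have [c2 [r2 s2]] := IHk b1 c1 (dsI dF Fx (F_below y1)) b1k.
pose y2 := cf c2 z0.
have b1b : b1 `<=` below y1 by move=> z [].
have x2 : part a k y2 = x by rewrite (transfer_part r2 b1k).
have m1 : mixed a k y1 by rewrite (transfer_mixed r1 b0k) // fz0.
have m2 : mixed a k y2 by rewrite (transfer_mixed r2 b1k).
have [||c3 [r3 n3]] := split_point Fa ak' m2.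
- by rewrite x2 (transfer_below r2 b1k).
- rewrite x2 (transfer_under r2 b1k) // (transfer_under r1 b0k) // fz0.
  rewrite (transfer_dm r2 b1k) // (transfer_dm r1 b0k) // fz0 => ky.
  have := saturated_refines r2 s1; rewrite /b0 -{1}ky eqxx; exact.
have nc2 : nmixed c2 a k <= nmixed c a k.
  exact: leq_trans (transfer_nmixed r2 b1k a) (transfer_nmixed r1 b0k a).
have [|c4 [r4 s4]] := IHn c3.
  exact: leq_trans n3 (leq_trans nc2 cn).
exists c4; split=> //.
have r02 : refines a c c2.
  by apply: refines_trans r1 r2 => z; [move/b0x/xa|move=> [/xa]].
have aa : a `<=` a by [].
have r03 := refines_trans aa aa r02 r3.
exact: (refines_trans aa aa r03 r4).
Qed.

End Key.

(** * Copying a splitting step into a super scaled lattice *)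

Lemma cpt_idem (T : Type) (o : dpos T) i (A : set T) : down o A ->
  cpt o i (cpt o i A) = cpt o i A.
Proof.
move=> dA; apply: pureP; first exact: down_cpt; first exact: cpt_dm.
move=> x [y [xy my dy]]; exists y; split=> //; exists y; split=> //.
exact: ple_refl.
Qed.

Lemma pureU (T : Type) (o : dpos T) k (A B : set T) : down o A -> down o B ->
  cpt o k A = A -> cpt o k B = B -> cpt o k (A `|` B) = A `|` B.
Proof.
move=> dA dB pA pB; apply: pureP.
- by move=> x y xy [/(dA _ _ xy)|/(dB _ _ xy)]; [left|right].
- by move=> x [/(pure_dm pA)|/(pure_dm pB)].
- move=> x [/(pure_top pA)|/(pure_top pB)] [y [xy Ay dy]]; exists y; split=> //.
    by left.
  by right.
Qed.

(** The super scaled axioms read on down-sets, purity being [cpt o k A = A]. Scaling takes the form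
    of a descent by one degree: iterated, it produces the chains that bring the lattice dimension up
    to [scdim]. *)
Record supersys (T : Type) (o : dpos T) (F : set (set T)) := SuperSys {
  ss_scaling : forall k A, F A -> cpt o k.+1 A = A -> A !=set0 ->
    exists B, [/\ F B, B `<=` A, cpt o k B = B & B !=set0];
  ss_caten : forall r q p C A, r <= q -> q <= p -> F C -> F A ->
    C `<=` A -> cpt o p A = A -> cpt o r C = C -> A !=set0 -> C !=set0 ->
    exists B, [/\ F B, cpt o q B = B, C `<=` B & B `<=` A];
  ss_splitting : forall B1 B2 A, F B1 -> F B2 -> F A ->
    B1 `|` B2 `<=` A -> A !=set0 -> dsub o A (B1 `|` B2) = A ->
    exists A1 A2, [/\ F A1 /\ F A2, A1 !=set0 /\ A2 !=set0,
      B1 `<=` A1 /\ B2 `<=` A2, A1 = dsub o A A2 /\ A2 = dsub o A A1 &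
      A1 `&` A2 = B1 `&` B2] }.

Section Super.
Variables (T : Type) (o : dpos T) (F : set (set T)) (D : nat).
Hypotheses (dF : dsys o F) (sF : supersys o F) (bD : dbound o D).

Lemma super_descend q r A : F A -> cpt o q A = A -> A !=set0 -> r <= q ->
  exists B, [/\ F B, B `<=` A, cpt o r B = B & B !=set0].
Proof.
elim: q A => [|q IHq] A FA pA nA; first by rewrite leqn0 => /eqP ->; exists A; split.
rewrite leq_eqVlt => /orP[/eqP ->|]; first by exists A; split.
rewrite ltnS => rq; have [B [FB BA pB nB]] := ss_scaling sF FA pA nA.
have [C [FC CB pC nC]] := IHq _ FB pB nB rq.
by exists C; split=> // x /CB/BA.
Qed.

(** Catenarity applies to pure elements, so it is used on each component of [S] separately and the
    results are united. The union starts from a set given by [super_descend], to be nonempty even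
    when [S] is empty. *)
Lemma super_between q r A S : F A -> cpt o q A = A -> A !=set0 -> r <= q ->
  F S -> S `<=` A -> (forall z, S z -> dm o z < r) ->
  exists x, [/\ F x, cpt o r x = x, x !=set0, S `<=` x & x `<=` A].
Proof.
move=> FA pA nA rq FS SA Sr; have dS := ds_down dF FS.
have H m : m <= r -> exists x, [/\ F x, cpt o r x = x, x !=set0, x `<=` A &
    forall i, i < m -> cpt o i S `<=` x].
  elim: m => [_|m IHm mr].
    have [B [FB BA pB nB]] := super_descend FA pA nA rq.
    by exists B; split.
  have [x [Fx px nx xA hx]] := IHm (ltnW mr).
  have [[z cz]|nc] := pselect (cpt o m S !=set0); last first.
    exists x; split=> // i; rewrite ltnS leq_eqVlt => /orP[/eqP ->|/hx//] w cw.
    by case: nc; exists w.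
  have FC : F (cpt o m S) by apply: (dsC dF).
  have [|||B [FB pB CB BA]] := ss_caten sF (ltnW mr) rq FC FA _ pA _ nA.
  - by move=> w /(cpt_sub dS)/SA.
  - exact: cpt_idem.
  - by exists z.
  have dx := ds_down dF Fx; have dB := ds_down dF FB.
  exists (x `|` B); split.
  - exact: (dsU dF).
  - exact: pureU.
  - by case: nx => w xw; exists w; left.
  - by move=> w [/xA|/BA].
  - move=> i; rewrite ltnS leq_eqVlt => /orP[/eqP ->|/hx xi] w; first by right; apply: CB.
    by move/xi; left.
have [x [Fx px nx xA hx]] := H r (leqnn r).
exists x; split=> // z Sz; have [w [zw mw]] := max_above bD Sz.
by apply: (hx _ (Sr _ mw.1)); exists w.
Qed.

Definition super_real (P : finType) (oP : dpos P) (g : T -> P) :=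
  pmor o oP g /\ adm oP F g.

(** The preimage [E] of the down-set of [y] is pure of dimension [dm oP y]. If [k] is this
    dimension, splitting [E] along the preimages of [A1] and [A2] gives the two halves. If [k] is
    smaller, [Some y] keeps the whole of [E], and [None] receives a [k]-pure set found by catenarity
    inside one half of a splitting. *)
Lemma super_step (P : finType) (oP : dpos P) (g : T -> P) : super_real oP g ->
  forall y k A1 A2 (ec : ext_cond oP y k A1 A2),
  exists g' : T -> option P, super_real (ext_dpos ec) g' /\
    forall w, odflt y (g' w) = g w.
Proof.
move=> [pg ag] y k A1 A2 ec.
pose E := [set z | ple oP (g z) y].
have FE : F E := ag y.
have top z : E z -> exists w, [/\ ple o z w, g w = y & dm o w = dm oP y].
  exact: (pm_lift pg).
have inE w : g w = y -> E w by rewrite /E /= => ->; apply: ple_refl.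
have dE z : E z -> dm o z <= dm oP y.
  by move=> Ez; apply: leq_trans (pm_dm pg z) (dm_le Ez).
have pE : cpt o (dm oP y) E = E.
  apply: pureP => //; first exact: (ds_down dF FE).
  by move=> z /top[w [zw /inE Ew dw]]; exists w.
have nE : E !=set0 by have [z /inE] := pm_surj pg y; exists z.
have Fb1 : F (g @^-1` A1) by exact: (adm_down dF ag (ec_down1 ec)).
suff [x [a sc]] : exists x a, step_cond o F oP g y k A1 A2 x a.
  exists (splitmap g x y); split; last exact: splitmapK.
  by split; [exact: (step_pm ec dF pg sc)|exact: (step_adm ec ag sc)].
have SE B1 B2 : (forall p, B1 p -> ple oP p y /\ p <> y) ->
    (forall p, B2 p -> ple oP p y /\ p <> y) ->
    down oP B1 -> down oP B2 ->
    exists a1 a2, [/\ F a1 /\ F a2, a1 !=set0 /\ a2 !=set0,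
      g @^-1` B1 `<=` a1 /\ g @^-1` B2 `<=` a2, a1 = dsub o E a2 /\ a2 = dsub o E a1 &
      a1 `&` a2 = g @^-1` B1 `&` g @^-1` B2].
  move=> l1 l2 d1 d2; apply: (ss_splitting sF) => //.
  - exact: (adm_down dF ag d1).
  - exact: (adm_down dF ag d2).
  - by move=> z [/l1[]|/l2[]].
  - apply/seteqP; split; first exact: (dsub_sub (ds_down dF FE)).
    move=> z /top[w [zw gw dw]]; exists w; split=> //; first exact: inE.
    by case=> [/l1|/l2] [].
have DT a b : F a -> F b -> a = dsub o E b -> forall z, a z ->
    exists w, [/\ ple o z w, a w, ~ b w, g w = y & dm o w = dm oP y].
  move=> Fa Fb ab z; rewrite {1}ab => -[w [zw /top[v [wv gv dv]] bw]].
  have nbv : ~ b v by move=> bv; apply: bw; apply: (ds_down dF Fb wv).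
  exists v; split=> //; first exact: ple_trans zw wv.
  by rewrite ab; exists v; split=> //; [exact: ple_refl|exact: inE].
have := ec_le ec; rewrite leq_eqVlt => /orP[/eqP ky|ky].
  have [a1 [a2 [[F1 F2] [n1 n2] [s1 s2] [e1 e2] eI]]] :=
    SE _ _ (ec_lt1 ec) (ec_lt2 ec) (ec_down1 ec) (ec_down2 ec).
  have sub1 z : a1 z -> E z by rewrite e1; exact: (dsub_sub (ds_down dF FE)).
  have sub2 z : a2 z -> E z by rewrite e2; exact: (dsub_sub (ds_down dF FE)).
  have I12 z : a1 z -> a2 z -> A1 (g z) /\ A2 (g z).
    by move=> h1 h2; have : (a1 `&` a2) z by []; rewrite eI.
  exists a1, a2; split=> //.
  - by move=> z /sub1/dE; rewrite ky.
  - by move=> z /(DT _ _ F1 F2 e1)[w [zw aw _ gw dw]]; exists w; rewrite ky.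
  - by move=> z /(DT _ _ F2 F1 e2)[w [zw _ aw gw dw]]; exists w.
  - move=> z Ez; have [|na] := pselect (a2 z); first by right.
    by left; rewrite e1; exists z; split=> //; apply: ple_refl.
  - move=> z Ez gz; split=> [a1z|/s1//].
    by have [//|/s2 a2z] := ec_split ec ky Ez gz; have [] := I12 z a1z a2z.
  - move=> z Ez gz; split=> [a2z|/s2//].
    by have [/s1 a1z|//] := ec_split ec ky Ez gz; have [] := I12 z a1z a2z.
  - by move=> _ z a1z a2z; have [/(ec_lt1 ec)[]] := I12 z a1z a2z.
  - by rewrite ky ltnn.
(* With all the strictly lower points on the other side, the half [a1] meets their fibres exactly in
   the preimage of [A1]; any [x] between this preimage and [a1] then has the right trace. *)
pose Em : set P := [set p | ple oP p y /\ p <> y].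
have [||a1 [a2 [[F1 F2] [n1 n2] [s1 s2] [e1 e2] eI]]] :=
    SE _ Em (ec_lt1 ec) _ (ec_down1 ec).
- by [].
- move=> p q pq [qy nqy]; split; first exact: ple_trans pq qy.
  by move=> py; apply: nqy; apply: ple_anti qy _; rewrite -py.
have sub1 z : a1 z -> E z by rewrite e1; exact: (dsub_sub (ds_down dF FE)).
have p1 : cpt o (dm oP y) a1 = a1.
  apply: pureP; first exact: (ds_down dF F1).
    by move=> z /sub1/dE.
  by move=> z /(DT _ _ F1 F2 e1)[w [zw aw _ gw dw]]; exists w.
have b1k z : (g @^-1` A1) z -> dm o z < k.
  by move=> /(ec_dm1 ec); apply: leq_ltn_trans (pm_dm pg z).
have [x [Fx px nx b1x xa]] := super_between F1 p1 n1 (ltnW ky) Fb1 s1 b1k.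
have xb z : x z -> g z <> y -> A1 (g z).
  move=> /xa a1z gz; suff : (a1 `&` a2) z by rewrite eI => -[].
  by split=> //; apply: s2; split=> //; apply: sub1.
exists x, E; split=> //.
- by move=> z /xa/sub1.
- by move=> z; apply: pure_dm px.
- move=> z /(pure_top px)[w [zw xw dw]]; exists w; split=> //.
  by apply: contrapT => /(xb _ xw)/b1k; rewrite dw ltnn.
- move=> z /top[w [zw gw dw]]; exists w; split=> //.
  by move/(pure_dm px); rewrite dw leqNgt ky.
- by right.
- by move=> z Ez gz; split=> [/xb|/b1x]//; apply.
- by move=> z Ez gz; split=> // _; apply: (ec_full ec).
- by move=> ke; move: ky; rewrite -ke ltnn.
Qed.

End Super.

(** * Subscaled lattices and their representations *)

Lemma infimum_min (disp : Order.disp_t) (T : porderType disp) (x0 : T) (E : set T) m :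
  E m -> lbound E m -> infimum x0 E = m.
Proof.
move=> Em lm; rewrite /infimum; case: ifPn => [/eqP E0|_].
  by move: Em; rewrite E0.
have im : infimums E m by split=> // y; apply.
by apply: (is_subset1_infimums (A := E)) => //; case: xgetP => [y _ //|h]; case: (h m).
Qed.

Lemma supremum_max (disp : Order.disp_t) (T : porderType disp) (x0 : T) (E : set T) m :
  E m -> ubound E m -> supremum x0 E = m.
Proof.
move=> Em um; rewrite /supremum; case: ifPn => [/eqP E0|_].
  by move: Em; rewrite E0.
have sm : supremums E m by split=> // y; apply.
by apply: (is_subset1_supremums (A := E)) => //; case: xgetP => [y _ //|h]; case: (h m).
Qed.

Section Lattice.
Variables (d : nat) (M : structure (L_SC d)).
Hypothesis lM : is_lattice M.
Implicit Types a b c : M.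

Let jC : commutative (@join d M). Proof. by case: lM => -[]. Qed.
Let mC : commutative (@meet d M). Proof. by case: lM => -[]. Qed.
Let jA : associative (@join d M). Proof. by case: lM => _ []. Qed.
Let mA : associative (@meet d M). Proof. by case: lM => _ []. Qed.
Let jK a b : join a (meet a b) = a. Proof. by case: lM => _ _ []. Qed.
Let mK a b : meet a (join a b) = a. Proof. by case: lM => _ _ []. Qed.

Lemma lat_refl a : latle a a.
Proof. by rewrite /latle -{2}[a](mK a a) jK. Qed.

Lemma lat_trans b a c : latle a b -> latle b c -> latle a c.
Proof. by rewrite /latle => ab <-; rewrite jA ab. Qed.

Lemma lat_anti a b : latle a b -> latle b a -> a = b.
Proof. by rewrite /latle jC => h1 h2; rewrite -h2 h1. Qed.

Lemma lat_bot a : latle (bot M) a. Proof. by case: lM => _ _ _ /(_ a)[]. Qed.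
Lemma lat_top a : latle a (top M). Proof. by case: lM => _ _ _ /(_ a)[]. Qed.

Lemma lat_joinl a b : latle a (join a b).
Proof. by rewrite /latle jA lat_refl. Qed.

Lemma lat_joinr a b : latle b (join a b).
Proof. by rewrite jC; apply: lat_joinl. Qed.

Lemma lat_join a b c : latle a c -> latle b c -> latle (join a b) c.
Proof. by rewrite /latle -jA => ac ->. Qed.

Lemma lat_meetE a b : latle a b <-> meet a b = a.
Proof. by rewrite /latle; split=> <-; [rewrite mK|rewrite jC mC jK]. Qed.

Lemma lat_meetl a b : latle (meet a b) a.
Proof. by rewrite /latle jC jK. Qed.

Lemma lat_meetr a b : latle (meet a b) b.
Proof. by rewrite mC; apply: lat_meetl. Qed.

Lemma lat_meet a b c : latle c a -> latle c b -> latle c (meet a b).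
Proof. by rewrite !lat_meetE mA => -> ->. Qed.

Lemma join_bot a : join a (bot M) = a.
Proof. by rewrite jC; apply: lat_bot. Qed.

Lemma big_join_le (I : eqType) (r : seq I) (P : pred I) (f : I -> M) i :
  i \in r -> P i -> latle (f i) (\big[@join d M/bot M]_(j <- r | P j) f j).
Proof.
elim: r => // j r IHr; rewrite inE big_cons => /orP[/eqP <-|ir] Pi.
  by rewrite Pi; apply: lat_joinl.
case: ifP => _; last exact: IHr.
by apply: lat_trans (lat_joinr _ _); apply: IHr.
Qed.

Lemma big_join_bot (I : Type) (r : seq I) (P : pred I) (f : I -> M) :
  (forall i, ~~ P i -> f i = bot M) ->
  \big[@join d M/bot M]_(j <- r) f j = \big[@join d M/bot M]_(j <- r | P j) f j.
Proof.
move=> fP; elim: r => [|j r IHr]; first by rewrite !big_nil.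
rewrite !big_cons IHr; case: ifPn => // /fP ->; exact: lat_bot.
Qed.

End Lattice.

Section TC.
Variables (d : nat) (M : structure (L_SC d)).
Hypothesis tM : is_TC_lattice M.
Implicit Types a b c : M.

Let lM : is_lattice M := tM.1.

Lemma minus_le a b : latle a (join b (minus a b)).
Proof. by have [] := tM.2 a b. Qed.

Lemma minus_min a b c : latle a (join b c) -> latle (minus a b) c.
Proof. by have [_] := tM.2 a b; apply. Qed.

Lemma minus_sub a b : latle (minus a b) a.
Proof. by apply: minus_min; apply: lat_joinr. Qed.

(** Testing the definition on [minus a b] is enough, which turns the relation into an equation. *)
Lemma strongly_belowP b a :
  strongly_below b a <-> [/\ latle b a, a <> bot M & minus a b = a].
Proof.
split=> [[ba a0 h]|[ba a0 e]]; split=> //.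
  apply: contrapT => ne; have [|ab ] := h (minus a b).
    by split=> //; apply: minus_sub.
  by case; exact: (lat_anti lM ab (minus_le _ _)).
move=> c [ca ne]; split; first exact: lat_join.
move=> bc; apply: ne; apply: lat_anti => //.
by rewrite -{1}e; apply: minus_min; rewrite bc; apply: lat_refl.
Qed.

(** Adjointness of [minus] directly yields the dual law, in which joins distribute over meets; the
    usual two-step argument passes from one law to the other. *)
Lemma meet_join_le c a b :
  latle (meet c (join a b)) (join (meet c a) (meet c b)).
Proof.
have dual (x u v : M) : latle (meet (join x u) (join x v)) (join x (meet u v)).
  set w := meet (join x u) _; apply: (lat_trans lM (minus_le w x)).
  apply: lat_join => //; first exact: lat_joinl.
  apply: (fun h => lat_trans lM h (lat_joinr lM _ _)).
  by apply: lat_meet => //; apply: minus_min; [apply: lat_meetl|apply: lat_meetr].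
apply: (fun h => lat_trans lM h (dual _ _ _)); apply: lat_meet => //.
  by apply: (fun h => lat_trans lM h (lat_joinr lM _ _)); apply: lat_meetl.
set ca := meet c a; have bC : join ca b = join b ca by case: lM => -[].
rewrite bC; apply: (fun h => lat_trans lM h (dual _ _ _)); apply: lat_meet => //.
  exact: (lat_trans lM (lat_meetl lM _ _) (lat_joinr lM _ _)).
apply: (lat_trans lM (lat_meetr lM _ _)).
by have -> : join b a = join a b; [case: lM => -[]|apply: lat_refl].
Qed.

End TC.

(** * First-order axioms for subscaled lattices *)

Section Laws.
Variables (d : nat) (M : structure (L_SC d)).
Implicit Types a b c : M.

(* [dlt k a] means [sc-dim a < k]. *)
Definition dlt (k : nat) a := forall i : 'I_d.+1, k <= i -> Cpart i a = bot M.

(** The extended integer [scdim] is avoided in favour of [dlt k], a finite conjunction of equations,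
    so that each clause is a scheme of sentences. They characterise subscaled lattices: the converse
    of [is_subscaled_axioms] is [spec_rep] followed by [rep_subscaled]. *)
Record subscaled_axioms : Prop := ScAx {
  ax_tc : is_TC_lattice M;
  ax_cover : forall a, \big[@join d M/bot M]_(i < d.+1) Cpart i a = a;
  ax_orth : forall a (i j : 'I_d.+1), j != i -> Cpart j (Cpart i a) = bot M;
  ax_mono : forall a b k, latle b a -> dlt k a -> dlt k b;
  ax_meet : forall a (i j : 'I_d.+1), i != j ->
    dlt (minn i j) (meet (Cpart i a) (Cpart j a));
  ax_minus : forall a b (i : 'I_d.+1), dlt i b -> minus (Cpart i a) b = Cpart i a;
  ax_below : forall a b k, latle b a -> a <> bot M -> minus a b = a ->
    dlt k.+1 a -> dlt k b }.

(** Here [n] is the sc-dimension plus one, which makes it a natural number, with [0] for the value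
    [-1]; the covering axiom excludes the infinite value. *)
Lemma scdimP : is_lattice M ->
  (forall a, \big[@join d M/bot M]_(i < d.+1) Cpart i a = a) ->
  (forall a (I : {set 'I_d.+1}) (k : 'I_d.+1),
     Cpart k (\big[@join d M/bot M]_(i in I) Cpart i a) =
          if k \in I then Cpart k a else bot M) ->
  forall a, exists n, [/\ n <= d.+1, scdim a = (n%:Z - 1)%:E%E &
    forall k, dlt k a <-> n <= k].
Proof.
move=> lM H1 H2 a.
have key k : dlt k a <-> a = \big[@join d M/bot M]_(i < d.+1 | i < k) Cpart i a.
  split=> [ka|aE i ki].
    rewrite -{1}(H1 a); apply: big_join_bot => // i.
    by rewrite -leqNgt; apply: ka.
  rewrite aE (eq_bigl (fun j => j \in [set j : 'I_d.+1 | j < k]%SET)).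
    by rewrite H2 inE ltnNge ki.
  by move=> j; rewrite inE.
have ex : exists k, `[< dlt k a >].
  by exists d.+1; apply/asboolP => i; rewrite leqNgt ltn_ord.
case: (ex_minnP ex) => n /asboolP na nmin.
have nP k : dlt k a <-> n <= k.
  split; first by move=> ka; apply: nmin; apply/asboolP.
  by move=> nk i ki; apply: na; apply: leq_trans nk ki.
have nd : n <= d.+1 by apply/nP => i; rewrite leqNgt ltn_ord.
exists n; split=> //; apply: infimum_min => /=.
  exists (n%:Z - 1)%R => //; split; first by split; lia.
  rewrite {1}(key n).1 //; apply: eq_bigl => i; by lia.
move=> _ [l [[l1 l2] al] <-]; rewrite lee_fin.
have [k lk] : exists k : nat, l = (k%:Z - 1)%R.
  by exists (absz (l + 1)%R); lia.
suff : n <= k by rewrite lk; lia.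
apply/nP/key; rewrite {1}al; apply: eq_bigl => i; rewrite lk; by lia.
Qed.

Lemma is_subscaled_axioms : is_subscaled M -> subscaled_axioms.
Proof.
move=> [tM H1 [H2 H3 H4 H5 H6]]; have lM := tM.1.
have sd := scdimP lM H1 H2.
(* Suppose that [b <= a] had the greater sc-dimension, and take that degree: the component of [a]
   vanishes there, so by additivity on [join b a] that of [b] vanishes too, against the minimality
   of [nb]. *)
have mono a b k : latle b a -> dlt k a -> dlt k b.
  move=> ba ka; have [na [na1 na2 na3]] := sd a; have [nb [nb1 nb2 nb3]] := sd b.
  apply/nb3; move/na3: ka; apply: leq_trans; rewrite leqNgt; apply/negP => nab.
  have bd : nb.-1 < d.+1 by lia.
  have := H3 b a (Ordinal bd); rewrite ba nb2 na2 => /(_ _).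
  have -> : Cpart (Ordinal bd) a = bot M by apply: ((na3 na).2 (leqnn na)) => /=; lia.
  rewrite join_bot // ge_max !lee_fin /= => h.
  suff /nb3 : dlt nb.-1 b by lia.
  move=> i; rewrite leq_eqVlt => /orP[/eqP ei|ni]; last by apply: ((nb3 nb).2 (leqnn nb)); lia.
  have -> : i = Ordinal bd by apply: val_inj.
  by rewrite -h //; lia.
split=> //.
- move=> a i j ji; have := H2 a [set i]%SET j.
  rewrite -big_filter (eq_filter (a2 := pred1 i)); last by move=> i'; rewrite inE.
  rewrite filter_pred1_uniq ?index_enum_uniq ?mem_index_enum // big_cons big_nil.
  by rewrite join_bot // inE (negbTE ji).
- move=> a i j ij; have := H4 a i j ij; set c := meet _ _.
  have [n [_ -> nP]] := sd c; rewrite lte_fin => h; apply/nP; lia.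
- move=> a b i ib; have [n [_ nE nP]] := sd b.
  have := H5 a b i; rewrite (ib i) //.
  move=> ->; last by move/nP: ib => ib; rewrite nE lee_fin; lia.
  by apply: lat_anti => //; [apply: minus_sub|];
    have := minus_le tM (Cpart i a) (bot M); rewrite /latle lat_bot.
- move=> a b k ba a0 e ka.
  have /H6 : strongly_below b a by apply/strongly_belowP.
  have [na [_ -> nP]] := sd a; have [nb [_ -> nbP]] := sd b.
  by rewrite lte_fin => h; apply/nbP; move/nP: ka; lia.
Qed.

End Laws.

(** * Representations by down-sets *)

(** The poset [X] need not be the prime spectrum of [M]: the spectrum of an extension of [M] and
    inverse limits also occur. *)
Record rep (d : nat) (M : structure (L_SC d)) (X : Type) (o : dpos X)
    (h : M -> set X) : Prop := Rep {
  rep_inj : injective h;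
  rep_down : forall a, down o (h a);
  rep_bot : h (bot M) = set0;
  rep_top : h (top M) = setT;
  rep_join : forall a b, h (join a b) = h a `|` h b;
  rep_meet : forall a b, h (meet a b) = h a `&` h b;
  rep_minus : forall a b, h (minus a b) = dsub o (h a) (h b);
  rep_C : forall i a, h (Cpart i a) = cpt o i (h a);
  rep_bound : dbound o d.+1 }.

Section Rep.
Variables (d : nat) (M : structure (L_SC d)) (X : Type) (o : dpos X).
Variable h : M -> set X.
Hypothesis rh : rep o h.
Implicit Types a b c : M.

Lemma rep_le a b : latle a b <-> h a `<=` h b.
Proof.
rewrite /latle; split=> [<-|ab].
  by rewrite (rep_join rh) => x; left.
apply: (rep_inj rh); rewrite (rep_join rh); apply/seteqP; split=> x; last by right.
by case=> // /ab.
Qed.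

Lemma rep_n0 a : a <> bot M <-> h a !=set0.
Proof.
split=> [a0|[x ax] e].
  apply: contrapT => n0; apply: a0; apply: (rep_inj rh); rewrite (rep_bot rh).
  by apply/seteqP; split=> // x ax; case: n0; exists x.
by move: ax; rewrite e (rep_bot rh).
Qed.

Lemma rep_big (I : Type) (r : seq I) (P : pred I) (f : I -> M) :
  h (\big[@join d M/bot M]_(i <- r | P i) f i) =
  \big[setU/set0]_(i <- r | P i) h (f i).
Proof. exact: (big_morph h (rep_join rh) (rep_bot rh)). Qed.

Lemma rep_bigE (I : finType) (P : pred I) (f : I -> M) x :
  h (\big[@join d M/bot M]_(i | P i) f i) x <-> exists2 i, P i & h (f i) x.
Proof.
rewrite rep_big; split; last first.
  by move=> [i Pi fx]; rewrite (bigD1 i) //=; left.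
elim/big_ind: _ => //= [A B hA hB [/hA|/hB]//|i Pi fx]; by exists i.
Qed.

(** A maximal point of dimension [i] witnesses that the component of degree [i] is nonzero. Thus
    [scdim a] is the greatest dimension of a point of [h a]. *)
Lemma rep_dlt k a : dlt k a <-> forall x, h a x -> dm o x < k.
Proof.
split=> [ka x ax|ka i ki].
  have [y [xy my]] := max_above (rep_bound rh) ax.
  apply: leq_ltn_trans (dm_le xy) _; rewrite ltnNge; apply/negP => ky.
  have : h (Cpart (Ordinal (rep_bound rh y)) a) y.
    by rewrite (rep_C rh); exists y; split=> //; apply: ple_refl.
  by rewrite ka // (rep_bot rh).
apply: (rep_inj rh); rewrite (rep_C rh) (rep_bot rh); apply/seteqP; split=> // x.
by move=> [y [_ [/ka] yk _ dy]]; move: yk; rewrite dy ltnNge ki.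
Qed.

Lemma rep_TC : is_TC_lattice M.
Proof.
have I := rep_inj rh.
split; first split.
- split=> a b; apply: I.
    by rewrite (rep_join rh a) (rep_join rh b) setUC.
  by rewrite (rep_meet rh a) (rep_meet rh b) setIC.
- split=> a b c; apply: I.
    by rewrite !(rep_join rh) setUA.
  by rewrite !(rep_meet rh) setIA.
- split=> a b; apply: I.
    by rewrite (rep_join rh) (rep_meet rh) setUC setIK.
  by rewrite (rep_meet rh) (rep_join rh) setUC setKU.
- by move=> a; rewrite !rep_le (rep_bot rh) (rep_top rh); split.
move=> a b; rewrite !(rep_le, rep_join rh, rep_minus rh); split=> [x ax|c].
  have [bx|nbx] := pselect (h b x); [by left|right].
  by exists x; split=> //; apply: ple_refl.
rewrite !(rep_le, rep_join rh, rep_minus rh) => ab x [y [xy /ab[//|cy] _]].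
exact: (rep_down rh xy cy).
Qed.

Lemma rep_subscaled : is_subscaled M.
Proof.
have I := rep_inj rh; have tM := rep_TC; have lM := tM.1.
have H1 a : \big[@join d M/bot M]_(i < d.+1) Cpart i a = a.
  apply: I; apply/seteqP; split=> x.
    by move=> /rep_bigE[i _]; rewrite (rep_C rh) => /(cpt_sub (rep_down rh (a := a))).
  move=> ax; have [y [xy my]] := max_above (rep_bound rh) ax.
  apply/rep_bigE; exists (Ordinal (rep_bound rh y)) => //.
  by rewrite (rep_C rh); exists y.
have H2 a (J : {set 'I_d.+1}) (k : 'I_d.+1) :
     Cpart k (\big[@join d M/bot M]_(i in J) Cpart i a) =
          if k \in J then Cpart k a else bot M.
  apply: I; rewrite (rep_C rh); apply/seteqP; split=> x.
    move=> [y [xy [/rep_bigE[i iJ]]]]; rewrite (rep_C rh) => -[z [yz mz dz]] my dy.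
    have zy : z = y.
      apply: my => //; apply/rep_bigE; exists i => //; rewrite (rep_C rh).
      by exists z; split=> //; apply: ple_refl.
    have -> : k = i by apply: val_inj; rewrite /= -dy -dz zy.
    by rewrite iJ (rep_C rh); exists z; split; rewrite // zy.
  case: ifP => [kJ|_]; last by rewrite (rep_bot rh).
  rewrite (rep_C rh) => -[y [xy my dy]]; exists y; split=> //; split.
    apply/rep_bigE; exists k => //; rewrite (rep_C rh); exists y; split=> //.
    exact: ple_refl.
  move=> z yz /rep_bigE[i _]; rewrite (rep_C rh) => /(cpt_sub (rep_down rh (a := a))).
  exact: my.2.
have sd := scdimP lM H1 H2.
split=> //; split=> //.
- move=> a b k; have [na [_ -> naP]] := sd a; have [nb [_ -> nbP]] := sd b.
  rewrite ge_max !lee_fin => /andP[ak bk]; apply: I.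
  have /rep_dlt ak' : dlt k.+1 a by apply/naP; lia.
  have /rep_dlt bk' : dlt k.+1 b by apply/nbP; lia.
  rewrite !(rep_C rh, rep_join rh); apply/seteqP; split=> x.
    move=> [y [xy [ab my] dy]]; case: ab => [ay|by_]; [left|right];
      exists y; split=> //; split=> // z yz az; apply: my => //; [by left|by right].
  move=> [] [y [xy [ay my] dy]]; exists y; split=> //; split; [by left| |by right|].
  - move=> z yz [az|bz]; first exact: my.
    by apply/esym/(ple_dm_eq yz); rewrite dy -ltnS; apply: bk'.
  - move=> z yz [az|bz]; last exact: my.
    by apply/esym/(ple_dm_eq yz); rewrite dy -ltnS; apply: ak'.
- move=> a i j ij; have [n [_ -> nP]] := sd (meet (Cpart i a) (Cpart j a)).
  suff /nP : dlt (minn i j) (meet (Cpart i a) (Cpart j a)) by rewrite lte_fin; lia.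
  apply/rep_dlt => x; rewrite (rep_meet rh) !(rep_C rh).
  move=> [[y [xy [ay my] dy]] [z [xz [az mz] dz]]].
  have yz : y <> z.
    by move=> yz; move: ij; rewrite -(inj_eq val_inj) /= -dy -dz yz eqxx.
  rewrite leq_min -dy -dz; apply/andP; split; apply: dm_lt => // xe.
    by apply: yz; rewrite -(my z) // -xe.
  by apply: yz; rewrite -(mz y) // -xe.
- move=> a b k; have [n [_ -> nP]] := sd b; rewrite lee_fin => nk.
  have /rep_dlt bk : dlt k.+1 b by apply/nP; lia.
  apply: I; rewrite !(rep_minus rh) !(rep_C rh); apply/seteqP; split=> x.
    move=> [y [xy cy nby]]; exists y; split=> // /(cpt_sub (rep_down rh (a := b))).
    by [].
  move=> [y [xy [z [yz mz dz]] nc]]; exists z; split.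
  - exact: ple_trans xy yz.
  - by exists z; split=> //; apply: ple_refl.
  - move=> bz; apply: nc; exists z; split=> //; split=> // w zw bw.
    by apply/esym/(ple_dm_eq zw); rewrite dz -ltnS; apply: bk.
- move=> a b /(strongly_belowP tM)[/rep_le ba /rep_n0[x0 ax0] e].
  have [na [_ -> naP]] := sd a; have [nb [_ -> nbP]] := sd b; rewrite lte_fin.
  have /rep_dlt ak : dlt na a by apply/naP.
  have na0 : 0 < na.
    exact: leq_ltn_trans (ak _ ax0).
  suff : nb <= na.-1 by lia.
  apply/nbP/rep_dlt => x bx; have := ba _ bx; rewrite -{1}e (rep_minus rh).
  move=> [y [xy ay nby]]; have := ak _ ay.
  have : x <> y by move=> xy'; apply: nby; rewrite -xy'.
  move=> /(dm_lt xy); lia.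
Qed.

End Rep.

(** * The prime spectrum *)

Section PrimeFilters.
Variables (d : nat) (M : structure (L_SC d)).
Hypothesis tM : is_TC_lattice M.
Let lM : is_lattice M := tM.1.

Record ideal (J : set M) : Prop := Ideal {
  ideal_bot : J (bot M);
  ideal_down : forall a b, latle a b -> J b -> J a;
  ideal_join : forall a b, J a -> J b -> J (join a b) }.

Lemma prime_separation (J : set M) a : ideal J -> ~ J a ->
  exists p, [/\ prime_filter p, p a & forall c, J c -> ~ p c].
Proof.
move=> [J0 Jd Jj] Ja.
pose fil (p : set M) := [/\ p a, forall b c, p b -> latle b c -> p c,
  forall b c, p b -> p c -> p (meet b c) & forall c, J c -> ~ p c].
(* The empty set is added to the family for the sake of the empty chain; it is not maximal, because
   of the filter generated by [a]. *)
have [|p [[p0|fp] pmax]] := @Zorn_bigcup M [set p | p = set0 \/ fil p].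
- move=> Q QP tQ.
  have [[q [Qq fq]]|nf] := pselect (exists q, Q q /\ fil q); last first.
    left; apply/seteqP; split=> // x [q Qq qx]; have [q0|fq] := QP q Qq.
      by move: qx; rewrite q0.
    by case: nf; exists q.
  have cof r : Q r -> forall x, r x -> fil r.
    by move=> Qr x rx; have [r0|//] := QP r Qr; move: rx; rewrite r0.
  right; split.
  - by exists q => //; case: fq.
  - move=> b c [r Qr rb] bc; exists r => //.
    by have [_ h _ _] := cof r Qr _ rb; apply: h bc.
  - move=> b c [r Qr rb] [s Qs sc].
    have [_ _ hr _] := cof r Qr _ rb; have [_ _ hs _] := cof s Qs _ sc.
    have [rs|sr] := tQ r s Qr Qs; first by exists s => //; apply: hs => //; apply: rs.
    by exists r => //; apply: hr => //; apply: sr.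
  - by move=> c Jc [r Qr rc]; have [_ _ _ h] := cof r Qr _ rc; apply: h rc.
- exfalso; apply: (pmax [set c | latle a c]).
    by rewrite p0; split=> // /(_ a); apply; apply: lat_refl.
  right; split.
  - exact: lat_refl.
  - by move=> b c ab bc; apply: (lat_trans lM ab bc).
  - by move=> b c ab ac; apply: lat_meet.
  - by move=> c Jc ac; apply: Ja; apply: Jd Jc.
have [pa pu pm pJ] := fp.
exists p; split=> //; split=> //.
- by split; [apply: pu pa _; apply: lat_top|apply: pJ].
- move=> b c pbc; apply: contrapT => /not_orP[nb nc].
  have ext x : ~ p x -> exists2 u, p u & J (meet u x).
    move=> nx; apply: contrapT => nu.
    apply: (pmax [set c | exists2 u, p u & latle (meet u x) c]).
      split=> [|/(_ x) h].
        by move=> u pu'; exists u => //; apply: lat_meetl.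
      by apply/nx/h; exists a => //; apply: lat_meetr.
    right; split.
    - by exists a => //; apply: lat_meetl.
    - by move=> u v [w pw wu] uv; exists w => //; apply: (lat_trans lM wu uv).
    - move=> u v [w pw wu] [w' pw' wv]; exists (meet w w'); first exact: pm.
      apply: lat_meet => //.
        apply: (fun h => lat_trans lM h wu); apply: lat_meet => //.
          exact: (lat_trans lM (lat_meetl lM _ _) (lat_meetl lM _ _)).
        exact: lat_meetr.
      apply: (fun h => lat_trans lM h wv); apply: lat_meet => //.
        exact: (lat_trans lM (lat_meetl lM _ _) (lat_meetr lM _ _)).
      exact: lat_meetr.
    - by move=> u Ju [w pw wu]; apply: nu; exists w => //; apply: Jd Ju.
  have [u pu' Ju] := ext b nb; have [v pv Jv] := ext c nc.
  set w := meet u v; have pw : p w by apply: pm.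
  apply: (pJ _ _ (pm _ _ pw pbc)).
  apply: (Jd _ _ (meet_join_le tM w b c)); apply: Jj.
    apply: (Jd _ _ _ Ju); apply: lat_meet => //; last exact: lat_meetr.
    exact: (lat_trans lM (lat_meetl lM _ _) (lat_meetl lM _ _)).
  apply: (Jd _ _ _ Jv); apply: lat_meet => //; last exact: lat_meetr.
  exact: (lat_trans lM (lat_meetl lM _ _) (lat_meetr lM _ _)).
Qed.

(** Separate [a] from the ideal generated by [b] and the complement of [p]: if [a <= b \/ y] with
    [y] outside [p], then [minus a b <= y], which is excluded. This is the half of the duality
    between [minus] and [dsub] that needs a new point. *)
Lemma prime_minus (p : set M) a b : prime_filter p -> p (minus a b) ->
  exists q, [/\ prime_filter q, q `<=` p, q a & ~ q b].
Proof.
move=> [[_ p0] pu pm pj] pab.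
have [||q [fq qa qJ]] :=
  @prime_separation [set c | exists2 y, ~ p y & latle c (join b y)] a.
- split=> [|u v uv [y py vy]|u v [y py uy] [z pz vz]].
  + by exists (bot M) => //; apply: lat_bot.
  + by exists y => //; apply: (lat_trans lM uv vy).
  + exists (join y z); first by move=> /pj[].
    apply: lat_join => //.
      apply: (lat_trans lM uy); apply: lat_join => //; first exact: lat_joinl.
      by apply: (fun h => lat_trans lM h (lat_joinr lM _ _)); apply: lat_joinl.
    apply: (lat_trans lM vz); apply: lat_join => //; first exact: lat_joinl.
    by apply: (fun h => lat_trans lM h (lat_joinr lM _ _)); apply: lat_joinr.
- by move=> [y py] /(minus_min tM); move=> /(pu _ _ pab).
exists q; split=> //.
  move=> x qx; apply: contrapT => px; apply: (qJ x) => //.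
  by exists x => //; apply: lat_joinr.
by apply: qJ; exists (bot M) => //; apply: lat_joinl.
Qed.

Lemma prime_minus_mem (p : set M) a b : prime_filter p -> p a -> ~ p b -> p (minus a b).
Proof.
move=> [_ pu _ pj] pa nb.
by have [] := pj b (minus a b) (pu _ _ pa (minus_le tM a b)).
Qed.

Lemma prime_sep_le (a b : M) : ~ latle a b -> exists p, [/\ prime_filter p, p a & ~ p b].
Proof.
move=> ab; have [||p [fp pa pb]] := @prime_separation [set c | latle c b] a => //.
- split=> [|u v uv vb|u v]; first exact: lat_bot.
    exact: (lat_trans lM uv vb).
  exact: lat_join.
by exists p; split=> //; apply: pb; apply: lat_refl.
Qed.

Lemma prime_big (p : set M) (I : Type) (r : seq I) (f : I -> M) : prime_filter p ->
  p (\big[@join d M/bot M]_(i <- r) f i) -> exists i, p (f i).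
Proof.
move=> [[_ p0] _ _ pj]; elim: r => [|i r IHr]; first by rewrite big_nil => /p0.
by rewrite big_cons => /pj[pi|/IHr//]; exists i.
Qed.

End PrimeFilters.

Section Spectrum.
Variables (d : nat) (M : structure (L_SC d)).
Hypothesis aM : subscaled_axioms M.
Let tM : is_TC_lattice M := ax_tc aM.
Let lM : is_lattice M := tM.1.

(* [M -> Prop] rather than [set M], whose universe is too large for the carrier of a
   structure; likewise below. *)
Definition spec := {p : M -> Prop | prime_filter p}.
Implicit Types x y z : spec.

Lemma dlt_top k (a : M) : d < k -> dlt k a.
Proof. by move=> dk i ki; have := leq_trans dk ki; rewrite leqNgt ltn_ord. Qed.

Lemma dlt0 (a : M) : dlt 0 a -> a = bot M.
Proof.
move=> a0; rewrite -(ax_cover aM a); elim: (index_enum _) => [|i r IHr].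
  by rewrite big_nil.
by rewrite big_cons IHr a0 // join_bot.
Qed.

Lemma dltW k m (a : M) : k <= m -> dlt k a -> dlt m a.
Proof. by move=> km ak i mi; apply: ak; apply: leq_trans mi. Qed.

Lemma spec_dm_ex x : exists k, `[< exists a, sval x a /\ dlt k.+1 a >].
Proof.
exists d; apply/asboolP; exists (top M); split; last exact: dlt_top.
by case: (svalP x) => -[].
Qed.

(** The least sc-dimension of an element of the filter. *)
Definition spec_dm x : nat := ex_minn (spec_dm_ex x).

Lemma spec_dm_lt x k a : sval x a -> dlt k a -> spec_dm x < k.
Proof.
case: k => [|k] xa ak; last first.
  rewrite ltnS /spec_dm; case: ex_minnP => m _; apply.
  by apply/asboolP; exists a.
by have [[_ x0] _ _ _] := svalP x; case: x0; rewrite -(dlt0 ak).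
Qed.

Lemma spec_dmP x : exists a, sval x a /\ dlt (spec_dm x).+1 a.
Proof. by rewrite /spec_dm; case: ex_minnP => m /asboolP. Qed.

(** Inclusion is reversed, so that elements of [M] become down-sets. *)
Definition spec_le x y := sval y `<=` sval x.

Lemma spec_le_refl x : spec_le x x. Proof. by []. Qed.

Lemma spec_le_trans y x z : spec_le x y -> spec_le y z -> spec_le x z.
Proof. by move=> xy yz a /yz/xy. Qed.

Lemma spec_anti x y : spec_le x y -> spec_le y x -> x = y.
Proof.
case: x y => [p fp] [q fq] pq qp; apply: eq_exist => /=.
by apply/seteqP; split.
Qed.

(** Take [b] in the larger filter only and [a] of least sc-dimension in the smaller one. Then
    [e = minus a b] still belongs to the smaller filter, and [meet b e], which lies in the larger
    one, is strongly below [e], so its sc-dimension is strictly smaller. *)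
Lemma spec_dm_mono x y : spec_le x y -> x <> y -> spec_dm x < spec_dm y.
Proof.
move=> xy ne.
have [b [xb yb]] : exists b, sval x b /\ ~ sval y b.
  apply: contrapT => nb; apply: ne; apply: spec_anti => // b xb.
  by apply: contrapT => yb; apply: nb; exists b.
have [a [ya da]] := spec_dmP y.
have [[ytop ybot] yu ym yj] := svalP y; have [_ xu xm _] := svalP x.
set e := minus a b; have ye : sval y e by apply: prime_minus_mem.
have xc : sval x (meet b e) by apply: xm => //; apply: xy.
apply: (spec_dm_lt xc); apply: (ax_below aM (a := e)).
- exact: lat_meetr.
- by move=> e0; apply: ybot; rewrite -e0.
- apply: lat_anti => //; first exact: minus_sub.
  set t := minus e (meet b e); apply: minus_min => //.
  apply: (lat_trans lM (minus_le tM a b)); apply: lat_join => //.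
    exact: lat_joinl.
  apply: (lat_trans lM (minus_le tM e (meet b e))); apply: lat_join => //.
    exact: (lat_trans lM (lat_meetl lM _ _) (lat_joinl lM _ _)).
  exact: lat_joinr.
- by apply: (ax_mono aM _ da); apply: minus_sub.
Qed.

Definition spec_dpos : dpos spec := DPos spec_le_refl spec_le_trans spec_dm_mono.

Definition spec_set (a : M) : set spec := [set x | sval x a].

Lemma spec_bound : dbound spec_dpos d.+1.
Proof.
move=> x; apply: (spec_dm_lt (a := top M)); last exact: dlt_top.
by case: (svalP x) => -[].
Qed.

Lemma Cpart_le (a : M) i : latle (Cpart i a) a.
Proof. by rewrite -{2}(ax_cover aM a); apply: (big_join_le lM) => //; apply: mem_index_enum. Qed.

(** If the dimension of [y] were below [i], some [b] in [y] would have sc-dimension below [i].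
    Subtracting [b] leaves [Cpart i a] unchanged, so there is a point above [y] in [Cpart i a] and
    outside [b], against maximality. *)
Lemma spec_max_C (a : M) (i : 'I_d.+1) y : maxin spec_dpos (spec_set (Cpart i a)) y ->
  spec_dm y = i.
Proof.
move=> [ya my]; apply/eqP; rewrite eqn_leq; apply/andP; split.
  rewrite -ltnS; apply: (spec_dm_lt ya) => j ij; apply: (ax_orth aM).
  by apply/eqP => ji; move: ij; rewrite ji ltnn.
rewrite leqNgt; apply/negP => yi.
have [b [yb db]] := spec_dmP y.
have e := ax_minus aM a (dltW yi db).
have [|q [fq qy qa qb]] := prime_minus tM (svalP y) (a := Cpart i a) (b := b).
  by rewrite e.
by apply: qb; rewrite -(my (exist _ q fq)) // in yb.
Qed.

Theorem spec_rep : rep spec_dpos spec_set.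
Proof.
split.
- move=> a b ab; apply: lat_anti => //; apply: contrapT => nab.
    have [p [fp pa pb]] := prime_sep_le tM nab; apply: pb.
    by have : spec_set a (exist _ p fp) by []; rewrite ab.
  have [p [fp pa pb]] := prime_sep_le tM nab; apply: pb.
  by have : spec_set b (exist _ p fp) by []; rewrite -ab.
- by move=> a x y xy; apply: xy.
- by apply/seteqP; split=> // x; case: (svalP x) => -[].
- by apply/seteqP; split=> // x _; case: (svalP x) => -[].
- move=> a b; apply/seteqP; split=> x; have [_ xu _ xj] := svalP x.
    by move=> /xj.
  by case=> /xu; apply; [apply: lat_joinl|apply: lat_joinr].
- move=> a b; apply/seteqP; split=> x; have [_ xu xm _] := svalP x.
    by move=> xab; split; apply: xu xab _; [apply: lat_meetl|apply: lat_meetr].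
  by case; apply: xm.
- move=> a b; apply/seteqP; split=> x.
    move=> /(prime_minus tM (svalP x))[q [fq qx qa qb]].
    by exists (exist _ q fq).
  by move=> [y [xy ya yb]]; apply: xy; apply: prime_minus_mem => //; apply: svalP.
(* A point of [a] above [y] lies in some [Cpart j a]. If [j] differed from [i], then [y] would lie
   in the meet of the two components, of sc-dimension less than [i], whereas [y] has dimension
   [i]. *)
- have max_a i (a : M) y : maxin spec_dpos (spec_set (Cpart i a)) y ->
      maxin spec_dpos (spec_set a) y.
    move=> my; have yi := spec_max_C my; have [ya {}my] := my.
    have [_ yu ym _] := svalP y.
    split; first by apply: yu ya _; apply: Cpart_le.
    move=> z yz; rewrite /spec_set /= -{1}(ax_cover aM a) => /(prime_big (svalP z))[j zj].
    have [ji|ji] := eqVneq j i; first by apply: my => //; rewrite -ji.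
    have yij : sval y (meet (Cpart i a) (Cpart j a)) by apply: ym => //; apply: yz.
    have := spec_dm_lt yij (ax_meet aM a (i := i) (j := j) _).
    by rewrite eq_sym ji yi => /(_ isT); rewrite leq_min ltnn.
  move=> i a; apply/seteqP; split=> x.
    move=> /(max_above spec_bound)[y [xy my]]; exists y; split=> //.
      exact: max_a my.
    exact: spec_max_C my.
  move=> [y [xy [ya my] dy]]; apply: xy.
  have := ya; rewrite /spec_set /= -{1}(ax_cover aM a) => /(prime_big (svalP y))[j yj].
  suff ji : j = i by rewrite -ji.
  apply: val_inj => /=; rewrite -dy; apply/esym/spec_max_C; split; first exact: yj.
  move=> z yz zj; apply: my => //.
  by have [_ zu _ _] := svalP z; apply: zu zj _; apply: Cpart_le.
- exact: spec_bound.
Qed.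

End Spectrum.

(** * First-order definability of the axioms *)

Section Definable.
Variable L : language.

(** Definability is a property of families of functions given on all structures at once; closure
    under the operations lets sentences be found by search instead of being written out. *)
Definition dterm n (t : forall M : structure L, ('I_n -> M) -> M) :=
  exists s : term L n, forall M v, eval v s = t M v.

Definition dform n (P : forall M : structure L, ('I_n -> M) -> Prop) :=
  exists phi : formula L n, forall (M : structure L) (v : 'I_n -> M), sat phi v <-> P M v.

Lemma dterm_var n (i : 'I_n) : dterm (fun M v => v i).
Proof. by exists (Var i). Qed.

Lemma dform_eq n s t : @dterm n s -> dterm t -> dform (fun M v => s M v = t M v).
Proof. by move=> [s' hs] [t' ht]; exists (Eq s' t') => M v /=; rewrite hs ht. Qed.

Lemma dform_imp n P Q : @dform n P -> dform Q -> dform (fun M v => P M v -> Q M v).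
Proof.
move=> [p hp] [q hq]; exists (Imp p q) => M v /=.
by split=> h /hp/h/hq.
Qed.

Lemma dform_not n P : @dform n P -> dform (fun M v => ~ P M v).
Proof.
move=> [p hp]; exists (Neg p) => M v /=.
by split=> h /hp/h.
Qed.

Lemma dform_iff n P Q : @dform n P -> (forall M v, P M v <-> Q M v) -> dform Q.
Proof. by move=> [p hp] PQ; exists p => M v; rewrite hp. Qed.

Lemma dform_cst n (P : Prop) : @dform n (fun _ _ => P).
Proof.
have [p|np] := pselect P.
  by exists (Imp Fls Fls) => M v /=; split.
by exists Fls => M v /=; split.
Qed.

Lemma dform_and n P Q : @dform n P -> dform Q -> dform (fun M v => P M v /\ Q M v).
Proof.
move=> dP dQ; apply: (dform_iff (dform_not (dform_imp dP (dform_not dQ)))).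
move=> M v; split=> [h|[p q] h]; last exact: h.
by split; apply: contrapT => nh; apply: h.
Qed.

Lemma dform_all n (P : forall M : structure L, M -> ('I_n -> M) -> Prop) :
  @dform n.+1 (fun M v => P M (v ord0) (fun i => v (lift ord0 i))) ->
  dform (fun M v => forall a, P M a v).
Proof.
move=> [p hp]; exists (All p) => M v /=; split=> h a; move: (h a); rewrite hp /scons;
  rewrite unlift_none; set w := fun i => _; suff -> : w = v by [];
  by apply: funext => i; rewrite /w liftK.
Qed.

Lemma dform_ex n (P : forall M : structure L, M -> ('I_n -> M) -> Prop) :
  @dform n.+1 (fun M v => P M (v ord0) (fun i => v (lift ord0 i))) ->
  dform (fun M v => exists a, P M a v).
Proof.
move=> dP; have := dform_all (P := fun M a v => ~ P M a v) (dform_not dP).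
move=> /dform_not/dform_iff; apply=> M v; split=> [h|[a pa] h]; last exact: h pa.
by apply: contrapT => ne; apply: h => a pa; apply: ne; exists a.
Qed.

Lemma dform_fin (T : finType) n (P : T -> forall M : structure L, ('I_n -> M) -> Prop) :
  (forall i, dform (P i)) -> dform (fun M v => forall i, P i M v).
Proof.
move=> dP.
have [p hp] : dform (fun M v => forall i, i \in enum T -> P i M v).
  elim: (enum T) => [|i s IHs].
    by apply: (dform_iff (dform_cst _ True)).
  apply: (dform_iff (dform_and (dP i) IHs)) => M v; split.
    by move=> [pi h] j; rewrite inE => /orP[/eqP ->//|/h].
  move=> h; split=> [|j js]; apply: h; first exact: mem_head.
  by rewrite inE js orbT.
exists p => M v; rewrite hp; split=> h i; last by move=> _.
by apply: h; rewrite mem_enum.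
Qed.

(** An arbitrary model of [theory_of K] need not lie in [K]; definable properties of the members of
    [K] reach it in this way. *)
Lemma models_dform (K : set (structure L)) (P : structure L -> Prop) (M : structure L) :
  @dform 0 (fun M _ => P M) -> (forall N, K N -> P N) -> models M (theory_of K) -> P M.
Proof.
move=> [p hp] KP MK; apply/hp/(MK p) => N KN; apply/hp; exact: KP.
Qed.

End Definable.

Section DefinableSC.
Variables (d n : nat).
Implicit Types s t : forall M : structure (L_SC d), ('I_n -> M) -> M.

Lemma dterm_bot : @dterm (L_SC d) n (fun M _ => bot M).
Proof.
exists (@App (L_SC d) n SCbot (@no_var _)) => M v /=; congr interp.
by apply: funext => -[].
Qed.

Lemma dterm_top : @dterm (L_SC d) n (fun M _ => top M).
Proof.
exists (@App (L_SC d) n SCtop (@no_var _)) => M v /=; congr interp.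
by apply: funext => -[].
Qed.

Lemma dterm_join s t : dterm s -> dterm t -> dterm (fun M v => join (s M v) (t M v)).
Proof.
move=> [s' hs] [t' ht]; exists (@App (L_SC d) n SCjoin (tnth [tuple s'; t'])) => M v /=.
congr interp; apply: funext => i; rewrite -hs -ht !(tnth_nth s') !(tnth_nth (eval v s')) /=.
by case: i => -[|[|]].
Qed.

Lemma dterm_meet s t : dterm s -> dterm t -> dterm (fun M v => meet (s M v) (t M v)).
Proof.
move=> [s' hs] [t' ht]; exists (@App (L_SC d) n SCmeet (tnth [tuple s'; t'])) => M v /=.
congr interp; apply: funext => i; rewrite -hs -ht !(tnth_nth s') !(tnth_nth (eval v s')) /=.
by case: i => -[|[|]].
Qed.

Lemma dterm_minus s t : dterm s -> dterm t -> dterm (fun M v => minus (s M v) (t M v)).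
Proof.
move=> [s' hs] [t' ht]; exists (@App (L_SC d) n SCminus (tnth [tuple s'; t'])) => M v /=.
congr interp; apply: funext => i; rewrite -hs -ht !(tnth_nth s') !(tnth_nth (eval v s')) /=.
by case: i => -[|[|]].
Qed.

Lemma dterm_C i s : dterm s -> dterm (fun M v => Cpart i (s M v)).
Proof.
move=> [s' hs]; exists (@App (L_SC d) n (SCcomp i) (tnth [tuple s'])) => M v /=.
congr interp; apply: funext => j; rewrite -hs !(tnth_nth s') !(tnth_nth (eval v s')) /=.
by case: j => -[|].
Qed.

Lemma dterm_big s : dterm s ->
  dterm (fun M v => \big[@join d M/bot M]_(i < d.+1) Cpart i (s M v)).
Proof.
move=> ds; elim: (index_enum _) => [|i r [t ht]].
  by have [t ht] := dterm_bot; exists t => M v; rewrite ht big_nil.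
have [u hu] := dterm_join (dterm_C i ds) (ex_intro _ t (fun M v => erefl (eval v t))).
by exists u => M v; rewrite hu ht big_cons.
Qed.

Lemma dform_dlt k s : dterm s -> dform (fun M v => dlt k (s M v)).
Proof.
move=> ds; apply: dform_fin => i; apply: dform_imp; first exact: dform_cst.
apply: dform_eq; first exact: dterm_C.
exact: dterm_bot.
Qed.

Lemma dform_latle s t : dterm s -> dterm t -> dform (fun M v => latle (s M v) (t M v)).
Proof. by move=> ds dt; apply: dform_eq => //; apply: dterm_join. Qed.

End DefinableSC.

Ltac definable :=
  repeat first
    [ apply: dform_all | apply: dform_ex | apply: dform_dlt | apply: dform_latle
    | apply: dform_not | apply: dform_imp | apply: dform_and | apply: dform_eq
    | apply: dterm_big | apply: dterm_C
    | apply: dterm_join | apply: dterm_meet | apply: dterm_minus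
    | apply: dterm_bot | apply: dterm_top | exact: dterm_var ].

Section Models.
Variables (d : nat) (K : set (structure (L_SC d))) (M : structure (L_SC d)).
Hypothesis MK : models M (theory_of K).

Lemma models_subscaled_axioms : (forall N, K N -> subscaled_axioms N) -> subscaled_axioms M.
Proof.
move=> KA.
have T (P : structure (L_SC d) -> Prop) (h : @dform (L_SC d) 0 (fun M _ => P M)) hK : P M :=
  models_dform h hK MK.
split.
- split; first split; first split.
  + apply: (T (fun M => forall a b : M, join a b = join b a)); first by definable.
    by move=> N /KA/ax_tc[[[]]].
  + apply: (T (fun M => forall a b : M, meet a b = meet b a)); first by definable.
    by move=> N /KA/ax_tc[[[]]].
  + split.
      apply: (T (fun M => forall a b c : M, join a (join b c) = join (join a b) c)).
        by definable.
      by move=> N /KA/ax_tc[[_ []]].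
    apply: (T (fun M => forall a b c : M, meet a (meet b c) = meet (meet a b) c)).
      by definable.
    by move=> N /KA/ax_tc[[_ []]].
  + split.
      apply: (T (fun M => forall a b : M, join a (meet a b) = a)); first by definable.
      by move=> N /KA/ax_tc[[_ _ []]].
    apply: (T (fun M => forall a b : M, meet a (join a b) = a)); first by definable.
    by move=> N /KA/ax_tc[[_ _ []]].
  + apply: (T (fun M => forall a : M, latle (bot M) a /\ latle a (top M))).
      by definable.
    by move=> N /KA/ax_tc[[_ _ _ ]].
  + move=> a b; split; move: a b.
      apply: (T (fun M => forall a b : M, latle a (join b (minus a b)))); first by definable.
      by move=> N /KA/ax_tc[_ h] a b; case: (h a b).
    apply: (T (fun M => forall a b c : M, latle a (join b c) -> latle (minus a b) c)).
      by definable.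
    by move=> N /KA/ax_tc[_ h] a b; case: (h a b).
- apply: (T (fun M => forall a : M, \big[@join d M/bot M]_(i < d.+1) Cpart i a = a)).
    by definable.
  by move=> N /KA/ax_cover.
- move=> a i j ji; move: a.
  apply: (T (fun M => forall a : M, Cpart j (Cpart i a) = bot M)); first by definable.
  by move=> N /KA/ax_orth h a; apply: h.
- move=> a b k; move: a b.
  apply: (T (fun M => forall a b : M, latle b a -> dlt k a -> dlt k b)); first by definable.
  by move=> N /KA/ax_mono h a b; apply: h.
- move=> a i j ij; move: a.
  apply: (T (fun M => forall a : M, dlt (minn i j) (meet (Cpart i a) (Cpart j a)))).
    by definable.
  by move=> N /KA/ax_meet h a; apply: h.
- move=> a b i; move: a b.
  apply: (T (fun M => forall a b : M, dlt i b -> minus (Cpart i a) b = Cpart i a)).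
    by definable.
  by move=> N /KA/ax_minus h a b; apply: h.
- move=> a b k; move: a b.
  apply: (T (fun M => forall a b : M, latle b a -> a <> bot M -> minus a b = a ->
    dlt k.+1 a -> dlt k b)); first by definable.
  by move=> N /KA/ax_below h a b; apply: h.
Qed.

End Models.

(** * First-order axioms for super scaled lattices *)

(** Purity is expressed by [Cpart k a = a] and the dimensions range over the finitely many indices,
    so each clause is a sentence. Conjunctions are iterated binary ones, the form that [definable]
    takes apart. *)
Record super_axioms (d : nat) (M : structure (L_SC d)) : Prop := SuperAx {
  sa_scaling : forall i j : 'I_d.+1, j = i.+1 :> nat -> forall a : M,
    Cpart j a = a -> a <> bot M ->
    exists b : M, latle b a /\ Cpart i b = b /\ b <> bot M;
  sa_caten : forall r q p : 'I_d.+1, r <= q -> q <= p -> forall c a : M,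
    latle c a -> a <> bot M -> c <> bot M -> Cpart p a = a -> Cpart r c = c ->
    exists b : M, Cpart q b = b /\ latle c b /\ latle b a;
  sa_split : forall b1 b2 a : M, latle (join b1 b2) a -> a <> bot M ->
    minus a (join b1 b2) = a ->
    exists a1 a2 : M, a1 <> bot M /\ a2 <> bot M /\ latle b1 a1 /\ latle b2 a2 /\
      a1 = minus a a2 /\ a2 = minus a a1 /\ meet a1 a2 = meet b1 b2 }.

Lemma models_super_axioms d (K : set (structure (L_SC d))) M :
  models M (theory_of K) -> (forall N, K N -> super_axioms N) -> super_axioms M.
Proof.
move=> MK KA.
have T (P : structure (L_SC d) -> Prop) (h : @dform (L_SC d) 0 (fun M _ => P M)) hK : P M :=
  models_dform h hK MK.
split.
- move=> i j ji.
  apply: (T (fun M => forall a : M, Cpart j a = a -> a <> bot M ->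
    exists b : M, latle b a /\ Cpart i b = b /\ b <> bot M)); first by definable.
  by move=> N /KA/sa_scaling; apply.
- move=> r q p rq qp.
  apply: (T (fun M => forall c a : M,
    latle c a -> a <> bot M -> c <> bot M -> Cpart p a = a -> Cpart r c = c ->
    exists b : M, Cpart q b = b /\ latle c b /\ latle b a)); first by definable.
  by move=> N /KA/sa_caten; apply.
- apply: (T (fun M => forall b1 b2 a : M, latle (join b1 b2) a -> a <> bot M ->
    minus a (join b1 b2) = a ->
    exists a1 a2 : M, a1 <> bot M /\ a2 <> bot M /\ latle b1 a1 /\ latle b2 a2 /\
      a1 = minus a a2 /\ a2 = minus a a1 /\ meet a1 a2 = meet b1 b2)).
    by definable.
  by move=> N /KA/sa_split.
Qed.

(** * Super scaled lattices, algebraically *)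

Section Scaled.
Variables (d : nat) (M : structure (L_SC d)).
Hypothesis sM : is_subscaled M.
Let aM : subscaled_axioms M := is_subscaled_axioms sM.
Let tM : is_TC_lattice M := ax_tc aM.
Let lM : is_lattice M := tM.1.
Let o := spec_dpos aM.
Let h : M -> set (spec M) := @spec_set d M.
Let rh : rep o h := spec_rep aM.
Implicit Types a b : M.

Lemma subscaled_scdim a : exists n, [/\ n <= d.+1, scdim a = (n%:Z - 1)%:E%E &
    forall k, dlt k a <-> n <= k].
Proof. by have [_ H1 [H2 _ _ _ _]] := sM; apply: scdimP. Qed.

(** The numbering goes downwards from the highest point [y 0], because increasing prime filters are
    descending points. *)
Definition spec_chain a n (y : nat -> spec M) :=
  (forall i, i <= n -> h a (y i)) /\
  forall i, i < n -> ple o (y i.+1) (y i) /\ y i.+1 <> y i.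

Lemma prime_chainP a n : prime_chain a n <-> exists y, spec_chain a n y.
Proof.
split=> [[p [fp sp]]|[y [ya sy]]].
  exists (fun i => exist _ (p (inord i)) (fp (inord i)).1); split=> [i _|i ni].
    exact: (fp (inord i)).2.
  have [|le nle] := sp (inord i) (inord i.+1).
    by rewrite !inordK // ltnS ltnW.
  split; first exact: le.
  by move=> /(congr1 sval) /= e; apply: nle; rewrite e.
exists (fun i : 'I_n.+1 => sval (y i)); split=> [i|i j ji].
  by split; [apply: svalP|apply: ya; rewrite -ltnS].
have [|le ne] := sy i; first by have := ltn_ord j; rewrite ji ltnS.
rewrite ji; split; first exact: le.
by move=> le'; apply: ne; apply: (ple_anti le).
Qed.

Lemma spec_chain_dm a n y i j : spec_chain a n y -> i <= j -> j <= n ->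
  dm o (y j) + (j - i) <= dm o (y i).
Proof.
move=> [_ sy]; elim: j => [|j IHj] ij jn.
  by rewrite sub0n addn0 (_ : i = 0) //; lia.
move: ij; rewrite leq_eqVlt => /orP[/eqP <-|ij]; first by rewrite subnn addn0.
have [le ne] := sy j jn; have := dm_lt le ne.
have := IHj ij (ltnW jn); move: ij; clear; lia.
Qed.

(** As for the sc-dimension, [m] is the dimension plus one: the number of points of a longest chain
    in [a]. Each step of a chain lowers [dm], whence the bound of [m] by the sc-dimension. *)
Lemma latdimP a : exists m, [/\ latdim a = (m%:Z - 1)%:E%E, m = 0 <-> a = bot M,
  forall k, dlt k a -> m <= k, forall k, prime_chain a k -> k < m &
  0 < m -> prime_chain a m.-1].
Proof.
have [n [_ _ nP]] := subscaled_scdim a.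
have /(rep_dlt rh) na : dlt n a by apply/nP.
have bound k : prime_chain a k -> k < n.
  move=> /prime_chainP[y cy]; have [ya _] := cy.
  have := spec_chain_dm cy (leq0n k) (leqnn k); have := na _ (ya 0 (leq0n k)); lia.
have [[x ax]|a0] := pselect (h a !=set0); last first.
  exists 0; split=> //.
  - have -> : latdim a = supremum (-1)%:E%E [set n%:Z%:E%E | n in prime_chain a] by [].
    rewrite (_ : [set _ | _ in _] = set0) ?supremum0 //.
    apply/seteqP; split=> // z [k /prime_chainP[y [ya _]] _].
    by case: a0; exists (y 0); apply: ya.
  - split=> // _; apply: contrapT => /(rep_n0 rh); exact: a0.
  - by move=> k /prime_chainP[y [ya _]]; case: a0; exists (y 0); apply: ya.
have ex : exists k, `[< prime_chain a k >].
  by exists 0; apply/asboolP/prime_chainP; exists (fun=> x); split.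
have ub k : `[< prime_chain a k >] -> k <= n by move=> /asboolP/bound/ltnW.
case: (ex_maxnP ex ub) => m /asboolP cm mmax.
exists m.+1; split=> //.
- apply: supremum_max; first by exists m => //; congr (_%:E)%E; lia.
  by move=> _ [k ck <-]; rewrite lee_fin; have := mmax k (asboolT ck); lia.
- by split=> // a0; case: (rep_n0 rh a).2; first by exists x.
- by move=> k /nP; apply: leq_trans; apply: bound.
- by move=> k ck; apply: mmax; apply/asboolP.
Qed.

(** The lattice dimension never exceeds the sc-dimension, so the equality only asks for one chain
    that is long enough. *)
Lemma scaledP : is_scaled M <->
  forall a, a <> bot M -> exists n, dlt n.+1 a /\ prime_chain a n.
Proof.
split=> [[_ sc] a a0|H].
  have [n [_ nE nP]] := subscaled_scdim a.
  have [m [mE m0 _ _ cm]] := latdimP a.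
  have : scdim a = latdim a by apply: sc.
  rewrite nE mE => -[] nm; have {}nm : n = m by lia.
  have mgt : 0 < m by rewrite lt0n; apply/eqP => /m0.
  exists m.-1; split; last exact: cm.
  by apply/nP; lia.
split=> // a; have [n [_ -> nP]] := subscaled_scdim a.
have [m [-> m0 mk mc _]] := latdimP a.
have mn : m <= n by apply/mk/nP.
suff : n <= m by move=> nm; congr (_%:E)%E; lia.
have [/m0 m0'|a0] := pselect (a = bot M).
  suff : n <= 0 by lia.
  apply/nP => i _; rewrite (m0.1 m0'); apply: (rep_inj rh).
  rewrite (rep_C rh) (rep_bot rh); apply/seteqP; split=> // x [y [_ [] //]].
by have [k [/nP nk /mc km]] := H a a0; apply: leq_trans nk km.
Qed.

(** Purity is tested on [a - C^k(a)]. Were it nonzero, it would have dimension [k]; yet a maximal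
    point of [a] outside [C^k(a)] does not have dimension [k]. Conversely, if [C^k(a) = a], every
    nonzero difference contains a point of dimension [k]. *)
Lemma pure_points (k : 'I_d.+1) a : is_scaled M -> pure k a <-> Cpart k a = a.
Proof.
move=> [_ sc].
have E b : latdim b = (k : nat)%:Z%:E%E <-> dlt k.+1 b /\ ~ dlt k b.
  rewrite -sc; have [n [_ -> nP]] := subscaled_scdim b; rewrite !nP.
  by split=> [[] e|[e1 e2]]; [split|congr (_%:E)%E]; lia.
split=> [pa|pa b].
  apply: lat_anti => //; first exact: Cpart_le.
  set e := minus a (Cpart k a).
  have [e0|/pa/E[/(rep_dlt rh) ek /(rep_dlt rh) nk]] := pselect (e = bot M).
    have := minus_le tM a (Cpart k a); rewrite -/e e0 join_bot //.
  exfalso; apply: nk => x; rewrite (rep_minus rh) => -[y [xy ay ny]].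
  have [z [yz mz]] := max_above (rep_bound rh) ay.
  have nz : ~ h (Cpart k a) z by move=> cz; apply: ny; apply: (rep_down rh yz).
  have ez : h e z by rewrite (rep_minus rh); exists z; split; [exact: ple_refl|case: mz|].
  apply: leq_ltn_trans (dm_le (ple_trans xy yz)) _.
  rewrite ltn_neqAle -ltnS ek // andbT; apply/eqP => dz; apply: nz.
  by rewrite (rep_C rh); exists z; split=> //; apply: ple_refl.
have {}pa : cpt o k (h a) = h a by rewrite -(rep_C rh) pa.
move=> /(rep_n0 rh)[x]; rewrite (rep_minus rh) => -[y [xy ay ny]].
have [z [yz az dz]] := pure_top pa ay.
apply/E; split.
  apply/(rep_dlt rh) => w; rewrite (rep_minus rh) => -[v [wv av _]].
  by rewrite ltnS; apply: leq_trans (dm_le wv) (pure_dm pa av).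
move=> /(rep_dlt rh)/(_ z); rewrite dz ltnn (rep_minus rh) => e; suff : false by [].
apply: e; exists z; split; [exact: ple_refl|by []|].
by move=> bz; apply: ny; apply: (rep_down rh yz).
Qed.

Lemma pure_dim_bound k a : is_scaled M -> pure_dim k a -> k < d.+1.
Proof.
move=> [_ sc] [a0 pa].
have e : minus a (bot M) = a.
  apply: lat_anti => //; first exact: minus_sub.
  by have := minus_le tM a (bot M); rewrite /latle lat_bot.
have := pa (bot M); rewrite e -sc => /(_ a0).
by have [n [nd -> _]] := subscaled_scdim a => -[]; lia.
Qed.

Lemma is_super_axioms : is_super_scaled M -> super_axioms M.
Proof.
move=> [sc cat sp]; split.
- move=> i j ji a pa a0; have [n [/(rep_dlt rh) an]] := (scaledP.1 sc) a a0.
  move=> /prime_chainP[y cy]; have [ya _] := cy.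
  have {}pa : cpt o j (h a) = h a by rewrite -(rep_C rh) pa.
  have [x ax] := (rep_n0 rh a).1 a0.
  have [z [_ az dz]] := pure_top pa ax.
  have jn : j <= n by have := an z az; rewrite dz ltnS.
  have y0 := pure_dm pa (ya 0 (leq0n n)).
  have n0 : 0 < n by apply: leq_trans jn; rewrite ji.
  (* The chain starts at dimension at most [j] and has length [n >= j], so it descends by exactly
     one at each step. *)
  have dy1 : dm o (y 1) = i.
    have := spec_chain_dm cy n0 (leqnn n); have := spec_chain_dm cy (leq0n 1) n0.
    move: y0 jn n0; rewrite ji; clear; lia.
  (* An element of least sc-dimension in the filter [y 1] cuts [a] down to sc-dimension [i] while
     keeping this point. *)
  have [e [ye ed]] := spec_dmP (y 1); move: ed; rewrite (_ : spec_dm (y 1) = i) // => ed.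
  have hme : h (meet e a) (y 1) by rewrite (rep_meet rh); split=> //; apply: ya.
  have med : dlt i.+1 (meet e a) by apply: (ax_mono aM _ ed); apply: lat_meetl.
  exists (Cpart i (meet e a)); split.
    by apply: (lat_trans lM (Cpart_le aM _ _)); apply: lat_meetr.
  split.
    by apply: (rep_inj rh); rewrite !(rep_C rh) cpt_idem //; apply: (rep_down rh).
  apply/(rep_n0 rh); exists (y 1); rewrite (rep_C rh).
  exists (y 1); split; [exact: ple_refl| |by []].
  split=> // w yw hw; apply/esym/(ple_dm_eq yw); rewrite dy1 -ltnS.
  by move/(rep_dlt rh): med; apply.
- move=> r q p rq qp c a ca a0 c0 pa pc.
  have [||b [pb cb ba]] := cat r q p c a rq qp ca.
  + by split=> //; apply/(pure_points _ _ sc).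
  + by split=> //; apply/(pure_points _ _ sc).
  by exists b; split=> //; apply/(pure_points _ _ sc).
- move=> b1 b2 a ba a0 e; have [|a1 [a2 [[? ?] [? ?] [? ?] ?]]] := sp b1 b2 a.
    exact/(strongly_belowP tM).
  by exists a1, a2; do !split.
Qed.

(** For Scaling, a chain through all dimensions [0, ..., k] is built in a [k]-pure element: a chain
    in a pure element one degree lower is extended by a point of dimension [k] above it. Catenarity
    and Splitting are then translated through [pure_points] and [strongly_belowP]. *)
Lemma super_axioms_super : super_axioms M -> is_super_scaled M.
Proof.
move=> [sa sb sp].
have chain k (a : M) (kd : k < d.+1) : Cpart (Ordinal kd) a = a -> a <> bot M ->
    exists y : nat -> spec M, (forall i, i <= k -> h a (y i) /\ dm o (y i) = i) /\
      forall i, i < k -> ple o (y i) (y i.+1).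
  elim: k a kd => [|k IHk] a kd pa a0.
    have [x ax] := (rep_n0 rh a).1 a0; exists (fun=> x); split=> // i.
    rewrite leqn0 => /eqP ->; split=> //; apply/eqP; rewrite -leqn0.
    have {}pa : cpt o 0 (h a) = h a by rewrite -{2}pa (rep_C rh).
    exact: (pure_dm pa ax).
  have [|b [ba [pb b0]]] := sa (Ordinal (ltnW kd)) (Ordinal kd) _ a pa a0 => //.
  have [y [hy sy]] := IHk b _ pb b0.
  have /(rep_le rh) hba := ba.
  have {}pa : cpt o k.+1 (h a) = h a by rewrite -{2}pa (rep_C rh).
  have [w [yw aw dw]] := pure_top pa (hba _ (hy k (leqnn k)).1).
  exists (fun i => if i <= k then y i else w); split=> i.
    rewrite leq_eqVlt => /orP[/eqP ->|]; first by rewrite ltnn.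
    by rewrite ltnS => ik; rewrite ik; have [hb ?] := hy i ik; split=> //; apply: hba.
  rewrite ltnS => ik; rewrite ik; case: ifP => [|/negbT]; first exact: sy.
  by rewrite -leqNgt => ki; have -> : i = k by apply/eqP; rewrite eqn_leq ik.
have sc : is_scaled M.
  apply/scaledP => a a0; have [n [nd _ nP]] := subscaled_scdim a.
  have n0 : 0 < n.
    rewrite lt0n; apply/eqP => n0; apply: a0; apply: (dlt0 aM).
    by apply/nP; rewrite n0.
  have kd : n.-1 < d.+1 by lia.
  exists n.-1; rewrite prednK //; split; first exact/nP.
  have cn0 : Cpart (Ordinal kd) a <> bot M.
    move=> c0; suff /nP : dlt n.-1 a by lia.
    move=> i; rewrite leq_eqVlt => /orP[/eqP ei|ni].
      by rewrite (_ : i = Ordinal kd) //; apply: val_inj.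
    by apply: ((nP n).2 (leqnn n)); lia.
  have idem : Cpart (Ordinal kd) (Cpart (Ordinal kd) a) = Cpart (Ordinal kd) a.
    by apply: (rep_inj rh); rewrite !(rep_C rh) cpt_idem //; apply: (rep_down rh).
  have [y [hy sy]] := chain _ _ _ idem cn0.
  have /(rep_le rh) ca := Cpart_le aM a (Ordinal kd).
  apply/prime_chainP; exists (fun i => y (n.-1 - i)); split=> i ni.
    by apply: ca; apply: (hy _ _).1; apply: leq_subr.
  have e : n.-1 - i = (n.-1 - i.+1).+1 by lia.
  rewrite e; split; first by apply: sy; lia.
  move=> ey; have [|_ d1] := hy (n.-1 - i.+1) _; first exact: leq_subr.
  have [|_ d2] := hy (n.-1 - i.+1).+1 _; first by lia.
  by move: d1; rewrite ey d2; lia.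
split=> //.
- move=> r q p c a rq qp ca pa pc.
  have pd := pure_dim_bound sc pa; have qd := leq_ltn_trans qp pd.
  have rd := leq_ltn_trans rq qd.
  have [||b [pb [cb ba]]] :=
    sb (Ordinal rd) (Ordinal qd) (Ordinal pd) rq qp c a ca pa.1 pc.1.
  + by apply/(pure_points _ _ sc); apply: pa.2.
  + by apply/(pure_points _ _ sc); apply: pc.2.
  exists b; split=> //.
  exact: ((pure_points (Ordinal qd) b sc).2 pb).
- move=> b1 b2 a /(strongly_belowP tM)[ba a0 e].
  have [a1 [a2 [? [? [? [? [? [? ?]]]]]]]] := sp b1 b2 a ba a0 e.
  by exists a1, a2; do !split.
Qed.

End Scaled.

(** * Super scaled lattices as families of down-sets *)

Section SuperRep.
Variables (d : nat) (M : structure (L_SC d)) (X : Type) (o : dpos X) (h : M -> set X).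
Hypothesis rh : rep o h.

Lemma rep_dsys : dsys o (range h).
Proof.
split.
- by move=> _ [a _ <-]; apply: (rep_down rh).
- by exists (bot M) => //; apply: rep_bot rh.
- by move=> _ _ [a _ <-] [b _ <-]; exists (join a b) => //; apply: rep_join rh _ _.
- by move=> _ _ [a _ <-] [b _ <-]; exists (meet a b) => //; apply: rep_meet rh _ _.
- by move=> _ _ [a _ <-] [b _ <-]; exists (minus a b) => //; apply: rep_minus rh _ _.
- move=> i _ [a _ <-]; have [id|di] := ltnP i d.+1.
    by exists (Cpart (Ordinal id) a) => //; apply: rep_C rh _ _.
  exists (bot M) => //; rewrite (rep_bot rh); apply/seteqP; split=> // x.
  by move=> [y [_ _ dy]]; have := rep_bound rh y; rewrite dy ltnNge di.
Qed.

Lemma rep_supersys : super_axioms M -> supersys o (range h).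
Proof.
move=> [sa sb sp].
have bd k A : cpt o k A = A -> A !=set0 -> k < d.+1.
  by move=> pA [x /(pure_top pA)[y [_ _ <-]]]; apply: (rep_bound rh).
have pC (k : 'I_d.+1) a : cpt o k (h a) = h a <-> Cpart k a = a.
  by split=> [e|{2}<-]; [apply: (rep_inj rh)|]; rewrite (rep_C rh).
split.
- move=> k _ [a _ <-] pa na; have kd := bd _ _ pa na.
  have [||b [/(rep_le rh) ba [pb /(rep_n0 rh) b0]]] :=
    sa (Ordinal (ltnW kd)) (Ordinal kd) erefl a.
  + exact/pC.
  + exact/(rep_n0 rh).
  by exists (h b); split; [exists b| |apply/(pC (Ordinal (ltnW kd)))|].
- move=> r q p _ _ rq qp [c _ <-] [a _ <-] ca pa pc na nc.
  have pd := bd _ _ pa na; have qd := leq_ltn_trans qp pd.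
  have rd := leq_ltn_trans rq qd.
  have [|||||b [pb [/(rep_le rh) cb /(rep_le rh) ba]]] :=
    sb (Ordinal rd) (Ordinal qd) (Ordinal pd) rq qp c a.
  + exact/(rep_le rh).
  + exact/(rep_n0 rh).
  + exact/(rep_n0 rh).
  + exact/pC.
  + exact/pC.
  by exists (h b); split; [exists b|apply/(pC (Ordinal qd))| |].
- move=> _ _ _ [b1 _ <-] [b2 _ <-] [a _ <-]; rewrite -(rep_join rh) => ba na e.
  have [|||a1 [a2 [n1 [n2 [l1 [l2 [e1 [e2 eI]]]]]]]] := sp b1 b2 a.
  + exact/(rep_le rh).
  + exact/(rep_n0 rh).
  + by apply: (rep_inj rh); rewrite (rep_minus rh).
  exists (h a1), (h a2); split.
  + by split; [exists a1|exists a2].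
  + by split; apply/(rep_n0 rh).
  + by split; apply/(rep_le rh).
  + by rewrite -!(rep_minus rh) -e1 -e2.
  + by rewrite -!(rep_meet rh) eI.
Qed.

Lemma supersys_super_axioms : supersys o (range h) -> super_axioms M.
Proof.
move=> [sa sb sp].
have pC (k : 'I_d.+1) a : cpt o k (h a) = h a <-> Cpart k a = a.
  by split=> [e|{2}<-]; [apply: (rep_inj rh)|]; rewrite (rep_C rh).
have rE a : range h (h a) by exists a.
split.
- move=> i j ji a /pC; rewrite ji => pa /(rep_n0 rh) na.
  have [_ [[b _ <-] ba pb nb]] := sa i _ (rE a) pa na.
  exists b; split; first exact/(rep_le rh).
  by split; [apply/pC|apply/(rep_n0 rh)].
- move=> r q p rq qp c a /(rep_le rh) ca /(rep_n0 rh) na /(rep_n0 rh) nc /pC pa /pC pc.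
  have [_ [[b _ <-] pb cb ba]] := sb r q p _ _ rq qp (rE c) (rE a) ca pa pc na nc.
  exists b; split; first exact/pC.
  by split; apply/(rep_le rh).
- move=> b1 b2 a /(rep_le rh); rewrite (rep_join rh) => ba /(rep_n0 rh) na e.
  have [|_ [_ [[[a1 _ <-] [a2 _ <-]] [n1 n2] [l1 l2] [e1 e2] eI]]] :=
      sp _ _ _ (rE b1) (rE b2) (rE a) ba na.
    by rewrite -(rep_join rh) -(rep_minus rh) e.
  exists a1, a2; do !split; do ?(exact/(rep_n0 rh)); do ?(exact/(rep_le rh)).
  + by apply: (rep_inj rh); rewrite (rep_minus rh).
  + by apply: (rep_inj rh); rewrite (rep_minus rh).
  + by apply: (rep_inj rh); rewrite !(rep_meet rh).
Qed.

End SuperRep.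

(** * Embedding into a super scaled lattice *)

Section Refinements.
Variables (X : Type) (o : dpos X).

Definition cat_cond (t : option X * X * nat) : Prop :=
  (forall x, t.1.1 = Some x -> [/\ ple o x t.1.2, x <> t.1.2 & dm o x < t.2]) /\
  t.2 < dm o t.1.2.

(* [inr (u, y, k)] is a new point of dimension [k] below [y], and above [x] when
   [u = Some x]. *)
Definition catT : Type := (X + {t | cat_cond t})%type.

Definition cat_le (u v : catT) : Prop :=
  match u, v with
  | inl a, inl b => ple o a b
  | inl a, inr t => exists2 x, (sval t).1.1 = Some x & ple o a x
  | inr t, inl b => ple o (sval t).1.2 b
  | inr s, inr t => s = t \/ exists2 x, (sval t).1.1 = Some x & ple o (sval s).1.2 x
  end.

Definition cat_dm (u : catT) : nat :=
  match u with inl a => dm o a | inr t => (sval t).2 end.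

Lemma cat_refl u : cat_le u u.
Proof. by case: u => [a|t] /=; [apply: ple_refl|left]. Qed.

Lemma cat_trans v u w : cat_le u v -> cat_le v w -> cat_le u w.
Proof.
case: u => [a|s]; case: v => [b|t]; case: w => [c|r] //=.
- exact: ple_trans.
- by move=> ab [x rx bx]; exists x => //; apply: ple_trans ab bx.
- move=> [x tx ax] tc; have [/(_ x tx)[xt _ _] _] := svalP t.
  exact: ple_trans ax (ple_trans xt tc).
- move=> [x tx ax] [tr|[y ry ty]]; first by exists x; rewrite // -tr.
  have [/(_ x tx)[xt _ _] _] := svalP t; exists y => //.
  exact: ple_trans ax (ple_trans xt ty).
- exact: ple_trans.
- by move=> sb [x rx bx]; right; exists x => //; apply: ple_trans sb bx.
- move=> [->//|[x tx sx]] tc; have [/(_ x tx)[xt _ _] _] := svalP t.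
  exact: ple_trans sx (ple_trans xt tc).
- move=> [->//|[x tx sx]] [tr|[y ry ty]]; first by right; exists x; rewrite // -tr.
  have [/(_ x tx)[xt _ _] _] := svalP t; right; exists y => //.
  exact: ple_trans sx (ple_trans xt ty).
Qed.

Lemma cat_lt u v : cat_le u v -> u <> v -> cat_dm u < cat_dm v.
Proof.
case: u => [a|s]; case: v => [b|t] /=.
- by move=> ab ne; apply: dm_lt ab _ => e; apply: ne; rewrite e.
- move=> [x tx ax] _; have [/(_ x tx)[_ _ xt] _] := svalP t.
  exact: leq_ltn_trans (dm_le ax) xt.
- by move=> sb _; have [_ st] := svalP s; apply: leq_trans st (dm_le sb).
- move=> [->//|[x tx sx]] _; have [/(_ x tx)[_ _ xt] _] := svalP t.
  have [_ st] := svalP s; apply: leq_trans (ltnW xt); apply: leq_trans st (dm_le sx).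
Qed.

Definition cat_dpos := DPos cat_refl cat_trans cat_lt.

Definition cat_pi (u : catT) : X := match u with inl a => a | inr t => (sval t).1.2 end.

Lemma cat_pm : pmor cat_dpos o cat_pi.
Proof.
split.
- case=> [a|s] [b|t] //=.
    move=> [x tx ax]; have [/(_ x tx)[xt _ _] _] := svalP t.
    exact: ple_trans ax xt.
  move=> [->|[x tx sx]]; first exact: ple_refl.
  have [/(_ x tx)[xt _ _] _] := svalP t; exact: ple_trans sx xt.
- by case=> [a|t] //=; have [_ /ltnW] := svalP t.
- by case=> [a|t] q /= aq; exists (inl q).
- by move=> q; exists (inl q).
Qed.

Lemma cat_point (t : option X * X * nat) (ct : cat_cond t) (u : X) :
  t.1.1 = Some u -> forall w : catT, ple o (cat_pi w) u ->
  ple cat_dpos w (inr (exist _ t ct)).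
Proof. by move=> tu [a|s] /= wu; [exists u|right; exists u]. Qed.

Lemma principal_pure (T : Type) (oT : dpos T) (S : set T) k :
  (forall x, S x -> dm oT x = k) ->
  cpt oT k [set w | exists2 v, S v & ple oT w v] = [set w | exists2 v, S v & ple oT w v].
Proof.
move=> Sk; apply: pureP.
- by move=> x y xy [v Sv yv]; exists v => //; apply: ple_trans xy yv.
- by move=> x [v /Sk <-]; apply: dm_le.
- move=> x [v Sv xv]; exists v; split=> //; last exact: Sk.
  by exists v => //; apply: ple_refl.
Qed.

Lemma cat_scaling k (A : set X) : down o A -> cpt o k.+1 A = A -> A !=set0 ->
  exists B, [/\ down cat_dpos B, B `<=` cat_pi @^-1` A, cpt cat_dpos k B = B & B !=set0].
Proof.
move=> dA pA [x Ax]; have [y [_ Ay dy]] := pure_top pA Ax.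
have ct : cat_cond (None, y, k) by split; rewrite //= dy.
pose t : catT := inr (exist _ _ ct).
exists [set w | exists2 v, v = t & ple cat_dpos w v]; split.
- by move=> u v uv [w e vw]; exists w => //; apply: cat_trans uv vw.
- move=> w [_ -> /(pm_mono cat_pm) /= wy]; exact: (dA _ _ wy Ay).
- by apply: principal_pure => _ ->.
- by exists t, t => //; apply: cat_refl.
Qed.

Lemma cat_caten r q p (C A : set X) : r <= q -> q <= p -> down o C -> down o A ->
  C `<=` A -> cpt o p A = A -> cpt o r C = C ->
  exists B, [/\ down cat_dpos B, cpt cat_dpos q B = B, cat_pi @^-1` C `<=` B &
    B `<=` cat_pi @^-1` A].
Proof.
move=> rq qp dC dA CA pA pC; have pm := cat_pm.
move: rq; rewrite leq_eqVlt => /orP[/eqP <-|rq].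
  exists (cat_pi @^-1` C); split=> //; first exact: (pm_down pm).
    by rewrite -(pm_cpt pm) pC.
  by move=> x /CA.
move: qp; rewrite leq_eqVlt => /orP[/eqP ->|qp].
  exists (cat_pi @^-1` A); split=> //; first exact: (pm_down pm).
    by rewrite -(pm_cpt pm) pA.
  by move=> x /CA.
pose S : set catT := [set v | exists2 t, v = inr t &
  (sval t).2 = q /\ A (sval t).1.2].
exists [set w | exists2 v, S v & ple cat_dpos w v]; split.
- by move=> u v uv [w e vw]; exists w => //; apply: cat_trans uv vw.
- by apply: principal_pure => _ [t -> []].
- move=> w Cw; have [x [wx Cx dx]] := pure_top pC Cw.
  have [y [xy Ay dy]] := pure_top pA (CA _ Cx).
  have ct : cat_cond (Some x, y, q).
    split=> [_ [<-]|] /=; last by rewrite dy.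
    split=> //; last by rewrite dx.
    by move=> e; move: qp; rewrite -dy -e dx ltnNge (ltnW rq).
  exists (inr (exist _ _ ct)); first by exists (exist _ _ ct).
  exact: (cat_point ct (u := x)).
- move=> w [_ [t -> [_ At]] /(pm_mono pm) /= wt]; exact: (dA _ _ wt At).
Qed.

Definition inst : Type := ((X -> Prop) * (X -> Prop) * (X -> Prop))%type.
Implicit Types (t s : inst) (p q : X) (b : bool).

Definition good t := [/\ down o t.1.1, down o t.1.2, down o t.2 &
  t.1.2 `|` t.2 `<=` t.1.1].

(** At a point of the intersection of [B1] and [B2] there is nothing to choose, since it must belong
    to both halves. *)
Definition act t p := [/\ good t, t.1.1 p & ~ (t.1.2 p /\ t.2 p)].

(** Choices are forced on [B1] and [B2]. On inactive problems they are normalised to [false], so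
    that two comparable points with the same projection are equal, as [split_lt] requires. *)
Definition valid (w : X * (inst -> bool)) := forall t,
  [/\ ~ act t w.1 -> w.2 t = false, act t w.1 -> t.1.2 w.1 -> w.2 t = true &
      act t w.1 -> t.2 w.1 -> w.2 t = false].

(* A point of [splitT] is a point [p] with a choice, for every splitting problem
   [t = (A, B1, B2)] active at [p], of the half of [A] in which it lies. *)
Definition splitT := {w | valid w}.
Implicit Types u v w : splitT.

Definition split_pi w : X := (sval w).1.
Definition side w t : bool := (sval w).2 t.

Definition split_le w v := ple o (split_pi w) (split_pi v) /\
  forall t, act t (split_pi w) -> act t (split_pi v) -> side w t = side v t.

Definition split_dm w := dm o (split_pi w).

Lemma act_down t p q : ple o p q -> act t p -> t.1.1 q -> act t q.
Proof.
move=> pq [gt tp nb] tq; split=> // -[b1 b2]; apply: nb.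
by have [_ d1 d2 _] := gt; split; [apply: d1 b1|apply: d2 b2].
Qed.

Lemma act_up t p q : ple o p q -> act t q -> t.1.1 p.
Proof. by move=> pq [[d _ _ _] tq _]; apply: d tq. Qed.

Lemma split_refl w : split_le w w.
Proof. by split=> //; apply: ple_refl. Qed.

(** A problem active at both ends is also active at the point between them, so the intermediate
    choice links the outer two. *)
Lemma split_trans v u w : split_le u v -> split_le v w -> split_le u w.
Proof.
move=> [uv suv] [vw svw]; split; first exact: ple_trans uv vw.
move=> t tu tw; have tv := act_down uv tu (act_up vw tw).
by rewrite suv // svw.
Qed.

Lemma split_lt u v : split_le u v -> u <> v -> split_dm u < split_dm v.
Proof.
move=> [uv suv] ne; apply: (dm_lt uv) => e; apply: ne.
case: u v uv suv e => [[p f] fp] [[q g] gq]; rewrite /split_pi /side /= => pq h e.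
subst q; apply: eq_exist => /=; congr pair; apply: funext => t.
have [ta|tn] := pselect (act t p); first exact: h.
by have [/(_ tn) /= -> _ _] := fp t; have [/(_ tn) /= -> _ _] := gq t.
Qed.

Definition split_dpos := DPos split_refl split_trans split_lt.

Lemma split_mk p (g : inst -> bool) : exists w, split_pi w = p /\
  forall t, act t p -> ~ t.1.2 p -> ~ t.2 p -> side w t = g t.
Proof.
have vp : valid (p, fun t => `[< act t p /\ (t.1.2 p \/ ~ t.2 p /\ g t) >]).
  move=> t; split=> /=.
  - by move=> nt; apply: asboolF; case.
  - by move=> ta tp; apply: asboolT; split=> //; left.
  - by move=> ta tp; apply: asboolF => -[[_ _ nb] [b1|[]//]]; apply: nb.
exists (exist _ _ vp); split=> // t ta n1 n2; rewrite /side /=.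
apply/idP/idP => [/asboolP[_ [//|[_ //]]]|gt].
by apply: asboolT; split=> //; right.
Qed.

(** The new point keeps the choices of [w] and uses [b] for problems that are inactive at [w]. The
    forced choices agree with those of [w] because [B1] and [B2] are down-sets. *)
Lemma split_lift w q b : ple o (split_pi w) q ->
  exists v, [/\ ple split_dpos w v, split_pi v = q &
    forall t, act t q -> ~ t.1.2 q -> ~ t.2 q ->
      (act t (split_pi w) -> side w t = b) -> side v t = b].
Proof.
move=> wq; have [v [vq sv]] := split_mk q
  (fun t => if `[< act t (split_pi w) >] then side w t else b).
exists v; split=> //.
  split; rewrite vq // => t tw tq.
  have [gt _ _] := tq; have [_ d1 d2 _] := gt.
  have [_ /(_ tw) w1 /(_ tw) w2] := svalP w t.
  have := svalP v t; rewrite -[(sval v).1]/(split_pi v) vq => -[_ /(_ tq) v1 /(_ tq) v2].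
  have [b1|n1] := pselect (t.1.2 q).
    rewrite /side v1 // w1 //; exact: d1 wq b1.
  have [b2|n2] := pselect (t.2 q).
    rewrite /side v2 // w2 //; exact: d2 wq b2.
  by rewrite sv // asboolT.
move=> t tq n1 n2 hw; rewrite sv //; case: asboolP => // tw; exact: hw.
Qed.

Lemma split_pm : pmor split_dpos o split_pi.
Proof.
split=> // [x y []//|w q /(split_lift true)[v [wv vq _]]|q].
  by exists v; split=> //; rewrite /= /split_dm vq.
by have [w [wq _]] := split_mk q (fun=> true); exists w.
Qed.

(** The halves are [H true] and [H false], a point without a choice to make lying in both. By [eA],
    each point of [A] is below one outside both [B1] and [B2], over which either choice is possible;
    so each half is generated by its points outside the other. *)
Lemma split_splitting (B1 B2 A : set X) : down o B1 -> down o B2 -> down o A ->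
  B1 `|` B2 `<=` A -> A !=set0 -> dsub o A (B1 `|` B2) = A ->
  exists A1 A2, [/\ down split_dpos A1 /\ down split_dpos A2,
    A1 !=set0 /\ A2 !=set0,
    split_pi @^-1` B1 `<=` A1 /\ split_pi @^-1` B2 `<=` A2,
    A1 = dsub split_dpos (split_pi @^-1` A) A2 /\
    A2 = dsub split_dpos (split_pi @^-1` A) A1 &
    A1 `&` A2 = split_pi @^-1` B1 `&` split_pi @^-1` B2].
Proof.
move=> d1 d2 dA BA nA eA; pose t : inst := (A, B1, B2).
have gt : good t by [].
pose H b : set splitT :=
  [set w | A (split_pi w) /\ (act t (split_pi w) -> side w t = b)].
have dH b : down split_dpos (H b).
  move=> u v [uv suv] [Av hv]; have Au := dA _ _ uv Av; split=> // tu.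
  have tv := act_down uv tu Av; by rewrite suv // hv.
have nact p : A p -> ~ act t p -> B1 p /\ B2 p.
  by move=> Ap nt; apply: contrapT => nb; apply: nt.
have actd q : A q -> ~ (B1 `|` B2) q -> [/\ act t q, ~ B1 q & ~ B2 q].
  move=> Aq nB; have n1 : ~ B1 q by move=> b; apply: nB; left.
  by split=> //; [split=> // -[]|move=> b; apply: nB; right].
have HE b : H b = dsub split_dpos (split_pi @^-1` A) (H (~~ b)).
  apply/seteqP; split=> w.
    move=> [Aw hw]; have := Aw; rewrite -{1}eA => -[q [wq Aq nB]].
    have [v [wv vq hv]] := split_lift b wq; have [tq n1 n2] := actd q Aq nB.
    exists v; split=> //; first by rewrite /= vq.
    move=> [_]; rewrite vq => /(_ tq); rewrite hv //; by case: (b).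
  move=> [v [wv Av nv]]; apply: (dH _ _ _ wv); split=> // tv.
  apply: contrapT => nb; apply: nv; split=> // _.
  by case: (side v t) nb; case: (b).
have nH b : H b !=set0.
  have [x] := nA; rewrite -{1}eA => -[q [_ Aq nB]].
  have [w [wq hw]] := split_mk q (fun=> b); have [tq n1 n2] := actd q Aq nB.
  by exists w; split; rewrite wq // => _; apply: hw.
exists (H true), (H false); split.
- by split; apply: dH.
- by split; apply: nH.
- split=> w Bw; have [_ h1 h2] := svalP w t.
    by split=> [|tw]; [apply: BA; left|apply: h1].
  by split=> [|tw]; [apply: BA; right|apply: h2].
- by split; apply: HE.
- apply/seteqP; split=> w.
    move=> [[Aw h1] [_ h2]]; apply: nact => // tw.
    by move: (h1 tw); rewrite h2.
  move=> [b1 b2]; have nt : ~ act t (split_pi w) by move=> [_ _]; apply.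
  by split; split=> //; apply: BA; left.
Qed.

End Refinements.

(** * Inverse limits of posets with a dimension *)

(** Below level [n] the thread is forced by [f]; above it, points are chosen so as to keep the
    dimension. The predicate [R] will be the condition of lying above a given thread, or be
    trivial. *)
Lemma thread_through (T : nat -> Type) (dmT : forall n, T n -> nat)
    (f : forall n, T n.+1 -> T n) (R : forall n, T n -> Prop) :
  (forall n y, R n y -> exists z, [/\ f n z = y, R n.+1 z & dmT n.+1 z = dmT n y]) ->
  (forall n z, R n.+1 z -> R n (f n z)) ->
  forall n q, R n q -> exists x : forall n, T n,
    [/\ forall m, f m (x m.+1) = x m, forall m, R m (x m), x n = q &
        forall m, n <= m -> dmT m (x m) = dmT n q].
Proof.
move=> up dn n; elim: n T dmT f R up dn => [|n IHn] T dmT f R up dn q Rq.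
  pose next m (s : {y | R m y}) : {z | [/\ f m z = sval s, R m.+1 z &
    dmT m.+1 z = dmT m (sval s)]} := cid (up m _ (svalP s)).
  pose fix y m : {y : T m | R m y} := match m with
    | 0 => exist (R 0) q Rq
    | m.+1 => let z := next m (y m) in
        exist (R m.+1) (sval z) (let: And3 _ h _ := svalP z in h)
    end.
  exists (fun m => sval (y m)); split=> //=.
  - by move=> m; case: (svalP (next m (y m))).
  - by move=> m; apply: svalP.
  - elim=> // m IHm _; rewrite -IHm //.
    by have [_ _] := svalP (next m (y m)).
have [x [hf hR hq hd]] := IHn (fun m => T m.+1) (fun m => dmT m.+1) (fun m => f m.+1)
  (fun m => R m.+1) (fun m => up m.+1) (fun m => dn m.+1) q Rq.
exists (fun m => match m with 0 => f 0 (x 0) | m.+1 => x m end); split=> //.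
- by case.
- by case=> // ; apply: dn.
- by case=> // m; rewrite ltnS => /hd.
Qed.

Section Limit.
Variables (T : nat -> Type) (o : forall n, dpos (T n)) (f : forall n, T n.+1 -> T n).
Arguments f : clear implicits.
Hypothesis pf : forall n, pmor (o n.+1) (o n) (f n).

Definition thread := {x : forall n, T n | forall n, f n (x n.+1) = x n}.
Implicit Types x y z : thread.

Definition proj n x : T n := sval x n.

Lemma projS n x : f n (proj n.+1 x) = proj n x.
Proof. exact: (svalP x n). Qed.

Definition thread_le x y := forall n, ple (o n) (proj n x) (proj n y).

Lemma thread_dm_ex x : exists k, `[< exists n, dm (o n) (proj n x) = k >].
Proof. by exists (dm (o 0) (proj 0 x)); apply/asboolP; exists 0. Qed.

(** Dimensions can only decrease along a thread, by [pm_dm], so the least value is the eventual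
    one. *)
Definition thread_dm x : nat := ex_minn (thread_dm_ex x).

Lemma thread_dm_le x n : thread_dm x <= dm (o n) (proj n x).
Proof.
rewrite /thread_dm; case: ex_minnP => m _; apply; apply/asboolP.
by exists n.
Qed.

Lemma thread_dm_ev x : exists N, forall n, N <= n -> dm (o n) (proj n x) = thread_dm x.
Proof.
have [N eN] : exists N, dm (o N) (proj N x) = thread_dm x.
  by rewrite /thread_dm; case: ex_minnP => m /asboolP.
exists N => n Nn; apply/eqP; rewrite eqn_leq thread_dm_le andbT -eN.
elim: n Nn => [|n IHn]; first by rewrite leqn0 => /eqP ->.
rewrite leq_eqVlt => /orP[/eqP -> //|]; rewrite ltnS => /IHn.
by apply: leq_trans; rewrite -(projS n); apply: (pm_dm (pf n)).
Qed.

Lemma thread_refl x : thread_le x x.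
Proof. by move=> n; apply: ple_refl. Qed.

Lemma thread_trans y x z : thread_le x y -> thread_le y z -> thread_le x z.
Proof. by move=> xy yz n; apply: ple_trans (xy n) (yz n). Qed.

Lemma thread_lt x y : thread_le x y -> x <> y -> thread_dm x < thread_dm y.
Proof.
move=> xy ne; have [n0 nn0] : exists n, proj n x <> proj n y.
  apply: contrapT => h; apply: ne; apply: sval_inj; apply: functional_extensionality_dep => n.
  by apply: contrapT => hn; apply: h; exists n.
have nn n : n0 <= n -> proj n x <> proj n y.
  elim: n => [|n IHn]; first by rewrite leqn0 => /eqP <-.
  rewrite leq_eqVlt => /orP[/eqP <- //|]; rewrite ltnS => /IHn h e; apply: h.
  by rewrite -(projS n x) -(projS n y) e.
have [N1 h1] := thread_dm_ev x; have [N2 h2] := thread_dm_ev y.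
pose n := maxn n0 (maxn N1 N2).
rewrite -(h1 n) ?leq_max ?leqnn ?orbT // -(h2 n) ?leq_max ?leqnn ?orbT //.
by apply: dm_lt (xy n) _; apply: nn; rewrite leq_maxl.
Qed.

Definition thread_dpos := DPos thread_refl thread_trans thread_lt.

Lemma thread_dmE x n k : (forall m, n <= m -> dm (o m) (proj m x) = k) ->
  thread_dm x = k.
Proof.
move=> h; have [N hN] := thread_dm_ev x.
by rewrite -(hN (maxn n N)) ?leq_maxr // h // leq_maxl.
Qed.

Lemma proj_pm n : pmor thread_dpos (o n) (proj n).
Proof.
split.
- by move=> x y; apply.
- by move=> x; apply: thread_dm_le.
- move=> x q xq.
  have [||y [fy ley yq dy]] := @thread_through T (fun m => dm (o m)) f
      (fun m => ple (o m) (proj m x)) _ _ n q xq.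
  + move=> m z xz; have [|w [xw fw dw]] := pm_lift (pf m) (x := proj m.+1 x) (q := z).
      by rewrite projS.
    by exists w.
  + by move=> m z xz; rewrite -(projS m); apply: pm_mono (pf m) _ _ xz.
  exists (exist _ y fy); split=> //; exact: (thread_dmE (n := n)).
- move=> q; have [||y [fy _ yq _]] := @thread_through T (fun m => dm (o m)) f
      (fun=> xpredT) _ _ n q isT => //.
    by move=> m z _; have [w [wz dw]] := pm_top (pf m) z; exists w.
  by exists (exist _ y fy).
Qed.

(** The direct limit of the lattices of all down-sets of the levels. Finitely many of its members
    live on a common level, so an instance of an axiom arises at some level and is solved at the
    next one. *)
Definition limit_sets : set (set thread) :=
  [set B | exists n A, down (o n) A /\ B = proj n @^-1` A].

Lemma limit_raise n m B : n <= m -> (exists A, down (o n) A /\ B = proj n @^-1` A) ->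
  exists A, down (o m) A /\ B = proj m @^-1` A.
Proof.
elim: m => [|m IHm]; first by rewrite leqn0 => /eqP ->.
rewrite leq_eqVlt => /orP[/eqP ->//|]; rewrite ltnS => nm /(IHm nm)[A [dA ->]].
exists (f m @^-1` A); split; first exact: pm_down (pf m) _ dA.
by apply/seteqP; split=> x /=; rewrite projS.
Qed.

Lemma limit_common2 B C : limit_sets B -> limit_sets C -> exists n A A',
  [/\ down (o n) A, down (o n) A', B = proj n @^-1` A & C = proj n @^-1` A'].
Proof.
move=> [n hB] [m hC]; exists (maxn n m).
have [A [dA eA]] := limit_raise (leq_maxl n m) hB.
have [A' [dA' eA']] := limit_raise (leq_maxr n m) hC.
by exists A, A'.
Qed.

Lemma limit_dsys : dsys thread_dpos limit_sets.
Proof.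
split.
- by move=> _ [n [A [dA ->]]]; apply: (pm_down (proj_pm n)).
- by exists 0, set0; split; [move=> x y|rewrite preimage_set0].
- move=> B C /limit_common2 h /h[n [A [A' [dA dA' -> ->]]]].
  exists n, (A `|` A'); split=> // x y xy [Ay|Ay]; [left; exact: dA Ay|right; exact: dA' Ay].
- move=> B C /limit_common2 h /h[n [A [A' [dA dA' -> ->]]]].
  by exists n, (A `&` A'); split=> // x y xy [Ay A'y]; split; [exact: dA Ay|exact: dA' A'y].
- move=> B C /limit_common2 h /h[n [A [A' [dA dA' -> ->]]]].
  exists n, (dsub (o n) A A'); split; first exact: down_dsub.
  by rewrite (pm_dsub (proj_pm n)).
- move=> i _ [n [A [dA ->]]]; exists n, (cpt (o n) i A); split; first exact: down_cpt.
  by rewrite (pm_cpt (proj_pm n)).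
Qed.

Hypothesis f_scaling : forall n k (A : set (T n)), down (o n) A ->
  cpt (o n) k.+1 A = A -> A !=set0 ->
  exists B, [/\ down (o n.+1) B, B `<=` f n @^-1` A, cpt (o n.+1) k B = B & B !=set0].
Hypothesis f_caten : forall n r q p (C A : set (T n)), r <= q -> q <= p ->
  down (o n) C -> down (o n) A -> C `<=` A -> cpt (o n) p A = A -> cpt (o n) r C = C ->
  exists B, [/\ down (o n.+1) B, cpt (o n.+1) q B = B, f n @^-1` C `<=` B &
    B `<=` f n @^-1` A].
Hypothesis f_splitting : forall n (B1 B2 A : set (T n)),
  down (o n) B1 -> down (o n) B2 -> down (o n) A ->
  B1 `|` B2 `<=` A -> A !=set0 -> dsub (o n) A (B1 `|` B2) = A ->
  exists A1 A2, [/\ down (o n.+1) A1 /\ down (o n.+1) A2, A1 !=set0 /\ A2 !=set0,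
    f n @^-1` B1 `<=` A1 /\ f n @^-1` B2 `<=` A2,
    A1 = dsub (o n.+1) (f n @^-1` A) A2 /\ A2 = dsub (o n.+1) (f n @^-1` A) A1 &
    A1 `&` A2 = f n @^-1` B1 `&` f n @^-1` B2].

Lemma proj_preimageS n (A : set (T n)) :
  proj n.+1 @^-1` (f n @^-1` A) = proj n @^-1` A.
Proof. by apply/seteqP; split=> x /=; rewrite projS. Qed.

Lemma proj_n0 n (A : set (T n)) : proj n @^-1` A !=set0 <-> A !=set0.
Proof.
split=> [[x Ax]|[q Aq]]; first by exists (proj n x).
by have [x xq] := pm_surj (proj_pm n) q; exists x; rewrite /= xq.
Qed.

Lemma proj_subset n (A B : set (T n)) : proj n @^-1` A `<=` proj n @^-1` B -> A `<=` B.
Proof.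
move=> AB q; have [x <-] := pm_surj (proj_pm n) q; exact: AB.
Qed.

Lemma limit_supersys : supersys thread_dpos limit_sets.
Proof.
have pm n := proj_pm n; have inj n := pm_inj (pm n).
split.
- move=> k _ [n [A [dA ->]]]; rewrite -(pm_cpt (pm n)) => /inj pA /proj_n0 nA.
  have [B [dB BA pB nB]] := f_scaling dA pA nA.
  exists (proj n.+1 @^-1` B); split; first by exists n.+1, B.
  + by rewrite -(proj_preimageS A) => x /BA.
  + by rewrite -(pm_cpt (pm _)) pB.
  + exact/proj_n0.
- move=> r q p C A rq qp /limit_common2 h /h{h}[n [C' [A' [dC dA -> ->]]]].
  move=> /proj_subset CA; rewrite -!(pm_cpt (pm n)) => /inj pA /inj pC _ _.
  have [B [dB pB CB BA]] := f_caten rq qp dC dA CA pA pC.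
  exists (proj n.+1 @^-1` B); split; first by exists n.+1, B.
  + by rewrite -(pm_cpt (pm _)) pB.
  + by rewrite -(proj_preimageS C') => x /CB.
  + by rewrite -(proj_preimageS A') => x /BA.
- move=> B1 B2 A F1 F2 FA.
  have [n [b1 [b2 [a [[d1 d2 da] e1 e2 ->]]]]] : exists n b1 b2 a,
      [/\ [/\ down (o n) b1, down (o n) b2 & down (o n) a], B1 = proj n @^-1` b1,
          B2 = proj n @^-1` b2 & A = proj n @^-1` a].
    have [n [b1 [b2 [d1 d2 e1 e2]]]] := limit_common2 F1 F2.
    have [m hA] := FA; exists (maxn n m).
    have [|c1 [? ?]] := limit_raise (B := B1) (leq_maxl n m); first by exists b1.
    have [|c2 [? ?]] := limit_raise (B := B2) (leq_maxl n m); first by exists b2.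
    have [a [? ?]] := limit_raise (leq_maxr n m) hA.
    by exists c1, c2, a.
  rewrite {}e1 {}e2 => /(@proj_subset n (b1 `|` b2)) ba /proj_n0 na.
  rewrite -[X in dsub _ _ X]/(proj n @^-1` (b1 `|` b2)) -(pm_dsub (pm n)) => /inj ea.
  have [a1 [a2 [[? ?] [? ?] [l1 l2] [e1 e2] eI]]] := f_splitting d1 d2 da ba na ea.
  exists (proj n.+1 @^-1` a1), (proj n.+1 @^-1` a2); split.
  + by split; [exists n.+1, a1|exists n.+1, a2].
  + by split; apply/proj_n0.
  + by rewrite -(proj_preimageS b1) -(proj_preimageS b2); split=> x; [apply: l1|apply: l2].
  + by rewrite -(proj_preimageS a) -!(pm_dsub (pm n.+1)) -e1 -e2.
  + by rewrite -(proj_preimageS b1) -(proj_preimageS b2) -(preimage_setI (proj n.+1) a1) eI.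
Qed.

End Limit.

(** * The tower of refinements and its limit structure *)

Record ptype := PType { pcar : Type; pord : dpos pcar }.

Definition refine_step (P : ptype) : ptype :=
  PType (split_dpos (cat_dpos (pord P))).

Definition tower (P : ptype) n : ptype := iter n refine_step P.

Definition tower_pi P n : pcar (tower P n.+1) -> pcar (tower P n) :=
  @cat_pi _ (pord (tower P n)) \o @split_pi _ (cat_dpos (pord (tower P n))).

Section Existence.
Variables (X : Type) (o : dpos X) (d : nat).
Hypothesis bX : dbound o d.+1.

Let T n := pcar (tower (PType o) n).
Let oT n : dpos (T n) := pord (tower (PType o) n).
Let f n : T n.+1 -> T n := @tower_pi (PType o) n.
Let pf n : pmor (oT n.+1) (oT n) (f (n := n)) :=
  pmor_comp (split_pm _) (cat_pm _).
Let Q := thread f.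
Let oQ : dpos Q := thread_dpos pf.
Let F := @limit_sets T oT f.
Let dF : dsys oQ F := limit_dsys pf.

Lemma tower_supersys : supersys oQ F.
Proof.
apply: limit_supersys.
- move=> n k A dA pA nA; have [B [dB BA pB nB]] := cat_scaling dA pA nA.
  have pS := split_pm (cat_dpos (oT n)).
  exists (@split_pi _ (cat_dpos (oT n)) @^-1` B); split.
  + exact: (pm_down pS).
  + by move=> x /BA.
  + by rewrite -(pm_cpt pS) pB.
  + by have [y By] := nB; have [w wy] := pm_surj pS y; exists w; rewrite /= wy.
- move=> n r q p C A rq qp dC dA CA pA pC.
  have [B [dB pB CB BA]] := cat_caten rq qp dC dA CA pA pC.
  have pS := split_pm (cat_dpos (oT n)).
  exists (@split_pi _ (cat_dpos (oT n)) @^-1` B); split.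
  + exact: (pm_down pS).
  + by rewrite -(pm_cpt pS) pB.
  + by move=> x /CB.
  + by move=> x /BA.
- move=> n B1 B2 A d1 d2 dA BA nA eA; have pC := cat_pm (oT n).
  apply: (split_splitting (o := cat_dpos (oT n)) (pm_down pC d1) (pm_down pC d2)
    (pm_down pC dA)).
  + by move=> x /BA.
  + by have [y By] := nA; have [w wy] := pm_surj pC y; exists w; rewrite /= wy.
  + by rewrite -[X in dsub _ _ X]/(_ @^-1` (B1 `|` B2)) -(pm_dsub pC) eA.
Qed.

Definition limit_carrier := {B : Q -> Prop | F B}.

Definition set_interp (g : SC_func d) : ('I_(SC_arity g) -> set Q) -> set Q :=
  match g return ('I_(SC_arity g) -> set Q) -> set Q with
  | SCbot => fun=> set0
  | SCtop => fun=> setT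
  | SCjoin => fun v => v ord0 `|` v ord_max
  | SCmeet => fun v => v ord0 `&` v ord_max
  | SCminus => fun v => dsub oQ (v ord0) (v ord_max)
  | SCcomp i => fun v => cpt oQ i (v ord0)
  end.

Lemma set_interp_closed g v : (forall i, F (v i)) -> F (@set_interp g v).
Proof.
move=> Fv; case: g v Fv => [||||| i] v Fv /=.
- exact: ds0 dF.
- by exists 0, setT; split; [move=> x y|rewrite preimage_setT].
- exact: (dsU dF).
- exact: (dsI dF).
- exact: (dsD dF).
- exact: (dsC dF).
Qed.

Definition limit_structure : structure (L_SC d) :=
  @Structure (L_SC d) limit_carrier (inhabits (exist _ set0 (ds0 dF)))
    (fun g v => exist _ (set_interp (fun i => sval (v i)))
       (set_interp_closed (fun i => svalP (v i)))).

Lemma limit_rep : rep (M := limit_structure) oQ (fun B : limit_carrier => sval B).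
Proof.
split=> //.
- by move=> [B FB] [C FC] /= BC; apply: eq_exist.
- by move=> [B FB]; apply: (ds_down dF).
- by move=> x; apply: leq_ltn_trans (thread_dm_le oT x 0) _; apply: bX.
Qed.

Theorem limit_super : is_super_scaled limit_structure.
Proof.
apply: super_axioms_super; first exact: rep_subscaled limit_rep.
apply: (supersys_super_axioms limit_rep).
rewrite (_ : range _ = F); first exact: tower_supersys.
by apply/seteqP; split=> B; [move=> [[C FC] _ <-]|move=> FB; exists (exist _ B FB)].
Qed.

Variables (M : structure (L_SC d)) (h : M -> set X).
Hypothesis rh : rep o h.

Lemma limit_mem (a : M) : F (@proj T f 0 @^-1` h a).
Proof. by exists 0, (h a); split=> //; apply: (rep_down rh). Qed.

Definition limit_map (a : M) : limit_structure := exist _ _ (limit_mem a).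

Lemma tuple2_fun (V : Type) (v : 'I_2 -> V) : v = tnth [tuple v ord0; v ord_max].
Proof.
apply: funext => i; rewrite (tnth_nth (v ord0)).
by case: i => -[|[|//]] p /=; congr v; apply: val_inj.
Qed.

Lemma limit_embedding : embedding limit_map.
Proof.
have pm := proj_pm pf 0.
split=> [a b /(congr1 sval) /= /(pm_inj pm)/(rep_inj rh)//|g v].
apply: sval_inj; case: g v => [||||| i] v /=.
- rewrite (_ : v = @no_var M); last by apply: funext => -[].
  by rewrite -[interp _ _ _]/(bot M) (rep_bot rh) preimage_set0.
- rewrite (_ : v = @no_var M); last by apply: funext => -[].
  by rewrite -[interp _ _ _]/(top M) (rep_top rh) preimage_setT.
- rewrite {1}(tuple2_fun v) -[interp _ _ _]/(join (v ord0) (v ord_max)).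
  by rewrite (rep_join rh) preimage_setU.
- rewrite {1}(tuple2_fun v) -[interp _ _ _]/(meet (v ord0) (v ord_max)).
  by rewrite (rep_meet rh) preimage_setI.
- rewrite {1}(tuple2_fun v) -[interp _ _ _]/(minus (v ord0) (v ord_max)).
  by rewrite (rep_minus rh) (pm_dsub pm).
- rewrite {1}(_ : v = tnth [tuple v ord0]); last first.
    by apply: funext => j; rewrite (tnth_nth (v ord0)) (ord1 j).
  by rewrite -[interp _ _ _]/(Cpart i (v ord0)) (rep_C rh) (pm_cpt pm).
Qed.

End Existence.

(** * Back and forth *)

Section Matching.
Variables (d : nat) (M N : structure (L_SC d)).
Variables (X : Type) (oX : dpos X) (h : M -> set X) (rh : rep oX h).
Variables (Y : Type) (oY : dpos Y) (g : N -> set Y) (rg : rep oY g).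

(* A finite partial isomorphism between [M] and [N], given by a finite poset onto
   which both representations project. *)
Record matching := Matching {
  mP : finType;
  mo : dpos mP;
  mf : X -> mP;
  mg : Y -> mP;
  mf_pm : pmor oX mo mf;
  mg_pm : pmor oY mo mg;
  mf_adm : adm mo (range h) mf;
  mg_adm : adm mo (range g) mg }.

Definition matched (c : matching) (m : M) (n : N) := exists A : set (mP c),
  h m = mf c @^-1` A /\ g n = mg c @^-1` A.

Lemma matched_eq c m n m' n' : matched c m n -> matched c m' n' -> m = m' <-> n = n'.
Proof.
move=> [A [hA gA]] [A' [hA' gA']]; split=> e.
  apply: (rep_inj rg); rewrite gA gA'; congr preimage.
  by apply: (pm_inj (mf_pm c)); rewrite -hA -hA' e.
apply: (rep_inj rh); rewrite hA hA'; congr preimage.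
by apply: (pm_inj (mg_pm c)); rewrite -gA -gA' e.
Qed.

Lemma matched_interp c (s : SC_func d) (v : 'I_(SC_arity s) -> M) (w : 'I_(SC_arity s) -> N) :
  (forall i, matched c (v i) (w i)) ->
  matched c (@interp (L_SC d) M s v) (@interp (L_SC d) N s w).
Proof.
have pf := mf_pm c; have pg := mg_pm c.
case: s v w => [||||| i] v w vw.
- exists set0; rewrite !preimage_set0 (_ : v = @no_var M); last by apply: funext => -[].
  rewrite (_ : w = @no_var N); last by apply: funext => -[].
  by split; [apply: rep_bot rh|apply: rep_bot rg].
- exists setT; rewrite !preimage_setT (_ : v = @no_var M); last by apply: funext => -[].
  rewrite (_ : w = @no_var N); last by apply: funext => -[].
  by split; [apply: rep_top rh|apply: rep_top rg].
- have [A [hA gA]] := vw ord0; have [B [hB gB]] := vw ord_max; exists (A `|` B).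
  rewrite {1}(tuple2_fun v) {1}(tuple2_fun w) !preimage_setU -hA -gA -hB -gB.
  by split; [apply: rep_join rh _ _|apply: rep_join rg _ _].
- have [A [hA gA]] := vw ord0; have [B [hB gB]] := vw ord_max; exists (A `&` B).
  rewrite {1}(tuple2_fun v) {1}(tuple2_fun w) !preimage_setI -hA -gA -hB -gB.
  by split; [apply: rep_meet rh _ _|apply: rep_meet rg _ _].
- have [A [hA gA]] := vw ord0; have [B [hB gB]] := vw ord_max; exists (dsub (mo c) A B).
  rewrite {1}(tuple2_fun v) {1}(tuple2_fun w) (pm_dsub pf) (pm_dsub pg) -hA -gA -hB -gB.
  by split; [apply: rep_minus rh _ _|apply: rep_minus rg _ _].
- have [A [hA gA]] := vw ord0; exists (cpt (mo c) i A).
  rewrite (_ : v = tnth [tuple v ord0]); last first.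
    by apply: funext => j; rewrite (tnth_nth (v ord0)) (ord1 j).
  rewrite (_ : w = tnth [tuple w ord0]); last first.
    by apply: funext => j; rewrite (tnth_nth (w ord0)) (ord1 j).
  rewrite (pm_cpt pf) (pm_cpt pg) -hA -gA.
  by split; [apply: rep_C rh _ _|apply: rep_C rg _ _].
Qed.

(** Refine until [h m] is a union of fibres, copying each step on the side of [N]. The partner of
    [m] is the element of [N] with the same image in the quotient, and pairs already matched stay
    so, by pulling their common set back. *)
Lemma forth (sN : supersys oY (range g)) c m : exists c',
  (forall m n, matched c m n -> matched c' m n) /\ exists n, matched c' m n.
Proof.
have dh := rep_dsys rh; have dg := rep_dsys rg.
have st := super_step dg sN (rep_bound rg).
pose c0 : config oX (range h) (@super_real Y oY (range g)) :=
  Config (mf_pm c) (@mf_adm c) (conj (mg_pm c) (@mg_adm c)).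
have [||c1 [[t [tf tg _]] s1]] := saturate dh st (k := d.+1) (a := h m) c0.
- by exists m.
- by move=> z _; apply: (rep_bound rh).
have [pg1 ag1] := cG c1.
exists (Matching (cpm c1) pg1 (@cadm _ _ _ _ _ c1) ag1); split.
  move=> a b [A [hA gA]]; exists (t @^-1` A).
  rewrite hA gA; split; apply/seteqP; split=> z /=; rewrite ?tf ?tg //.
pose A := [set p | exists2 z, cf c1 z = p & h m z].
have hA : h m = cf c1 @^-1` A.
  by apply/seteqP; split=> z /=; [exists z|move=> [w wz hw]; apply: s1 hw].
have dA : down (co c1) A.
  by apply: (pm_down_inv (cpm c1)); rewrite -hA; apply: (rep_down rh).
have [n _ gn] := adm_down dg ag1 dA.
by exists n, A.
Qed.

End Matching.

Definition matching_sym d (M N : structure (L_SC d)) X (oX : dpos X) (h : M -> set X)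
  Y (oY : dpos Y) (g : N -> set Y) (c : matching oX h oY g) : matching oY g oX h :=
  Matching (mg_pm c) (mf_pm c) (@mg_adm _ _ _ _ _ _ _ _ _ c) (@mf_adm _ _ _ _ _ _ _ _ _ c).

Lemma matched_sym d (M N : structure (L_SC d)) X (oX : dpos X) (h : M -> set X)
  Y (oY : dpos Y) (g : N -> set Y) (c : matching oX h oY g) m n :
  matched (matching_sym c) n m <-> matched c m n.
Proof. by split=> -[A [? ?]]; exists A. Qed.

(** * Finite quotients of a represented lattice *)

Section LocallyFinite.
Variables (d : nat) (M : structure (L_SC d)) (X : Type) (o : dpos X) (h : M -> set X).
Hypothesis rh : rep o h.

Definition cone_le (u v : option X) : Prop :=
  match u, v with
  | Some x, Some y => ple o x y
  | None, Some _ => False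
  | _, None => True
  end.

Definition cone_dm (u : option X) : nat := if u is Some x then dm o x else d.+1.

Lemma cone_refl u : cone_le u u.
Proof. by case: u => //= x; apply: ple_refl. Qed.

Lemma cone_trans v u w : cone_le u v -> cone_le v w -> cone_le u w.
Proof. case: u => [x|]; case: v => [y|]; case: w => [z|] //=; exact: ple_trans. Qed.

Lemma cone_lt u v : cone_le u v -> u <> v -> cone_dm u < cone_dm v.
Proof.
case: u => [x|]; case: v => [y|] //=; last by move=> _ _; apply: (rep_bound rh).
by move=> xy ne; apply: dm_lt xy _ => e; apply: ne; rewrite e.
Qed.

(* A new top point of dimension [d + 1] gives an initial finite quotient, the one
   with a single point. *)
Definition cone := DPos cone_refl cone_trans cone_lt.

Definition cone_set (A : set X) : set (option X) :=
  [set u | if u is Some x then A x else False].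

Definition cone_sets : set (set (option X)) :=
  [set S | S = setT \/ exists m, S = cone_set (h m)].

Lemma cone_dsys : dsys cone cone_sets.
Proof.
split.
- move=> S [->//|[m ->]] [x|] [y|] //= xy; exact: (rep_down rh xy).
- by right; exists (bot M); rewrite (rep_bot rh); apply/seteqP; split=> -[].
- move=> S S' [->|[m ->]]; first by rewrite setTU; left.
  move=> [->|[m' ->]]; first by rewrite setUT; left.
  by right; exists (join m m'); rewrite (rep_join rh); apply/seteqP; split=> -[x|] // [].
- move=> S S' [->|[m ->]]; first by rewrite setTI.
  move=> [->|[m' ->]]; first by rewrite setIT; right; exists m.
  right; exists (meet m m'); rewrite (rep_meet rh).
  by apply/seteqP; split=> -[x|] // [].
- have sT S : dsub cone S setT = set0 by apply/seteqP; split=> // u [v [_ _ nv]]; case: nv.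
  move=> S S' HS [->|[m' ->]].
    rewrite sT; right; exists (bot M); rewrite (rep_bot rh).
    by apply/seteqP; split=> -[].
  case: HS => [->|[m ->]].
    by left; apply/seteqP; split=> // u _; exists None; split=> //; case: u.
  right; exists (minus m m'); rewrite (rep_minus rh); apply/seteqP; split=> -[x|] //.
  + by move=> [[y|] [xy my ny]]; [exists y|case: my].
  + by move=> [[y|] [xy my ny]]; [case: xy|case: my].
  + by move=> [y [xy my ny]]; exists (Some y).
- move=> i S [->|[m ->]].
    have [->|id] := eqVneq i d.+1.
      left; apply/seteqP; split=> // u _; exists None; split=> //; first by case: u.
      by split=> // -[].
    right; exists (bot M); rewrite (rep_bot rh); apply/seteqP; split=> -[] //.
      move=> x [[y|] [xy [_ my] dy]]; first by have := my None I I.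
      by move: id; rewrite -dy eqxx.
    move=> [[y|] [xy [_ my] dy]]; [by case: xy|by move: id; rewrite -dy eqxx].
  right; have [id|di] := ltnP i d.+1; last first.
    exists (bot M); rewrite (rep_bot rh); apply/seteqP; split=> -[x|] //.
      move=> [[y|] [xy my dy]]; last by case: my.
      by have := rep_bound rh y; rewrite [dm _ _]dy ltnNge di.
    by move=> [[y|] [xy my dy]]; [case: xy|case: my].
  exists (Cpart (Ordinal id) m); rewrite (rep_C rh); apply/seteqP; split=> -[x|] //.
  + move=> [[y|] [xy [my ty] dy]]; last by case: my.
    by exists y; split=> //; split=> // z yz mz; have [] := ty (Some z) yz mz.
  + by move=> [[y|] [xy [my _] dy]]; [case: xy|case: my].
  + move=> [y [xy [my ty] dy]]; exists (Some y); split=> //; split=> // -[z|] //= yz mz.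
    by rewrite (ty z).
Qed.

(** Saturate the one-point quotient of the cone for the given elements in turn, with a trivial
    companion map, then delete the image of the added top point. *)
Lemma finite_quotient (s : seq M) : exists (P : finType) (oP : dpos P) (f : X -> P),
  [/\ pmor o oP f, adm oP (range h) f &
      forall m, List.In m s -> exists A, h m = f @^-1` A].
Proof.
pose G (P : finType) (oP : dpos P) (r : unit -> P) := True.
have st (P : finType) (oP : dpos P) (r : unit -> P) : G P oP r ->
    forall y k A1 A2 (ec : ext_cond oP y k A1 A2),
    exists r' : unit -> option P, @G (option P) (ext_dpos ec) r' /\
    forall w, odflt y (r' w) = r w by move=> _ y *; exists (fun w => Some (r w)).
have lt1 (x y : unit) : True -> x <> y -> d.+1 < d.+1 by case: x; case: y.
pose o1 : dpos unit := @DPos unit (fun _ _ => True) (fun=> d.+1)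
  (fun=> I) (fun _ _ _ _ _ => I) lt1.
have p1 : pmor cone o1 (fun=> tt).
  split=> //; first by case=> //= x; apply: ltnW; apply: (rep_bound rh).
    by move=> u [] _; exists None; split=> //; case: u.
  by case; exists None.
have a1 : adm o1 cone_sets (fun=> tt) by case; left; apply/seteqP; split.
pose c0 : config cone cone_sets G := Config p1 a1 (cg := id) I.
(* Adding [top M] to the list separates the added point [None] from all points of [X], so that its
   image can be removed. *)
have [c sc] : exists c : config cone cone_sets G,
    forall m, List.In m (top M :: s) -> saturated c (cone_set (h m)).
  elim: (_ :: s) => [|m r [c sc]]; first by exists c0.
  have [||c' [rc sc']] := saturate cone_dsys st (k := d.+2) (a := cone_set (h m)) c.
  - by right; exists m.
  - by case=> // x _; apply: ltnW; apply: (rep_bound rh).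
  exists c' => m' [<-//|/sc]; exact: saturated_refines rc.
have pc := cpm c; pose star := cf c None.
have nstar x : cf c (Some x) != star.
  apply/eqP => e; have := sc (top M) (or_introl erefl) _ _ e.
  by rewrite /cone_set /= (rep_top rh); apply.
have star_top q : ple (co c) q star.
  by have [u <-] := pm_surj pc q; apply: (pm_mono pc); case: u.
pose P : finType := {p : cP c | p != star}.
have lP (p q : P) : ple (co c) (val p) (val q) -> p <> q ->
    dm (co c) (val p) < dm (co c) (val q).
  by move=> pq ne; apply: dm_lt pq _ => /val_inj.
pose oP : dpos P := @DPos P (fun p q => ple (co c) (val p) (val q))
  (fun p => dm (co c) (val p)) (fun p => ple_refl _ _)
  (fun q p r => @ple_trans _ (co c) (val q) (val p) (val r)) lP.
pose f x : P := exist _ (cf c (Some x)) (nstar x).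
exists P, oP, f; split.
- split.
  + by move=> x y xy; apply: (pm_mono pc (x := Some x) (y := Some y)).
  + by move=> x; apply: (pm_dm pc (Some x)).
  + move=> x q /(pm_lift pc)[[y|] [xy fy dy]]; last first.
      by move/eqP: (svalP q); case.
    by exists y; split=> //; apply: val_inj.
  + move=> q; have [[y|] fy] := pm_surj pc (val q).
      by exists y; apply: val_inj.
    by move/eqP: (svalP q); case.
- move=> p; have [e|[m e]] := @cadm _ _ _ _ _ c (val p).
    have : [set z | ple (co c) (cf c z) (val p)] None by rewrite e.
    by move=> /(ple_anti (star_top _)) e'; move/eqP: (svalP p); case.
  exists m => //; apply/seteqP; split=> x.
    by move=> mx; have : cone_set (h m) (Some x) by []; rewrite -e.
  move=> fx; suff : cone_set (h m) (Some x) by []; by rewrite -e.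
- move=> m ms; exists [set p | exists2 x, f x = p & h m x].
  apply/seteqP; split=> x /=; first by exists x.
  move=> [y /(congr1 val) /= fy my].
  exact: (sc m (or_intror ms) (Some y) (Some x) fy my).
Qed.

End LocallyFinite.

(** * Moving a finite quotient to another representation *)

Section Transport.
Variables (d : nat) (M : structure (L_SC d)).
Variables (X : Type) (o : dpos X) (h : M -> set X) (rh : rep o h).
Variables (X' : Type) (o' : dpos X') (h' : M -> set X') (rh' : rep o' h').
Variables (P : finType) (oP : dpos P) (f : X -> P).
Hypotheses (pf : pmor o oP f) (af : adm oP (range h) f).

(** The principal down-sets of [P] name elements [e p] of [M], and the relations between these hold
    in [M] itself, hence in any representation. A point [z] of [X'] goes to the least [p] such that
    [z] lies in [h' (e p)]. *)
Lemma transport : exists f' : X' -> P, pmor o' oP f' /\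
  forall m A, h m = f @^-1` A -> h' m = f' @^-1` A.
Proof.
have [e he] : {e : P -> M & forall p, h (e p) = [set z | ple oP (f z) p]}.
  apply: (choice (P := fun p m => h m = [set z | ple oP (f z) p])) => p.
  by have [m _ hm] := af p; exists m.
have cov m (A : set P) : h m = f @^-1` A ->
    forall z, h' m z <-> exists2 p, A p & h' (e p) z.
  move=> hm z.
  have dA : down oP A by apply: (pm_down_inv pf); rewrite -hm; apply: (rep_down rh).
  have -> : m = \big[@join d M/bot M]_(p : P | `[< A p >]) e p.
    apply: (rep_inj rh); apply/seteqP; split=> x.
      rewrite hm => Ax; apply/(rep_bigE rh); exists (f x); first exact/asboolP.
      by rewrite he; apply: ple_refl.
    by move=> /(rep_bigE rh)[p /asboolP Ap]; rewrite he hm => fp; exact: (dA _ _ fp Ap).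
  rewrite (rep_bigE rh'); split=> -[p Ap pz]; exists p => //; exact/asboolP.
have mono p q : ple oP p q -> h' (e p) `<=` h' (e q).
  move=> pq; apply/(rep_le rh')/(rep_le rh); rewrite !he => z zp.
  exact: ple_trans zp pq.
have inter p q z : h' (e p) z -> h' (e q) z ->
    exists r, [/\ ple oP r p, ple oP r q & h' (e r) z].
  move=> pz qz; have : h' (meet (e p) (e q)) z by rewrite (rep_meet rh').
  rewrite (cov _ [set r | ple oP r p /\ ple oP r q]).
    by move=> [r [rp rq] rz]; exists r.
  by rewrite (rep_meet rh) !he.
have all z : exists p, h' (e p) z.
  have : h' (top M) z by rewrite (rep_top rh').
  by rewrite (cov _ setT) ?preimage_setT ?(rep_top rh) // => -[p _ pz]; exists p.
have [f' hf'] : {f' : X' -> P & forall z, h' (e (f' z)) z /\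
    forall q, h' (e q) z -> ple oP (f' z) q}.
  apply: (choice (P := fun z p => h' (e p) z /\ forall q, h' (e q) z -> ple oP p q)) => z.
  have ex : exists k, `[< exists p, dm oP p = k /\ h' (e p) z >].
    by have [p pz] := all z; exists (dm oP p); apply/asboolP; exists p.
  case: (ex_minnP ex) => k /asboolP[p [<- pz]] kmin; exists p; split=> // q qz.
  have [r [rp rq rz]] := inter p q z pz qz.
  suff <- : r = p by [].
  by apply: (ple_dm_eq rp); apply: kmin; apply/asboolP; exists r.
have f'E z q : ple oP (f' z) q <-> h' (e q) z.
  split; first by move=> /mono; apply; case: (hf' z).
  by case: (hf' z) => _; apply.
(* Purity of [e p] is an equation in [M], read off from [X] and used on [X'], where it provides the
   liftings. *)
have pe p : cpt o' (dm oP p) (h' (e p)) = h' (e p).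
  have [x [_ dx]] := pm_top pf p.
  have kd : dm oP p < d.+1 by rewrite -dx; apply: (rep_bound rh).
  rewrite -[dm oP p]/(Ordinal kd : nat) -(rep_C rh'); congr h'.
  apply: (rep_inj rh); rewrite (rep_C rh) he /=; apply: pureP.
  - by rewrite -he; apply: (rep_down rh).
  - by move=> z zp; apply: leq_trans (pm_dm pf z) (dm_le zp).
  - move=> z /(pm_lift pf)[w [zw fw dw]]; exists w; split=> //.
    by rewrite /= fw; apply: ple_refl.
have lift z q : ple oP (f' z) q ->
    exists w, [/\ ple o' z w, f' w = q & dm o' w = dm oP q].
  move=> /f'E/(pure_top (pe q))[w [zw qw dw]]; exists w; split=> //.
  apply: ple_dm_eq; first exact/f'E.
  by rewrite -dw; apply: (pure_dm (pe _)); case: (hf' w).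
exists f'; split.
  split=> //.
  - move=> z w zw; apply/f'E; apply: (rep_down rh' zw); by case: (hf' w).
  - by move=> z; apply: (pure_dm (pe _)); case: (hf' z).
  - move=> q; have [x fx] := pm_surj pf q.
    have /(rep_n0 rh')[z qz] : e q <> bot M.
      by apply/(rep_n0 rh); exists x; rewrite he /= fx; apply: ple_refl.
    by have [|w [_ fw _]] := lift z q; [apply/f'E|exists w].
move=> m A hm; have dA : down oP A.
  by apply: (pm_down_inv pf); rewrite -hm; apply: (rep_down rh).
apply/seteqP; split=> z /=.
  by move=> /(cov _ _ hm)[p Ap /f'E fp]; exact: (dA _ _ fp Ap).
by move=> Az; apply/(cov _ _ hm); exists (f' z) => //; case: (hf' z).
Qed.

End Transport.

(** * Diagrams *)

Section Reduct.
Variables (L : language) (C : Type).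

Definition reduct (N : structure (add_consts L C)) : structure L :=
  @Structure L N (carrier_inh N) (fun f => @interp (add_consts L C) N (inl f)).

Definition named (N : structure (add_consts L C)) (m : C) : N :=
  @interp (add_consts L C) N (inr m) (@no_var N).

Lemma eval_lift (N : structure (add_consts L C)) n (t : term L n) (v : 'I_n -> N) :
  eval v (lift_term C t) = eval (M := reduct N) v t.
Proof.
elim: t => //= f ts IH; congr interp; apply: funext => i; exact: IH.
Qed.

Lemma sat_lift (N : structure (add_consts L C)) n (phi : formula L n) (v : 'I_n -> N) :
  sat (lift_formula C phi) v <-> sat (M := reduct N) phi v.
Proof.
elim: phi v => {n} [n t u|n|n p IHp q IHq|n p IHp] v //=.
- by rewrite !eval_lift.
- by rewrite IHp IHq.
- by split=> H a; move: (H a); rewrite IHp.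
Qed.

Definition cterm n (m : C) : term (add_consts L C) n :=
  @App (add_consts L C) n (inr m) (@no_var _).

Lemma eval_cterm (N : structure (add_consts L C)) n (v : 'I_n -> N) m :
  eval v (cterm n m) = named N m.
Proof. by rewrite /= /named; congr interp; apply: funext => -[]. Qed.

End Reduct.

Section Expansion.
Variables (L : language) (M : structure L).

Lemma diagram_embedding (N : structure (add_consts L M)) :
  models N (diagram M) -> embedding (M := M) (N := reduct N) (named N).
Proof.
move=> dN; split=> [a b ab|f xs].
  apply: contrapT => nab.
  have : holds N (Neg (Eq (cterm L 0 a) (cterm L 0 b))).
    apply: dN; split; last by exists (cterm L 0 a), (cterm L 0 b); right.
    by rewrite /holds /=.
  apply; change (eval (@no_var N) (cterm L 0 a) = eval (@no_var N) (cterm L 0 b)).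
  by rewrite !eval_cterm.
pose t : term (add_consts L M) 0 :=
  @App (add_consts L M) 0 (inl f) (fun i => cterm L 0 (xs i)).
have : holds N (Eq t (cterm L 0 (interp M f xs))).
  apply: dN; split; last by exists t, (cterm L 0 (interp M f xs)); left.
  by [].
rewrite /holds /sat eval_cterm => <-; rewrite /=; congr interp; apply: funext => i.
exact: eval_cterm.
Qed.

Definition expand (N : structure L) (j : M -> N) : structure (add_consts L M) :=
  @Structure (add_consts L M) N (carrier_inh N)
    (fun f => match f return ('I_(@arity (add_consts L M) f) -> N) -> N with
      | inl g => interp N g
      | inr m => fun _ => j m
      end).

Lemma eval_expand (N : structure L) (j : M -> N) n (v : 'I_n -> M)
    (t : term (add_consts L M) n) : embedding j ->
  eval (M := expand j) (j \o v) t = j (eval (M := name_all M) v t).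
Proof.
move=> [_ hj]; elim: t => //= -[f|m] ts IH //=.
by rewrite hj; congr interp; apply: funext => i; apply: IH.
Qed.

Lemma expand_models (N : structure L) (j : M -> N) (T : theory L) :
  embedding j -> models N T ->
  models (expand j) ([set lift_formula M phi | phi in T] `|` diagram M).
Proof.
move=> ej NT psi [[phi Tphi <-]|[Mpsi [t [u tu]]]].
  apply/sat_lift; case: N j ej NT => cN iN fN j _ NT; exact: NT phi Tphi.
have e0 : @no_var (expand j) = j \o @no_var M by apply: funext => -[].
have inj := ej.1.
have ev s : eval (@no_var (expand j)) s = j (eval (@no_var (name_all M)) s).
  by rewrite e0; apply: eval_expand.
case: tu Mpsi => ->; rewrite /holds /=.
  by move=> tu; rewrite !ev tu.
by move=> ntu; rewrite !ev => /inj.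
Qed.

End Expansion.

(** A substructure is thus represented on the spectrum of the larger one, with no need to relate the
    two spectra. *)
Lemma rep_embedding d (M N : structure (L_SC d)) (j : M -> N) X (o : dpos X) (g : N -> set X) :
  embedding j -> rep o g -> rep o (g \o j).
Proof.
move=> [inj hj] rg.
have e2 (a b : M) : j \o tnth [tuple a; b] = tnth [tuple j a; j b].
  by apply: funext => i; rewrite (tuple2_fun (tnth [tuple j a; j b]));
    case: i => -[|[|//]] p.
have e1 (a : M) : j \o tnth [tuple a] = tnth [tuple j a].
  by apply: funext => -[[|//] p].
have e0 : j \o @no_var M = @no_var N by apply: funext => -[].
split.
- by move=> a b /(rep_inj rg)/inj.
- by move=> a; apply: (rep_down rg).
- by rewrite /= /bot hj e0; apply: rep_bot rg.
- by rewrite /= /top hj e0; apply: rep_top rg.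
- by move=> a b; rewrite /= {1}/join hj e2; apply: rep_join rg _ _.
- by move=> a b; rewrite /= {1}/meet hj e2; apply: rep_meet rg _ _.
- by move=> a b; rewrite /= {1}/minus hj e2; apply: rep_minus rg _ _.
- by move=> i a; rewrite /= {1}/Cpart hj e1; apply: rep_C rg _ _.
- exact: (rep_bound rg).
Qed.

Lemma In_flatten (T : Type) (I : eqType) (r : seq I) (S : I -> seq T) i x :
  i \in r -> List.In x (S i) -> List.In x (flatten [seq S j | j <- r]).
Proof.
elim: r => // j r IHr; rewrite inE => /orP[/eqP <-|/IHr h] xi /=; apply/List.in_or_app.
  by left.
by right; apply: h.
Qed.

(** * Formulas with constants along a matching *)

Section BackAndForth.
Variables (d : nat) (C : Type) (M N : structure (add_consts (L_SC d) C)).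
Let M' : structure (L_SC d) := reduct M.
Let N' : structure (L_SC d) := reduct N.
Variables (X : Type) (o : dpos X) (h : M' -> set X) (rh : rep o h).
Variables (Y : Type) (o' : dpos Y) (g : N' -> set Y) (rg : rep o' g).
Hypotheses (sM : supersys o (range h)) (sN : supersys o' (range g)).

Definition names_matched (c : matching o h o' g) (s : seq C) :=
  forall m, List.In m s -> matched c (named M m) (named N m).

Lemma eval_matched n (t : term (add_consts (L_SC d) C) n) : exists s : seq C,
  forall c, names_matched c s -> forall (v : 'I_n -> M') (w : 'I_n -> N'),
  (forall i, matched c (v i) (w i)) ->
  matched c (eval (M := M) v t) (eval (M := N) w t).
Proof.
elim: t => [i|[f|m] ts IH]; first by exists [::] => c _ v w; apply.
  have [S hS] := choice IH.
  exists (flatten [seq S i | i <- enum 'I_(SC_arity f)]) => c cs v w vw /=.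
  apply: (matched_interp rh rg) => i; apply: hS => // m mi; apply: cs.
  by apply: In_flatten mi; rewrite mem_enum.
exists [:: m] => c cs v w _ /=.
have e (K : structure (add_consts (L_SC d) C)) (x : 'I_n -> K) :
    interp K (inr m) (fun i => eval x (ts i)) = named K m.
  by rewrite /named; congr interp; apply: funext => -[].
by rewrite !e; apply: cs; left.
Qed.

(** Only the finitely many constants occurring in the formula, collected in [s], have to be matched.
    A quantifier is handled by [forth] in either direction, which enlarges the matching and so keeps
    the constants matched. *)
Lemma sat_matched n (phi : formula (add_consts (L_SC d) C) n) : exists s : seq C,
  forall c, names_matched c s -> forall (v : 'I_n -> M') (w : 'I_n -> N'),
  (forall i, matched c (v i) (w i)) ->
  (sat (M := M) phi v <-> sat (M := N) phi w).
Proof.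
elim: phi => {n} [n t u|n|n p [s hs] q [r hr]|n p [s hs]].
- have [s hs] := eval_matched t; have [r hr] := eval_matched u.
  exists (s ++ r) => c cs v w vw /=; apply: (matched_eq rh rg (c := c)).
    by apply: hs => // m ms; apply: cs; apply/List.in_or_app; left.
  by apply: hr => // m ms; apply: cs; apply/List.in_or_app; right.
- by exists [::].
- exists (s ++ r) => c cs v w vw /=.
  rewrite (hs c _ v w vw); first rewrite (hr c _ v w vw) //.
    by move=> m ms; apply: cs; apply/List.in_or_app; right.
  by move=> m ms; apply: cs; apply/List.in_or_app; left.
- have sc (c : matching o h o' g) a b (v : 'I_n -> M') (w : 'I_n -> N') : matched c a b ->
      (forall i, matched c (v i) (w i)) ->
      forall i, matched c (scons a v i) (scons b w i).
    by move=> ab vw i; rewrite /scons; case: (unlift _ _).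
  exists s => c cs v w vw /=; split=> H.
    move=> b; have [c1 [sub [a ab]]] := forth rg rh sM (matching_sym c) b.
    have sub' a' b' : matched c a' b' -> matched (matching_sym c1) a' b'.
      by move=> /matched_sym/sub/matched_sym.
    apply/(hs (matching_sym c1) _ (scons a v)); last exact: H.
      by move=> m /cs/sub'.
    by apply: sc => [|i]; [apply/matched_sym|apply: sub'].
  move=> a; have [c1 [sub [b ab]]] := forth rh rg sN c a.
  apply/(hs c1 _ _ (scons b w)); last exact: H.
    by move=> m /cs/sub.
  by apply: sc => // i; apply: sub.
Qed.

End BackAndForth.

(** * Completeness and the conclusion *)

Lemma super_models d (N : structure (L_SC d)) :
  models N (theory_of (@is_super_scaled d)) -> subscaled_axioms N /\ super_axioms N.
Proof.
move=> NT; split.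
  by apply: (models_subscaled_axioms NT) => K [[/is_subscaled_axioms]].
by apply: (models_super_axioms NT) => K sK; apply: is_super_axioms => //; case: sK => [[]].
Qed.

(** Through the constants, [M] is represented both on the spectrum of [N1] and on that of [N2]. A
    finite quotient for the constants of [phi] is found on the first and transported to the second;
    the two projections form the initial matching. *)
Lemma elementary_equiv d (M : structure (L_SC d)) (N1 N2 : structure (add_consts (L_SC d) M)) :
  let T := [set lift_formula M phi | phi in theory_of (@is_super_scaled d)] `|` diagram M in
  models N1 T -> models N2 T ->
  forall phi, holds N1 phi -> holds N2 phi.
Proof.
move=> T T1 T2 phi.
have red N : models N T -> [/\ models (reduct N) (theory_of (@is_super_scaled d)) &
    embedding (M := M) (N := reduct N) (named N)].
  move=> NT; split; last by apply: diagram_embedding => psi dpsi; apply: NT; right.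
  move=> psi spsi; apply/sat_lift; apply: NT; left; by exists psi.
have [/super_models[a1 s1] j1] := red N1 T1.
have [/super_models[a2 s2] j2] := red N2 T2.
have r1 := spec_rep a1; have r2 := spec_rep a2.
have [s hs] := sat_matched r1 r2 (rep_supersys r1 s1) (rep_supersys r2 s2) phi.
have e1 := rep_embedding j1 r1; have e2 := rep_embedding j2 r2.
have [P [oP [f1 [p1 ad1 q1]]]] := finite_quotient e1 s.
have [f2 [p2 tr]] := transport e1 e2 p1 ad1.
have ad1' : adm oP (range (@spec_set d (reduct N1))) f1.
  by move=> p; have [m _ hm] := ad1 p; exists (named N1 m).
have ad2 : adm oP (range (@spec_set d (reduct N2))) f2.
  move=> p; have [m _ hm] := ad1 p; exists (named N2 m) => //.
  exact: (tr m [set q | ple oP q p]).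
have [||h _] := hs (Matching p1 p2 ad1' ad2) _ (@no_var N1) (@no_var N2) _.
- by move=> m /q1[A hA]; exists A; split=> //; apply: (tr m).
- by case.
exact: h.
Qed.

Theorem theorem8p3 (d : nat) :
  is_model_completion
    (theory_of (@is_super_scaled d))
    (theory_of (@is_subscaled d)).
Proof.
have emb (M : structure (L_SC d)) : models M (theory_of (@is_subscaled d)) ->
    exists (N : structure (L_SC d)) (j : M -> N),
      models N (theory_of (@is_super_scaled d)) /\ embedding j.
  move=> MT; have aM : subscaled_axioms M.
    by apply: (models_subscaled_axioms MT) => K /is_subscaled_axioms.
  have r := spec_rep aM.
  exists (limit_structure (spec_dpos aM) d), (limit_map r); split.
    by move=> phi; apply; apply: limit_super (rep_bound r).
  exact: limit_embedding.
split=> // [phi sphi N NT|M MT].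
  by apply: NT => K [[sK _] _ _]; apply: sphi.
split.
  have [N [j [NT ej]]] := emb M MT.
  by exists (expand j); apply: expand_models.
move=> phi; set T := _ `|` _.
(* One model refuting [phi] decides for all of them, by [elementary_equiv]. *)
have [[N NT nphi]|all] := pselect (exists2 N, models N T & ~ holds N phi).
  right=> K KT; rewrite /holds /= => Kphi; apply: nphi.
  exact: (elementary_equiv KT NT).
by left=> K KT; apply: contrapT => nphi; apply: all; exists K.
Qed.
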